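(* Let $(\Omega, \Sigma, \mu)$ be a measure space and let $1 < p < \infty$, $p \neq 2$. Let $(e^{tA})_{t \ge 0}$ be a $C_0$-semigroup with generator $A$ on $X = L^p(\Omega, \Sigma, \mu; \mathbb{R})$ which is uniformly asymptotically contractive. Suppose that at least one of the following holds: (i) $\omega(A) > -\infty$ and $(e^{tA})_{t\ge 0}$ is norm continuous at infinity; or (ii) $(e^{tA})_{t\ge 0}$ is eventually norm continuous. Then $e^{tA}$ converges strongly as $t \to \infty$.
   Context: Measure spaces are arbitrary (not necessarily $\sigma$-finite). $\omega(A)$ denotes the growth bound of the semigroup, i.e. the infimum of all $\omega \in \mathbb{R}$ for which there is $M \ge 1$ with $\|e^{tA}\| \le M e^{\omega t}$ for all $t \ge 0$. A $C_0$-semigroup with $\omega(A) > -\infty$ is called norm continuous at infinity if $$\lim_{t \to \infty} \limsup_{h \to 0} \|e^{(t+h)(A - \omega(A))} - e^{t(A - \omega(A))}\| = 0.$$ A $C_0$-semigroup is eventually norm continuous if there is $t_0 \ge 0$ such that $t \mapsto e^{tA}$ is continuous on $(t_0,\infty)$ with respect to the operator norm. It is called uniformly asymptotically contractive if $\limsup_{t \to \infty} \|e^{tA}\| \le 1$. *)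

(* Defs.v *)
From HB Require Import structures.
From mathcomp Require Import all_boot all_order all_algebra.
From mathcomp Require Import all_classical all_reals all_analysis.
From mathcomp Require Import measurable_realfun ess_sup_inf measurable_fun_approximation.

Set Implicit Arguments.
Unset Strict Implicit.
Unset Printing Implicit Defensive.
Import Order.TTheory GRing.Theory Num.Theory.
Import numFieldNormedType.Exports.
Local Open Scope classical_set_scope.
Local Open Scope ring_scope.

(** * The normed space structure of [LspaceType mu p1]

   The library provides the type of classes of p-integrable functions modulo
   equality almost everywhere, but neither its vector space structure nor its
   norm. Operations are computed on representatives. *)

Section Lspace.
Context d (T : measurableType d) (R : realType).
Variables (mu : {measure set T -> \bar R}) (p : \bar R) (p1 : (1 <= p)%E).

Local Notation Lfun := (LfunType mu p1).
Local Notation Lsp := (LspaceType mu p1).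

Lemma eq_ae_Lnorm (f g : T -> R) :
  measurable_fun setT f -> measurable_fun setT g -> f = g %[ae mu] ->
  'N[mu]_p[EFin \o f]%E = 'N[mu]_p[EFin \o g]%E.
Proof.
move=> mf mg fg; rewrite unlock /Lnorm; case: p p1 => [r|//|//] r1.
- have mX (h : T -> R) : measurable_fun setT h ->
      measurable_fun setT ((fun x => (`|(EFin \o h) x| `^ r)%E) : T -> \bar R).
    move=> mh.
    apply: (@measurableT_comp _ _ _ _ _ _ (fun x : \bar R => x `^ r)%E) => //=.
      exact: (measurableT_comp (measurable_poweR _)).
    by do 2 apply: measurableT_comp => //.
  congr (_ `^ _)%E; apply: ae_eq_integral => //; [exact: mX|exact: mX|].
  by apply: filterS fg => x /= H xT; rewrite H.
- case: ifP => // _; apply: eq_ess_sup.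
  by apply: filterS fg => x /= H; rewrite H.
Qed.

(* [R] and [measurableTypeR R] carry the same sigma-algebra, with different
   displays; [LfunType] uses the former and [LspaceType] the latter. *)
Lemma measurable_fun_measurableTypeR (f : T -> R) :
  @measurable_fun _ _ T (measurableTypeR R) setT f <->
  measurable_fun [set: T] f.
Proof. by split=> mf mT Y mY; exact: mf. Qed.

Lemma measurable_fun_mfun (f : {mfun T >-> measurableTypeR R}) :
  measurable_fun [set: T] (f : T -> R).
Proof.
by have /measurable_fun_measurableTypeR := @measurable_funPT _ _ _ _ f.
Qed.

Lemma Lspace_repr_subproof (f : Lsp) :
  (repr (LebesgueSpace.sort f) : T -> R) \in hoelder.Lfun mu p.
Proof.
apply/andP; split; rewrite inE/=; last by case: f => f [[]].
exact: measurable_fun_mfun.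
Qed.

Definition Lspace_repr (f : Lsp) : Lfun := Lfun_Sub p1 (Lspace_repr_subproof f).

Definition Lfun_mfun (f : Lfun) : {mfun T >-> measurableTypeR R} :=
  MeasurableFun.Pack (MeasurableFun.Class (isMeasurableFun.Build _ _ _ _
    (f : T -> measurableTypeR R)
    ((measurable_fun_measurableTypeR f).2 (measurable_funPT f)))).

Lemma repr_pi_ae (f : {mfun T >-> measurableTypeR R}) :
  (repr (\pi_({mfun_ mu, T >-> measurableTypeR R})%qT f) : T -> R) = f %[ae mu].
Proof.
have := reprK (\pi_({mfun_ mu, T >-> measurableTypeR R})%qT f).
by move=> /eqP; rewrite eqmodE => /asboolP.
Qed.

Lemma Lspace_pi_subproof (f : Lfun) : isFinLebesgue d T R mu p p1
  (\pi_({mfun_ mu, T >-> measurableTypeR R})%qT (Lfun_mfun f)).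
Proof.
constructor; rewrite /finite_norm.
rewrite (@eq_ae_Lnorm _ f) //; first exact: Lfunction_finite.
  exact: measurable_fun_mfun.
exact: repr_pi_ae.
Qed.

Definition Lspace_pi (f : Lfun) : Lsp :=
  LebesgueSpace.Pack (LebesgueSpace.Class (Lspace_pi_subproof f)).

Lemma Lspace_sort_inj : injective (fun f : Lsp => LebesgueSpace.sort f).
Proof.
move=> [f [[Hf]]] [g [[Hg]]] /= fg; subst g.
by rewrite (Prop_irrelevance Hf Hg).
Qed.

Lemma Lspace_pi_eqP (f g : Lfun) :
  Lspace_pi f = Lspace_pi g <-> (f : T -> R) = g %[ae mu].
Proof.
split=> [/(congr1 (fun f : Lsp => LebesgueSpace.sort f))/= /eqP|fg].
  by rewrite eqmodE => /asboolP.
by apply: Lspace_sort_inj => /=; apply/eqP; rewrite eqmodE; apply/asboolP.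
Qed.

Lemma Lspace_reprK f : Lspace_pi (Lspace_repr f) = f.
Proof.
apply: Lspace_sort_inj => /=; rewrite -[RHS]reprK.
by apply/eqP; rewrite eqmodE; apply/asboolP; exact: ae_eq_refl.
Qed.

Lemma Lspace_piK (f : Lfun) :
  (Lspace_repr (Lspace_pi f) : T -> R) = f %[ae mu].
Proof. exact/Lspace_pi_eqP/Lspace_reprK. Qed.

Definition Lspace_zero : Lsp := Lspace_pi 0.
Definition Lspace_opp (f : Lsp) : Lsp := Lspace_pi (- Lspace_repr f).
Definition Lspace_add (f g : Lsp) : Lsp :=
  Lspace_pi (Lspace_repr f + Lspace_repr g).
Definition Lspace_scale (a : R) (f : Lsp) : Lsp :=
  Lspace_pi (a *: Lspace_repr f).
Definition Lspace_norm (f : Lsp) : R :=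
  fine 'N[mu]_p[EFin \o Lspace_repr f]%E.

Lemma Lspace_oppE f : Lspace_opp (Lspace_pi f) = Lspace_pi (- f).
Proof.
apply/Lspace_pi_eqP; apply: filterS (Lspace_piK f) => x /(_ I) fE _.
by rewrite -[LHS]/(- (Lspace_repr (Lspace_pi f) x)) fE.
Qed.

Lemma Lspace_addE f g :
  Lspace_add (Lspace_pi f) (Lspace_pi g) = Lspace_pi (f + g).
Proof.
apply/Lspace_pi_eqP.
apply: filterS2 (Lspace_piK f) (Lspace_piK g) => x /(_ I) fE /(_ I) gE _.
by rewrite -[LHS]/(Lspace_repr (Lspace_pi f) x + Lspace_repr (Lspace_pi g) x)
  fE gE.
Qed.

Lemma Lspace_scaleE a f : Lspace_scale a (Lspace_pi f) = Lspace_pi (a *: f).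
Proof.
apply/Lspace_pi_eqP; apply: filterS (Lspace_piK f) => x /(_ I) fE _.
by rewrite -[LHS]/(a * Lspace_repr (Lspace_pi f) x) fE.
Qed.

Lemma Lspace_normE f : Lspace_norm (Lspace_pi f) = fine 'N[mu]_p[EFin \o f]%E.
Proof. by congr fine; apply: eq_ae_Lnorm => //; exact: Lspace_piK. Qed.

Let Lspace_ind (P : Lsp -> Prop) : (forall f, P (Lspace_pi f)) -> forall f, P f.
Proof. by move=> h f; rewrite -(Lspace_reprK f). Qed.

HB.instance Definition _ := gen_eqMixin Lsp.
HB.instance Definition _ := gen_choiceMixin Lsp.

Let Lspace_addA : associative Lspace_add.
Proof.
elim/Lspace_ind=> f; elim/Lspace_ind=> g; elim/Lspace_ind=> h.
by rewrite !Lspace_addE addrA.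
Qed.

Let Lspace_addC : commutative Lspace_add.
Proof.
by elim/Lspace_ind=> f; elim/Lspace_ind=> g; rewrite !Lspace_addE addrC.
Qed.

Let Lspace_add0 : left_id Lspace_zero Lspace_add.
Proof. by elim/Lspace_ind=> f; rewrite Lspace_addE add0r. Qed.

Let Lspace_addN : left_inverse Lspace_zero Lspace_opp Lspace_add.
Proof. by elim/Lspace_ind=> f; rewrite Lspace_oppE Lspace_addE addNr. Qed.

HB.instance Definition _ := GRing.isZmodule.Build Lsp
  Lspace_addA Lspace_addC Lspace_add0 Lspace_addN.

Lemma Lspace_piD : {morph Lspace_pi : f g / f + g}.
Proof. by move=> f g; rewrite -Lspace_addE. Qed.

Let Lspace_scaleA a b f :
  Lspace_scale a (Lspace_scale b f) = Lspace_scale (a * b) f.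
Proof. by elim/Lspace_ind: f => f; rewrite !Lspace_scaleE scalerA. Qed.

Let Lspace_scale1 : left_id 1 Lspace_scale.
Proof. by elim/Lspace_ind=> f; rewrite Lspace_scaleE scale1r. Qed.

Let Lspace_scaleDr : right_distributive Lspace_scale +%R.
Proof.
move=> a; elim/Lspace_ind=> f; elim/Lspace_ind=> g.
by rewrite -Lspace_piD !Lspace_scaleE scalerDr Lspace_piD.
Qed.

Let Lspace_scaleDl f : {morph Lspace_scale^~ f : a b / a + b}.
Proof.
elim/Lspace_ind: f => f a b.
by rewrite !Lspace_scaleE scalerDl Lspace_piD.
Qed.

HB.instance Definition _ := GRing.Zmodule_isLmodule.Build R Lsp
  Lspace_scaleA Lspace_scale1 Lspace_scaleDr Lspace_scaleDl.

Lemma Lspace_piZ a : {morph Lspace_pi : f / a *: f}.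
Proof. by move=> f; rewrite -Lspace_scaleE. Qed.

Let Lspace_normD f g : Lspace_norm (f + g) <= Lspace_norm f + Lspace_norm g.
Proof.
elim/Lspace_ind: f => f; elim/Lspace_ind: g => g.
rewrite -Lspace_piD !Lspace_normE; exact: ler_LnormD.
Qed.

Let Lspace_normZ a f : Lspace_norm (a *: f) = `|a| * Lspace_norm f.
Proof.
elim/Lspace_ind: f => f; rewrite -Lspace_piZ !Lspace_normE.
by apply: EFin_inj; rewrite EFinM !finite_norm_fine LnormZ.
Qed.

Let Lspace_norm0_eq0 f : Lspace_norm f = 0 -> f = 0.
Proof.
elim/Lspace_ind: f => f; rewrite Lspace_normE => /fine_Lnormr_eq0 f0.
exact/Lspace_pi_eqP.
Qed.

HB.instance Definition _ := Lmodule_isNormed.Build R Lsp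
  Lspace_normD Lspace_normZ Lspace_norm0_eq0.

Lemma Lspace_normrE (f : Lfun) : `|Lspace_pi f| = fine 'N[mu]_p[EFin \o f]%E.
Proof. exact: Lspace_normE. Qed.

End Lspace.

(** * Strongly continuous semigroups *)

Section Semigroup.
Context (R : realType) (X : normedModType R).

(* Operator norm, in [\bar R] so that it makes sense for unbounded maps too. *)
Definition opnorm (f : X -> X) : \bar R :=
  ereal_sup [set `|f x|%:E | x in [set x | `|x| <= 1]].

(* Only the values of [S] at nonnegative times are relevant. *)
Implicit Type S : R -> {linear X -> X}.

Record C0_semigroup S : Prop := {
  C0_bounded : forall t, 0 <= t -> continuous (S t) ;
  C0_id : forall x, S 0 x = x ;
  C0_add : forall s t, 0 <= s -> 0 <= t -> forall x, S (s + t) x = S s (S t x) ;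
  C0_cvg : forall x, S h x @[h --> 0^'+] --> x }.

(* The generator is an unbounded operator, given here by its graph. *)
Definition generator S : set (X * X) :=
  [set xy | h^-1 *: (S h xy.1 - xy.1) @[h --> 0^'+] --> xy.2].

Definition growth_bound S : \bar R :=
  ereal_inf [set w%:E | w in [set w : R | exists2 M : R, 1 <= M &
    forall t, 0 <= t -> (opnorm (S t) <= (M * expR (w * t))%:E)%E]].

(* The semigroup generated by [A - w], where [A] is the generator of [S]. *)
Definition rescaled S (w : R) (t : R) (x : X) : X := expR (- (w * t)) *: S t x.

(* [fine] is harmless: the growth bound of a C0-semigroup is never [+oo], and
   the notion is only used together with [-oo < growth_bound S]. *)
Definition norm_continuous_at_infinity S : Prop :=
  let U := rescaled S (fine (growth_bound S)) in
  lime_sup (fun h => opnorm (U (t + h) \- U t)) 0 @[t --> +oo] --> 0%E.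

Definition eventually_norm_continuous S : Prop :=
  exists2 t0 : R, 0 <= t0 &
    forall t, t0 < t -> opnorm (S s \- S t) @[s --> t] --> 0%E.

Definition uniformly_asymptotically_contractive S : Prop :=
  (limf_esup (fun t => opnorm (S t)) +oo_R <= 1)%E.

Definition converges_strongly S : Prop :=
  exists2 P : {linear X -> X}, continuous P &
    forall x, S t x @[t --> +oo] --> P x.

End Semigroup.

Lemma lt1_le1e (R : realType) (p : R) : 1 < p -> (1 <= p%:E)%E.
Proof. by move=> /ltW; rewrite lee_fin. Qed.

(* Main.v *)
Require Import Defs.
From HB Require Import structures.
From mathcomp Require Import all_boot all_order all_algebra.
From mathcomp Require Import all_classical all_reals all_analysis.
From mathcomp Require Import measurable_realfun measurable_fun_approximation.
From mathcomp Require Import zify ring lra.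
Import Order.TTheory GRing.Theory Num.Theory.
Import numFieldNormedType.Exports.
Set Implicit Arguments.
Unset Strict Implicit.
Unset Printing Implicit Defensive.
Local Open Scope classical_set_scope.
Local Open Scope ring_scope.

(** Let [N Q] be the limit of the norms of [T r Q] as [r] grows, an algebra seminorm on
   polynomials in the semigroup [T]. The two continuity hypotheses only enter through
   [N (T h - 1) -> 0] as [h] tends to [0]. The core of the proof is [N (T t - 1) = 0] for all
   [t]. If [N ((T t - 1)^2) <= 2] for all [t], this follows from algebraic identities for
   [T (2 t)]. Otherwise there is a first time [t] at which [N ((T t - 1)^2) = 2], and uniform
   convexity turns this into approximate antiperiodic vectors: unit vectors [y] with
   [Z^4 y + y] small, where [Z = T (t / 2)]. Since [N ((Z - 1)^2) <= 2], the factor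
   [Z^2 + sqrt 2 Z + 1] of [Z^4 + 1] is bounded below, so the orbits [Z^i y] and their images
   under the duality map [J] almost satisfy [x_i + x_(i+2) = sqrt 2 x_(i+1)]. As [J] is
   homogeneous of degree [p - 1], for [p <> 2] this forces [|x_0|] and [|x_2|], and also
   [|x_0 + x_2|] and [|x_0 - x_2|], to be close in L^p, whence [x_0] is close to [0].
   Finally, [N (T t - 1) = 0] makes the closed convex set of the vectors asymptotic to [x]
   invariant; its element of minimal norm is then the limit of [T t x]. *)

(** The threshold 2 comes from [(W^2 - 1)^2 = (W - 1)^4 + 4 W (W - 1)^2] with [W = T t]. If
    [N ((W - 1)^2) <= c] at all times, the identity improves [c] to [(c + c^2) / 4], which is at
    most [3 c / 4] for [c <= 2]. If the value 2 is attained at [t], the right side has seminorm at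
    least [8 - 4 = 4], the largest value possible for [(W^2 - 1)^2], so that [y] and [- T (2 t) y]
    are almost extremal. The resulting relation [W^2 y = - y] is in itself no contradiction: the
    quarter turn [(a, b) |-> (- b, a)] is an isometry of every l^p. An eighth turn is not, unless
    [p = 2], hence the half step [Z = T (t / 2)]. Among the roots of [z^4 = -1] the bound on
    [(Z - 1)^2] leaves only those of angle [pi / 4] up to sign, since [|z - 1|^2 = 2 + sqrt 2] at
    the others. Exact antiperiodic vectors need not exist. Sequences of approximate ones, compared
    up to null sequences, take their place, and functionals are compared up to errors that are null
    in norm. *)

Lemma geometric_shrink (R : realType) (P : R -> Prop) (l c0 : R) :
  0 <= l -> l < 1 -> 0 <= c0 -> P c0 ->
  (forall c c', c <= c' -> P c -> P c') ->
  (forall c, 0 <= c -> c <= c0 -> P c -> P (l * c)) ->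
  forall e, 0 < e -> P e.
Proof.
move=> l0 l1 c00 Pc0 Pmono Pl e e0.
have Pn n : P (l ^+ n * c0).
  elim: n => [|n IHn]; first by rewrite mul1r.
  rewrite exprS -mulrA; apply: Pl => //; first by rewrite mulr_ge0 ?exprn_ge0.
  by rewrite ler_piMl// exprn_ile1// ltW.
have /cvgrPdist_lt/(_ e e0) : (fun n => c0 * l ^+ n) @ \oo --> 0.
  by apply: cvg_geometric; rewrite ger0_norm.
case=> N _ /(_ N (leqnn N)) /=; rewrite sub0r normrN => ce.
apply: Pmono (Pn N); apply/ltW/(le_lt_trans _ ce).
by rewrite mulrC ler_norm.
Qed.

(** * Asymptotic operator bounds along a semigroup *)

Section asymptotic_bound.
Context (R : realType) (X : normedModType R) (T : R -> {linear X -> X}).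

(* [asbound c Q] says that the upper limit of the norms of [T r Q] is at most [c]. *)
Definition asbound (c : R) (Q : X -> X) := forall e : R, 0 < e ->
  exists2 r0, 0 <= r0 &
    forall r, r0 <= r -> forall x, `|T r (Q x)| <= (c + e) * `|x|.

Lemma le_asbound c c' Q : c <= c' -> asbound c Q -> asbound c' Q.
Proof.
move=> cc' Qc e e0; have [r0 r00 Hr] := Qc e e0; exists r0 => // r r0r x.
by apply: le_trans (Hr r r0r x) _; rewrite ler_wpM2r// lerD2r.
Qed.

Lemma asbound_closed c Q : (forall e, 0 < e -> asbound (c + e) Q) -> asbound c Q.
Proof.
move=> Qc e e0; have e20 : 0 < e / 2 by rewrite divr_gt0.
have [r0 r00 Hr] := Qc _ e20 _ e20; exists r0 => // r r0r x.
by apply: le_trans (Hr r r0r x) _; rewrite -addrA -splitr.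
Qed.

Lemma eq_asbound c P Q : P =1 Q -> asbound c P -> asbound c Q.
Proof.
move=> PQ Pc e e0; have [r0 r00 Hr] := Pc e e0; exists r0 => // r r0r x.
by rewrite -PQ; exact: Hr.
Qed.

Lemma asboundD c c' P Q : asbound c P -> asbound c' Q ->
  asbound (c + c') (fun x => P x + Q x).
Proof.
move=> Pc Qc e e0; have e20 : 0 < e / 2 by rewrite divr_gt0.
have [r0 r00 Hr] := Pc _ e20; have [s0 s00 Hs] := Qc _ e20.
exists (Num.max r0 s0); first by rewrite le_max r00.
move=> r; rewrite ge_max => /andP[r0r s0r] x; rewrite linearD.
apply: le_trans (ler_normD _ _) _.
rewrite [e]splitr addrACA [X in _ <= X]mulrDl.
by apply: lerD; [exact: Hr|exact: Hs].
Qed.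

Lemma asboundZ a c Q : asbound c Q -> asbound (`|a| * c) (fun x => a *: Q x).
Proof.
move=> Qc e e0.
have a10 : 0 < `|a| + 1 by rewrite ltr_wpDl.
have [r0 r00 Hr] := Qc (e / (`|a| + 1)) ltac:(by rewrite divr_gt0).
exists r0 => // r r0r x; rewrite linearZ normrZ.
apply: le_trans (_ : _ <= `|a| * ((c + e / (`|a| + 1)) * `|x|)) _.
  by apply: ler_wpM2l => //; exact: Hr.
rewrite mulrA ler_wpM2r// mulrDr lerD2l mulrCA ler_piMr ?(ltW e0)//.
by rewrite ler_pdivrMr// mul1r lerDl.
Qed.

Lemma asboundB c c' P Q : asbound c P -> asbound c' Q ->
  asbound (c + c') (fun x => P x - Q x).
Proof.
move=> Pc Qc; have := asboundD Pc (asboundZ (-1) Qc).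
rewrite normrN normr1 mul1r; apply: eq_asbound => x.
by rewrite scaleN1r.
Qed.

Hypothesis T_add : forall s t : R, 0 <= s -> 0 <= t ->
  forall x, T (s + t) x = T s (T t x).

Lemma semigroupC s t : 0 <= s -> 0 <= t -> forall x, T s (T t x) = T t (T s x).
Proof. by move=> s0 t0 x; rewrite -!T_add// addrC. Qed.

(** The time is split as [(r - s0) + s0]: the part [s0] is spent on [Q], and since [P] commutes with
    the semigroup, the part [r - s0] remains for [P]. *)
Lemma asbound_comp c c' P Q : 0 <= c -> 0 <= c' ->
  (forall r, 0 <= r -> forall x, T r (P x) = P (T r x)) ->
  asbound c P -> asbound c' Q -> asbound (c * c') (P \o Q).
Proof.
move=> c0 c'0 TP Pc Qc e e0.
have [d d0 cd] : exists2 d, 0 < d & (c + d) * (c' + d) <= c * c' + e.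
  have k0 : 0 < c + c' + 1 by rewrite ltr_wpDl// addr_ge0.
  exists (Num.min 1 (e / (c + c' + 1))); first by rewrite lt_min ltr01 divr_gt0.
  set d := Num.min _ _.
  have d1 : d <= 1 by rewrite ge_min lexx.
  have d0 : 0 <= d by rewrite le_min ler01 divr_ge0// ltW.
  have : d * (c + c' + 1) <= e by rewrite -ler_pdivlMr// ge_min lexx orbT.
  nra.
have [r0 r00 Hr] := Pc _ d0; have [s0 s00 Hs] := Qc _ d0.
exists (r0 + s0); first by rewrite addr_ge0.
move=> r r0r x.
have rs0 : 0 <= r - s0 by rewrite subr_ge0 (le_trans _ r0r)// lerDr.
rewrite -(subrK s0 r) T_add//= TP//.
have rr0 : r0 <= r - s0 by rewrite lerBrDr.
apply: le_trans (Hr _ rr0 _) _.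
apply: le_trans (_ : _ <= (c + d) * ((c' + d) * `|x|)) _.
  by apply: ler_wpM2l; [rewrite addr_ge0// ltW|exact: Hs].
by rewrite mulrA ler_wpM2r.
Qed.

Hypothesis T_contr : forall e : R, 0 < e -> exists2 r0, 0 <= r0 &
  forall r, r0 <= r -> forall x, `|T r x| <= (1 + e) * `|x|.

(** One time suffices, because whatever follows it is asymptotically contractive: the upper limit of
    the norms is bounded by each single norm. *)
Lemma asbound_at r c Q : 0 <= r -> 0 <= c ->
  (forall x, `|T r (Q x)| <= c * `|x|) -> asbound c Q.
Proof.
move=> r0 c0 Hr e e0.
have c10 : 0 < c + 1 by rewrite ltr_wpDl.
have [s0 s00 Hs] := T_contr (e := e / (c + 1)) ltac:(by rewrite divr_gt0).
exists (s0 + r); first by rewrite addr_ge0.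
move=> s sr x.
have s0sr : s0 <= s - r by rewrite lerBrDr.
rewrite -(subrK r s) T_add//; last exact: le_trans s0sr.
apply: le_trans (Hs _ s0sr _) _.
apply: le_trans (_ : _ <= (1 + e / (c + 1)) * (c * `|x|)) _.
  by apply: ler_wpM2l; rewrite ?Hr// addr_ge0// divr_ge0// ltW.
rewrite mulrA ler_wpM2r// mulrDl mul1r lerD2l -mulrA ler_piMr ?(ltW e0)//.
by rewrite mulrC ler_pdivrMr// mul1r lerDl.
Qed.

Lemma asbound_T t : 0 <= t -> asbound 1 (T t).
Proof.
move=> t0 e e0; have [r0 r00 Hr] := T_contr e0; exists r0 => // r r0r x.
have r0' : 0 <= r by exact: le_trans r0r.
rewrite -T_add//; apply: Hr.
by rewrite (le_trans r0r)// lerDl.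
Qed.

Lemma asbound_id : asbound 1 id.
Proof. exact: T_contr. Qed.

Definition incr t : {linear X -> X} := T t \- idfun.

Lemma incrE t x : incr t x = T t x - x. Proof. by []. Qed.

Lemma incrC r t : 0 <= r -> 0 <= t -> forall x, T r (incr t x) = incr t (T r x).
Proof. by move=> r0 t0 x; rewrite !incrE linearB semigroupC. Qed.

Lemma incr2C r t : 0 <= r -> 0 <= t ->
  forall x, T r (incr t (incr t x)) = incr t (incr t (T r x)).
Proof. by move=> r0 t0 x; rewrite !incrC. Qed.

Lemma asbound_incr t : 0 <= t -> asbound 2 (incr t).
Proof. by move=> t0; apply: asboundB (asbound_T t0) asbound_id. Qed.

Lemma incr_double t : 0 <= t -> forall x,
  incr (t + t) x = incr t (incr t x) + 2 *: incr t x.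
Proof.
move=> t0 x; rewrite scaler_nat mulr2n addrA [incr t (incr t x)]incrE subrK.
by rewrite !incrE linearB/= -T_add// addrA subrK.
Qed.

(* (W^2 - 1)^2 = (W - 1)^4 + 4 W (W - 1)^2, and the factor [W = T t] is invisible to [asbound]. *)
Lemma incr2_double t : 0 <= t -> forall x,
  incr (t + t) (incr (t + t) x) =
  incr t (incr t (incr t (incr t x))) + 4 *: T t (incr t (incr t x)).
Proof.
move=> t0 x; have -> y : T t y = incr t y + y by rewrite incrE subrK.
rewrite [incr (t + t) x]incr_double// incr_double//; move: (incr t) => D.
rewrite !linearD/= !linearZ/= scalerA -!addrA; congr +%R.
rewrite addrA -scalerDl; congr (_ *: _ + _ *: _).
all: ring.
Qed.

Lemma asbound_incr2_double c k t : 0 <= t -> 0 <= k ->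
  asbound c (incr (t + t) \o incr (t + t)) ->
  asbound k (incr t \o incr t) -> asbound ((c + k * k) / 4) (incr t \o incr t).
Proof.
move=> t0 k0 c2t kt.
have k2 := asbound_comp k0 k0 (fun r r0 => incr2C r0 t0) kt kt.
have := asboundZ 4^-1 (asboundB c2t k2).
have -> : `|4^-1| * (c + k * k) = (c + k * k) / 4.
  by rewrite mulrC ger0_norm.
move=> H e e0; have [r0 r00 Hr] := H _ e0.
exists (r0 + t); first by rewrite addr_ge0.
move=> r; rewrite -lerBrDr => r0r x.
have := Hr _ r0r x.
rewrite (incr2_double t0 x : (incr (t + t) \o incr (t + t)) x = _).
rewrite [X in _ *: X]addrC addKr scalerA mulVf// scale1r.
by rewrite -T_add ?subrK// (le_trans r00).
Qed.

(** All times are treated at once, since the bound at [t] is improved by means of the bound at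
    [2 t]. Once the squares have bound 0, [2 (T t - 1) = (T (2 t) - 1) - (T t - 1)^2] halves the
    bound on the increments at each round. *)
Lemma asbound0_incr : (forall t, 0 <= t -> asbound 2 (incr t \o incr t)) ->
  forall t, 0 <= t -> asbound 0 (incr t).
Proof.
move=> bnd2.
have bnd0 t : 0 <= t -> asbound 0 (incr t \o incr t).
  move=> t0; apply: asbound_closed => e e0; rewrite add0r; move: t t0.
  pose P c := forall t, 0 <= t -> asbound c (incr t \o incr t).
  apply: (@geometric_shrink _ P (3 / 4) 2) => //; rewrite ?/P; try lra.
    by move=> c c' cc' Pc t t0; apply: le_asbound (Pc t t0).
  move=> c c0 c2 Pc t t0.
  apply: le_asbound (asbound_incr2_double t0 c0 (Pc _ (addr_ge0 t0 t0)) (Pc _ t0)).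
  nra.
move=> t t0; apply: asbound_closed => e e0; rewrite add0r; move: t t0.
pose P c := forall t, 0 <= t -> asbound c (incr t).
apply: (@geometric_shrink _ P 2^-1 2) => //; rewrite ?/P; try lra.
- exact: asbound_incr.
- by move=> c c' cc' Pc t t0; apply: le_asbound (Pc t t0).
move=> c c0 c2 Pc t t0.
have := asboundZ 2^-1 (asboundB (Pc _ (addr_ge0 t0 t0)) (bnd0 _ t0)).
rewrite addr0 ger0_norm//; apply: eq_asbound => x.
by rewrite (incr_double t0 x) [X in _ *: X]addrC addKr scalerA mulVf// scale1r.
Qed.

Lemma incrD s h : 0 <= s -> 0 <= h ->
  forall x, incr (s + h) x = incr s x + T s (incr h x).
Proof.
move=> s0 h0 x; rewrite !incrE linearB -T_add//.
by rewrite [RHS]addrC addrA subrK.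
Qed.

(** The difference of squares factors as [(incr (s + h) + incr s) \o T s \o incr h], and each of the
    two summands has asymptotic norm at most 2. *)
Lemma asbound_incr2_diff e s h : 0 <= s -> 0 <= h -> 0 <= e ->
  asbound e (incr h) ->
  asbound (4 * e) (fun x => incr (s + h) (incr (s + h) x) - incr s (incr s x)).
Proof.
move=> s0 h0 e0 he; have sh0 := addr_ge0 s0 h0.
have Esh := asbound_comp ler01 e0 (fun r r0 => semigroupC r0 s0) (asbound_T s0) he.
rewrite mul1r in Esh.
have := asboundD (asbound_comp (ler0n R 2) e0 (fun r r0 => incrC r0 sh0) (asbound_incr sh0) Esh)
  (asbound_comp (ler0n R 2) e0 (fun r r0 => incrC r0 s0) (asbound_incr s0) Esh).
rewrite -mulrDl -natrD; apply: eq_asbound => x.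
rewrite -[LHS]/(incr (s + h) (T s (incr h x)) + incr s (T s (incr h x))).
have -> : T s (incr h x) = incr (s + h) x - incr s x.
  by rewrite incrD// addrC addKr.
have incrCC : incr s (incr (s + h) x) = incr (s + h) (incr s x).
  by rewrite [in RHS]incrE linearB -incrC.
rewrite (linearB (incr (s + h))) (linearB (incr s)) incrCC.
by rewrite addrA subrK.
Qed.

(** The time is the supremum of those up to which the bound 2 holds. By [asbound_incr2_diff] the
    bound varies continuously, so it persists at the supremum, while a bound strictly below 2 there
    would extend beyond it. The supremum is not 0, where the bound is 0. *)
Lemma asbound_first_time :
  (forall x, T 0 x = x) ->
  (forall e : R, 0 < e -> exists2 h0, 0 < h0 &
    forall h, 0 < h -> h < h0 -> asbound e (incr h)) ->
  (exists2 u, 0 <= u & ~ asbound 2 (incr u \o incr u)) ->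
  exists t, [/\ 0 < t, forall s, 0 <= s -> s <= t -> asbound 2 (incr s \o incr s) &
    forall c, asbound c (incr t \o incr t) -> 2 <= c].
Proof.
move=> T0 Tcont [u u0 Bu].
have shift_r c e s h : 0 <= s -> 0 <= h -> 0 <= e -> asbound e (incr h) ->
    asbound c (incr s \o incr s) -> asbound (c + 4 * e) (incr (s + h) \o incr (s + h)).
  move=> s0 h0 e0 he sc.
  apply: eq_asbound (asboundD sc (asbound_incr2_diff s0 h0 e0 he)) => x.
  by rewrite addrC subrK.
pose A := [set t | 0 <= t /\ forall s, 0 <= s -> s <= t -> asbound 2 (incr s \o incr s)].
have B0 : asbound 0 (incr 0 \o incr 0).
  move=> e e0; exists 0 => // r r0 x.
  by rewrite [(_ \o _) x]incrE !T0 !subrr raddf0 normr0 add0r mulr_ge0// ltW.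
have A0 : A 0.
  split=> // s s0 s0'; have -> : s = 0 by apply/le_anti/andP.
  exact: le_asbound B0.
have Au t : A t -> t <= u.
  by move=> [t0 At]; rewrite leNgt; apply/negP => /ltW tu; exact: Bu (At _ u0 tu).
have Asup : has_sup A by split; [exists 0|exists u].
have t0 : 0 <= sup A by apply: ub_le_sup => //; exists u.
have Blt s : 0 <= s -> s < sup A -> asbound 2 (incr s \o incr s).
  move=> s0 /sup_gt[|a Aa sa]; first by exists 0.
  by apply: Aa.2 => //; exact: ltW.
have Bsup : asbound 2 (incr (sup A) \o incr (sup A)).
  have [<-|t_gt0] := eqVneq 0 (sup A); first exact: le_asbound B0.
  have {}t_gt0 : 0 < sup A by rewrite lt_neqAle t_gt0.
  apply: asbound_closed => e e0.
  have [h0 h00 Hh] := Tcont (e / 4) (divr_gt0 e0 (ltr0n _ 4)).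
  pose h := Num.min (sup A) (h0 / 2).
  have hpos : 0 < h by rewrite lt_min t_gt0 divr_gt0.
  have hh0 : h < h0 by rewrite gt_min ltr_pdivrMr// ltr_pMr// ltr1n orbT.
  have sh : 0 <= sup A - h by rewrite subr_ge0 ge_min lexx.
  have := shift_r 2 (e / 4) _ h sh (ltW hpos) (ltW (divr_gt0 e0 (ltr0n _ 4))) (Hh _ hpos hh0).
  by rewrite subrK mulrC divfK//; apply; apply: Blt => //; rewrite ltrBlDr ltrDl.
have Ble s : 0 <= s -> s <= sup A -> asbound 2 (incr s \o incr s).
  by move=> s0; rewrite le_eqVlt => /predU1P[->//|]; exact: Blt.
have Bge c : asbound c (incr (sup A) \o incr (sup A)) -> 2 <= c.
  move=> Bc; rewrite leNgt; apply/negP => c2.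
  have e0 : 0 < (2 - c) / 4 by rewrite divr_gt0// subr_gt0.
  have [h0 h00 Hh] := Tcont _ e0.
  have h20 : 0 < h0 / 2 by rewrite divr_gt0.
  have : A (sup A + h0 / 2).
    split=> [|s s0 st]; first by rewrite addr_ge0// ltW.
    have [sA|sA] := leP s (sup A); first exact: Ble.
    have -> : s = sup A + (s - sup A) by rewrite addrC subrK.
    apply: (@le_asbound (c + 4 * ((2 - c) / 4))); first by lra.
    apply: shift_r => //; first by rewrite subr_ge0 ltW.
      exact: ltW.
    by apply: Hh; [rewrite subr_gt0|lra].
  move=> /(sup_upper_bound Asup); rewrite gerDl leNgt => /negP; exact.
exists (sup A); split=> //.
rewrite lt_neqAle t0 andbT; apply/eqP => A00.
by have := Bge 0; rewrite -A00 => /(_ B0); rewrite leNgt ltr0n.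
Qed.

(** The vector is [y = T (r + r) x], where [x] almost attains the seminorm 2. Its two factors [T r]
    make the asymptotic bound effective for each of the two squares in [(T t - 1)^4]. *)
Lemma asbound_incr2_antiperiodic t :
  (forall e : R, 0 < e -> exists2 d, 0 < d & forall u v : X,
    `|u| <= 1 + d -> `|v| <= 1 + d -> 2 - d <= `|u + v| -> `|u - v| <= e) ->
  0 <= t -> asbound 2 (incr t \o incr t) ->
  (forall c, asbound c (incr t \o incr t) -> 2 <= c) ->
  forall e, 0 < e -> exists2 y : X, `|y| = 1 & `|T (t + t) y + y| <= e.
Proof.
move=> Xuc t0 B2 Bge e0 e0_gt0.
have [d d0 dP] := Xuc (e0 / 2) (divr_gt0 e0_gt0 (ltr0n _ 2)).
(* The defect passed to uniform convexity is [10 e + e * e <= 13 e <= d]; [e <= 1 / 24] keeps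
   [|y| >= n / 2], so that normalising [y] costs at most a factor 2. *)
pose e := Num.min (1 / 24) (d / 13).
have e_gt0 : 0 < e by rewrite lt_min !divr_gt0.
have e1 : e <= 1 / 24 by rewrite ge_min lexx.
have ed : 13 * e <= d.
  by rewrite mulrC -ler_pdivlMr// ge_min lexx orbT.
have [r0 r00 Hr0] := T_contr e_gt0.
have [s0 s00 Hs0] := B2 _ e_gt0.
pose r := Num.max r0 s0.
have r0r : r0 <= r by rewrite le_max lexx.
have s0r : s0 <= r by rewrite le_max lexx orbT.
have rpos : 0 <= r by exact: le_trans r0r.
have rtpos : 0 <= r + (r + t) by rewrite !addr_ge0.
(* Otherwise this single time would already give the asymptotic bound [2 - e]. *)
have [x xbig] : exists x, (2 - e) * `|x| < `|T (r + (r + t)) (incr t (incr t x))|.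
  apply: contrapT => /forallNP H.
  have : asbound (2 - e) (incr t \o incr t).
    apply: (asbound_at rtpos); first lra.
    by move=> x; rewrite leNgt; apply/negP; exact: H.
  by move=> /Bge; rewrite lerBrDr gerDl leNgt e_gt0.
pose n := `|x|; pose y := T (r + r) x.
have n0 : 0 < n.
  rewrite lt_neqAle normr_ge0 andbT eq_sym; apply/eqP => /normr0_eq0 xn0.
  by move: xbig; rewrite xn0 !raddf0 normr0 mulr0 ltxx.
have Tle s : r0 <= s -> `|T s x| <= (1 + e) * n by move=> /Hr0; exact.
have y1 : `|y| <= (1 + e) * n by apply: Tle; rewrite (le_trans r0r)// lerDl.
have y2 : `|T (t + t) y| <= (1 + e) * n.
  by rewrite /y -T_add ?addr_ge0//; apply: Tle; lra.
have y4 : `|T (t + t) (T (t + t) y)| <= (1 + e) * n.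
  by rewrite /y -!T_add ?addr_ge0//; apply: Tle; lra.
have D4 : `|incr t (incr t (incr t (incr t y)))| <= (2 + e) * ((2 + e) * n).
  rewrite /y T_add// -incr2C// -incr2C// -incr2C//.
  apply: le_trans (Hs0 _ s0r _) _; apply: ler_wpM2l; first lra.
  exact: Hs0.
have D2 : (2 - e) * n <= `|T t (incr t (incr t y))|.
  apply: ltW; rewrite /y -incr2C ?addr_ge0// -T_add ?addr_ge0//.
  by have -> : t + (r + r) = r + (r + t) by ring.
(* The constant is [4 (2 - e) - (2 + e)^2]. *)
have big : (4 - 8 * e - e * e) * n <= `|incr (t + t) (incr (t + t) y)|.
  rewrite incr2_double// [_ + 4 *: _]addrC.
  have := lerB_normD (4 *: T t (incr t (incr t y))) (incr t (incr t (incr t (incr t y)))).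
  rewrite normrZ normr_nat; lra.
pose u := n^-1 *: y; pose v := - (n^-1 *: T (t + t) y).
have nZ z : `|n^-1 *: z| = `|z| / n by rewrite normrZ ger0_norm ?invr_ge0 1?ltW// mulrC.
(* The vector of [big] is a sum of two differences; the first has norm at most [2 (1 + e) n], so the
   second carries the rest. *)
have ybig : (2 - 10 * e - e * e) * n <= `|y - T (t + t) y|.
  have Ey : incr (t + t) (incr (t + t) y) =
      (T (t + t) (T (t + t) y) - T (t + t) y) + (y - T (t + t) y).
    by rewrite [LHS]incrE linearB -[y - _]opprB.
  have := ler_normD (T (t + t) (T (t + t) y) - T (t + t) y) (y - T (t + t) y).
  have := ler_normB (T (t + t) (T (t + t) y)) (T (t + t) y).
  by rewrite -Ey; lra.
have en0 : 0 <= e * n by rewrite mulr_ge0// ltW.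
have en : e * n <= n / 24.
  by rewrite mulrC; apply: ler_wpM2l; [exact: ltW|lra].
have een : e * e * n <= e * n / 24.
  by rewrite -mulrA [e * (e * n)]mulrC; apply: ler_wpM2l; [rewrite mulr_ge0// ltW|lra].
have dn : 13 * e * n <= d * n by apply: ler_wpM2r => //; exact: ltW.
have y0 : n / 2 <= `|y|.
  have := ler_normB y (T (t + t) y); lra.
have /dP : `|u| <= 1 + d by rewrite nZ ler_pdivrMr//; lra.
move=> /(_ v); rewrite normrN nZ ler_pdivrMr//.
rewrite -scalerBr nZ ler_pdivlMr// opprK -scalerDr nZ ler_pdivrMr//.
move=> /(_ ltac:(lra) ltac:(lra)) small.
have y_gt0 : 0 < `|y| by apply: lt_le_trans y0; rewrite divr_gt0.
exists (`|y|^-1 *: y).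
  by rewrite normrZ normfV normr_id mulVf// gt_eqF.
rewrite linearZ -scalerDr normrZ normfV normr_id mulrC ler_pdivrMr//.
rewrite addrC; apply: (le_trans small).
have : e0 / 2 * n = e0 * (n / 2) by ring.
by move=> ->; apply: ler_wpM2l => //; exact: ltW.
Qed.

End asymptotic_bound.

(** * Sequences of functionals up to errors that are null in norm *)

Section functional_sequences.
Context (R : realType) (X : normedModType R).
Implicit Types F G H : nat -> X -> R.

Definition fbounded (c : R) F := forall e : R, 0 < e ->
  \forall n \near \oo, forall z, `|F n z| <= (c + e) * `|z|.

Definition fequiv F G := fbounded 0 (fun n z => F n z - G n z).

Lemma eq_fbounded c F G : (forall n, F n =1 G n) -> fbounded c F -> fbounded c G.
Proof.
move=> FG Fc e /Fc; apply: filterS => n Hn z; rewrite -FG; exact: Hn.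
Qed.

Lemma le_fbounded c c' F : c <= c' -> fbounded c F -> fbounded c' F.
Proof.
move=> cc' Fc e /Fc; apply: filterS => n Hn z; apply: (le_trans (Hn z)).
by rewrite ler_wpM2r// lerD2r.
Qed.

Lemma fboundedD c c' F G : fbounded c F -> fbounded c' G ->
  fbounded (c + c') (fun n z => F n z + G n z).
Proof.
move=> Fc Gc e e0; have e20 : 0 < e / 2 by rewrite divr_gt0.
apply: filterS2 (Fc _ e20) (Gc _ e20) => n Hn Kn z.
apply: (le_trans (ler_normD _ _)).
by rewrite [e]splitr addrACA [X in _ <= X]mulrDl lerD.
Qed.

Lemma fboundedZ a c F : fbounded c F -> fbounded (`|a| * c) (fun n z => a * F n z).
Proof.
move=> Fc e e0; have a10 : 0 < `|a| + 1 by rewrite ltr_wpDl.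
have : 0 < e / (`|a| + 1) by rewrite divr_gt0.
move=> /Fc; apply: filterS => n Hn z; rewrite normrM.
apply: (le_trans (ler_wpM2l _ (Hn z))) => //.
rewrite mulrA ler_wpM2r// mulrDr lerD2l mulrCA ler_piMr ?(ltW e0)//.
by rewrite ler_pdivrMr// mul1r lerDl.
Qed.

Lemma fboundedB c c' F G : fbounded c F -> fbounded c' G ->
  fbounded (c + c') (fun n z => F n z - G n z).
Proof.
move=> Fc /(fboundedZ (-1)); rewrite normrN normr1 mul1r => Gc.
by apply: eq_fbounded (fboundedD Fc Gc) => n z; rewrite mulN1r.
Qed.

Lemma fequivD F G F' G' : fequiv F G -> fequiv F' G' ->
  fequiv (fun n z => F n z + F' n z) (fun n z => G n z + G' n z).
Proof.
move=> FG FG'; have := fboundedD FG FG'; rewrite addr0.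
by apply: eq_fbounded => n z; ring.
Qed.

Lemma fequivZ a F G : fequiv F G ->
  fequiv (fun n z => a * F n z) (fun n z => a * G n z).
Proof.
by move=> /(fboundedZ a); rewrite mulr0; apply: eq_fbounded => n z; rewrite mulrBr.
Qed.

Lemma fequiv_sym F G : fequiv F G -> fequiv G F.
Proof.
move=> /(fboundedZ (-1)); rewrite mulr0.
by apply: eq_fbounded => n z; ring.
Qed.

Lemma fequiv_trans G F H : fequiv F G -> fequiv G H -> fequiv F H.
Proof.
move=> FG GH; have := fboundedD FG GH; rewrite addr0.
by apply: eq_fbounded => n z; ring.
Qed.

Lemma eq_fequiv F G : (forall n, F n =1 G n) -> fequiv F G.
Proof.
move=> FG e e0; apply: nearW => n z.
by rewrite FG subrr normr0 add0r mulr_ge0// ltW.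
Qed.

Lemma fequiv_bounded c F G : fequiv F G -> fbounded c F -> fbounded c G.
Proof.
move=> /fequiv_sym/fboundedD FG /FG; rewrite add0r.
by apply: eq_fbounded => n z; rewrite subrK.
Qed.

Lemma fbounded_closed c F : (forall e, 0 < e -> fbounded (c + e) F) -> fbounded c F.
Proof.
move=> Fc e e0; have e20 : 0 < e / 2 by rewrite divr_gt0.
apply: filterS (Fc _ e20 _ e20) => n Hn z.
by apply: le_trans (Hn z) _; rewrite -addrA -splitr.
Qed.

Lemma fbounded_comp c c' F (L : nat -> X -> X) : 0 <= c -> 0 <= c' ->
  fbounded c F -> (\forall n \near \oo, forall z, `|L n z| <= c' * `|z|) ->
  fbounded (c' * c) (fun n z => F n (L n z)).
Proof.
move=> c0 c'0 Fc Lc e e0; have c10 : 0 < c' + 1 by rewrite ltr_wpDl.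
have : 0 < e / (c' + 1) by rewrite divr_gt0.
move=> /Fc Fce; apply: filterS2 Fce Lc => n Hn Ln z.
apply: (le_trans (Hn _)).
apply: le_trans (_ : _ <= (c + e / (c' + 1)) * (c' * `|z|)) _.
  by apply: ler_wpM2l; rewrite ?Ln// addr_ge0// divr_ge0 ?ltW.
rewrite mulrA ler_wpM2r// mulrC mulrDr lerD2l mulrCA ler_piMr ?(ltW e0)//.
by rewrite ler_pdivrMr// mul1r lerDl.
Qed.

End functional_sequences.

(** * Orbits of almost antiperiodic vectors and their duality functionals *)

Lemma second_difference (V : zmodType) (a b c w : V) :
  b + b + w = a + w + c - (c - b - (b - a)).
Proof.
rewrite !opprB.
rewrite [RHS](AC (3*(2*2)) (((4*6)*2)*((1*5)*(3*7))))/=.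
by rewrite !subrr !addr0.
Qed.

Section rotation.
Context (R : realType) (X : normedModType R) (Z : {linear X -> X}).
Variable J : X -> X -> R.

Hypothesis J_lin : forall x a u v, J x (a *: u + v) = a * J x u + J x v.
Hypothesis J_opp : forall x z, J (- x) z = - J x z.
Hypothesis J_le : forall e : R, 0 < e -> exists2 d, 0 < d &
  forall x, `|x| <= 1 + d -> forall z, `|J x z| <= (1 + e) * `|z|.
Hypothesis J_diag : forall e : R, 0 < e -> exists2 d, 0 < d &
  forall x, 1 - d <= `|x| -> 1 - e <= J x x.
(** Uniform smoothness, as quantitative uniqueness of norming functionals: the norm of a functional
    and its value at [x] suffice to identify it with [J x]. *)
Hypothesis J_unique : forall e : R, 0 < e -> exists2 d, 0 < d &
  forall x (phi : X -> R), (forall a u v, phi (a *: u + v) = a * phi u + phi v) ->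
    (forall z, `|phi z| <= (1 + d) * `|z|) -> `|x| <= 1 + d -> 1 - d <= phi x ->
    forall z, `|phi z - J x z| <= e * `|z|.

Definition unit_seq (u : nat -> X) := (fun n => `|u n|) @ \oo --> (1 : R).
Definition null_seq (u : nat -> X) := u @ \oo --> (0 : X).

Lemma J_cvg_equiv (F : nat -> X -> R) (u : nat -> X) :
  (forall n a v w, F n (a *: v + w) = a * F n v + F n w) ->
  fbounded 1 F -> unit_seq u ->
  (forall e, 0 < e -> \forall n \near \oo, 1 - e <= F n (u n)) ->
  fequiv F (fun n => J (u n)).
Proof.
move=> Flin F1 u1 Fu e e0; have [d d0 Hd] := J_unique e0.
have /cvgrPdist_le/(_ d d0) u1d := u1.
apply: filterS3 (F1 d d0) u1d (Fu d d0) => n Fn un Fun z.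
rewrite add0r; apply: Hd => //.
by move: un; rewrite ler_distlC => /andP[].
Qed.

Lemma J_bounded (u : nat -> X) : unit_seq u ->
  fbounded 1 (fun n => J (u n)).
Proof.
move=> /cvgrPdist_le u1 e /J_le[d d0 Hd]; apply: filterS (u1 d d0) => n un.
by apply: Hd; move: un; rewrite ler_distlC => /andP[].
Qed.

Lemma J_diag_near (u : nat -> X) : unit_seq u ->
  forall e, 0 < e -> \forall n \near \oo, 1 - e <= J (u n) (u n).
Proof.
move=> /cvgrPdist_le u1 e /J_diag[d d0 Hd]; apply: filterS (u1 d d0) => n un.
by apply: Hd; move: un; rewrite ler_distlC => /andP[].
Qed.

Lemma J_near (u v : nat -> X) : unit_seq u ->
  null_seq (fun n => v n - u n) ->
  forall e, 0 < e -> \forall n \near \oo, 1 - e <= J (u n) (v n).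
Proof.
move=> u1 /cvgrPdist_le vu e e0.
have e20 : 0 < e / 2 by rewrite divr_gt0.
have e40 : 0 < e / 4 by rewrite divr_gt0.
apply: filterS3 (J_diag_near u1 e20) (J_bounded u1 ltr01) (vu _ e40) => n Jn Jb.
rewrite sub0r normrN => vun.
have := J_lin (u n) 1 (v n - u n) (u n); rewrite scale1r subrK mul1r => ->.
have := Jb (v n - u n); rewrite ler_norml => /andP[+ _].
lra.
Qed.

Lemma J_equiv (u v : nat -> X) : unit_seq u -> unit_seq v ->
  null_seq (fun n => v n - u n) -> fequiv (fun n => J (u n)) (fun n => J (v n)).
Proof.
by move=> u1 v1 vu; apply: J_cvg_equiv => //; [exact: J_bounded|exact: J_near].
Qed.

Lemma null_seqZ a (u : nat -> X) : null_seq u -> null_seq (fun n => a *: u n).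
Proof. by move=> u0; rewrite /null_seq -[0](scaler0 X a); apply: cvgZr. Qed.

Lemma null_seqD (u v : nat -> X) : null_seq u -> null_seq v ->
  null_seq (fun n => u n + v n).
Proof. by move=> u0 v0; rewrite /null_seq -[0](addr0 0); apply: cvgD. Qed.

Lemma null_seqB (u v : nat -> X) : null_seq u -> null_seq v ->
  null_seq (fun n => u n - v n).
Proof. by move=> u0 v0; rewrite /null_seq -[0](subr0 0); apply: cvgB. Qed.

Lemma null_seq_sym (u v : nat -> X) : null_seq (fun n => u n - v n) ->
  null_seq (fun n => v n - u n).
Proof.
move=> /(null_seqZ (-1)); congr null_seq; apply/funext => n.
by rewrite scaleN1r opprB.
Qed.

Lemma le_null_seq (M : R) (u v : nat -> X) :
  (forall n, `|v n| <= M * `|u n|) -> null_seq u -> null_seq v.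
Proof.
move=> uv /cvgrPdist_le u0; apply/cvgrPdist_le => e e0.
have M0 : 0 < `|M| + 1 by rewrite ltr_wpDl.
have : 0 < e / (`|M| + 1) by rewrite divr_gt0.
move=> /u0; apply: filterS => n; rewrite !sub0r !normrN ler_pdivlMr// => un.
apply: (le_trans (uv n)); apply: le_trans un; rewrite mulrC; apply: ler_wpM2l => //.
by rewrite (le_trans (ler_norm _))// lerDl.
Qed.

Lemma normB_null_seq (u v : nat -> X) : null_seq (fun n => u n - v n) ->
  forall e, 0 < e -> \forall n \near \oo, `|u n| <= `|v n| + e.
Proof.
move=> /cvgrPdist_le uv e /uv; apply: filterS => n; rewrite sub0r normrN => h.
by rewrite -lerBlDl; apply: le_trans (lerB_dist _ _) h.
Qed.

Lemma unit_seq_near (u v : nat -> X) : unit_seq u ->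
  null_seq (fun n => v n - u n) -> unit_seq v.
Proof.
move=> /cvgrPdist_le u1 /cvgrPdist_le vu; apply/cvgrPdist_le => e e0.
have e20 : 0 < e / 2 by rewrite divr_gt0.
apply: filterS2 (u1 _ e20) (vu _ e20) => n; rewrite sub0r normrN => h1 h2.
have := ler_dist_dist (u n) (v n); rewrite (distrC (u n)) => h3.
have := ler_distD `|u n| 1 `|v n|; lra.
Qed.

(* If [J] were linear in its first argument, both conditions would hold for all [f] and [g]. *)
Definition harmonic (s2 : R) (f g : nat -> X) :=
  fequiv (fun n z => J (f n) z + J (g n) z)
         (fun n z => s2 * J (s2^-1 *: (f n + g n)) z) /\
  fequiv (fun n z => J (g n) z - J (f n) z)
         (fun n z => s2 * J (s2^-1 *: (g n - f n)) z).

Section rotation_sequence.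
Variables (y : nat -> X) (q : nat -> nat) (M : R).
Hypothesis M0 : 0 <= M.
Hypothesis Z_le : forall z, `|Z z| <= M * `|z|.
Let x i n := iter i Z (y n).
Let P n := iter (q n) Z.
Hypothesis y1 : forall n, `|y n| = 1.
Hypothesis y_anti : null_seq (fun n => x 4 n + y n).
(* [P n] is a late power of [Z] that almost fixes [y n], so that applying it turns asymptotic
   norm bounds into bounds along the orbit of [y n]. *)
Hypothesis Py : null_seq (fun n => P n (y n) - y n).
Hypothesis P_le : forall k (e : R), 0 < e ->
  \forall n \near \oo, forall z, `|P n (iter k Z z)| <= (1 + e) * `|z|.
Hypothesis P_incr2 :
  \forall n \near \oo, forall z, `|P n (Z (Z z - z) - (Z z - z))| <= 3 * `|z|.

Let iterZ_le k z : `|iter k Z z| <= M ^+ k * `|z|.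
Proof.
elim: k => [|k IHk] /=; first by rewrite mul1r.
by rewrite exprS -mulrA (le_trans (Z_le _))// ler_wpM2l.
Qed.

Let iterZD k a b : iter k Z (a + b) = iter k Z a + iter k Z b.
Proof. by elim: k => //= k ->; rewrite linearD. Qed.

Let iterZN k a : iter k Z (- a) = - iter k Z a.
Proof. by elim: k => //= k ->; rewrite linearN. Qed.

Let iterZZ k a b : iter k Z (a *: b) = a *: iter k Z b.
Proof. by elim: k => //= k ->; rewrite linearZ. Qed.

Let iter_null k (u : nat -> X) : null_seq u -> null_seq (fun n => iter k Z (u n)).
Proof. exact/(le_null_seq (M := M ^+ k))/(fun n => iterZ_le k (u n)). Qed.

Let x_anti i : null_seq (fun n => x (i + 4)%N n + x i n).
Proof.
have := iter_null i y_anti; congr null_seq; apply/funext => n.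
by rewrite iterZD /x iterD.
Qed.

Let x_period i k : null_seq (fun n => x (i + 8 * k)%N n - x i n).
Proof.
elim: k => [|k IHk].
  rewrite (_ : (fun n => _) = (fun=> 0)); first exact: cvg_cst.
  apply/funext => n; rewrite muln0 addn0. exact: subrr.
have := null_seqD (null_seqB (x_anti (i + 8 * k + 4)%N) (x_anti (i + 8 * k)%N)) IHk.
congr null_seq; apply/funext => n.
have -> : (i + 8 * k + 4 + 4 = i + 8 * k.+1)%N by lia.
by rewrite opprD [X in X + _]addrA addrK addrA subrK.
Qed.

Let Px i : null_seq (fun n => P n (x i n) - x i n).
Proof.
have := iter_null i Py; congr null_seq; apply/funext => n.
by rewrite iterZD iterZN /x /P -!iterD addnC.
Qed.

Let x_shift i k : null_seq (fun n => P n (iter k Z (x i n)) - x (i + k)%N n).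
Proof.
by have := Px (i + k)%N; congr null_seq; apply/funext => n; rewrite /x [(i + k)%N]addnC iterD.
Qed.

(** For the upper bound, [Z^i y] is close to [P Z^i y]. For the lower bound the orbit returns:
    [x (8 i)] is close to [y], and as the image of [x i] under [Z^(7 i)] it is asymptotically no
    longer than [x i]. *)
Let x_unit i : unit_seq (x i).
Proof.
apply/cvgrPdist_le => e e0; have e30 : 0 < e / 3 by rewrite divr_gt0.
have up : \forall n \near \oo, `|x i n| <= 1 + e.
  apply: filterS2 (normB_null_seq (null_seq_sym (x_shift 0 i)) e30) (P_le i e30) => n.
  by rewrite add0n => xn /(_ (x 0 n)); rewrite {2}/x /= y1; lra.
have low1 : \forall n \near \oo, 1 <= `|x (8 * i)%N n| + e / 3.
  apply: filterS (normB_null_seq (null_seq_sym (x_period 0 i)) e30) => n.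
  by rewrite add0n {1}/x /= y1.
have low2 : \forall n \near \oo, `|x (8 * i)%N n| <= (1 + e / 3) * `|x i n| + e / 3.
  apply: filterS2 (normB_null_seq (null_seq_sym (x_shift i (7 * i))) e30)
    (P_le (7 * i) e30) => n.
  have -> : (i + 7 * i = 8 * i)%N by lia.
  by move=> xn /(_ (x i n)); lra.
near=> n.
have h1 : `|x i n| <= 1 + e by near: n.
have h2 : 1 <= `|x (8 * i)%N n| + e / 3 by near: n.
have h3 : `|x (8 * i)%N n| <= (1 + e / 3) * `|x i n| + e / 3 by near: n.
rewrite ler_distlC; apply/andP; split => //.
rewrite leNgt; apply/negP => h4.
have : e / 3 * `|x i n| <= e / 3 * 1.
  by apply: ler_wpM2l; lra.
by lra.
Unshelve. all: by end_near. Qed.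

Let f i n := J (x i n).

Let f_period i k : fequiv (f (i + 8 * k)%N) (f i).
Proof. exact/J_equiv/null_seq_sym/x_period. Qed.

Let f_anti i : fequiv (f (i + 4)%N) (fun n z => - f i n z).
Proof.
have Nx : unit_seq (fun n => - x i n).
  by rewrite /unit_seq; under eq_fun do rewrite normrN; exact: x_unit.
apply: fequiv_trans (J_equiv (x_unit _) Nx _) _.
  have := null_seqZ (-1) (x_anti i); congr null_seq; apply/funext => n.
  by rewrite scaleN1r opprD addrC.
by apply: eq_fequiv => n z; rewrite J_opp.
Qed.

(** The functional on the left has asymptotic norm at most 1, and its value at [x i] tends to 1
    because [P Z^k] sends [x i] close to [x (i + k)]; uniqueness of norming functionals applies. So
    the adjoint of [Z] moves the functionals one step back, up to the operators [P]. *)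
Let f_shift i k : fequiv (fun n z => f (i + k)%N n (P n (iter k Z z))) (f i).
Proof.
apply: J_cvg_equiv => //.
- by move=> n a v w; rewrite iterZD iterZZ /P iterZD iterZZ; exact: J_lin.
- apply: fbounded_closed => e e0; rewrite -[1 + e]mulr1.
  apply: (@fbounded_comp _ _ _ _ (f (i + k)%N) (fun n z => P n (iter k Z z))) => //.
  + by rewrite addr_ge0// ltW.
  + exact: J_bounded.
  + exact: P_le.
- exact/J_near/x_shift.
Qed.

Variable s2 : R.
Hypothesis s2_sqr : s2 * s2 = 2.
Hypothesis s2_gt1 : 1 < s2.

(** The factor [Z^2 - s2 Z + 1] of [Z^4 + 1], read on the functionals; its vanishing is the
    recurrence of an eighth turn. *)
Let rho i n z := f i n z - s2 * f i.+1 n z + f i.+2 n z.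

Let rho_equiv i j (F G : nat -> nat -> X -> R) :
  (forall k, (k <= 2)%N -> fequiv (F (i + k)%N) (G (j + k)%N)) ->
  fequiv (fun n z => F i n z - s2 * F i.+1 n z + F i.+2 n z)
         (fun n z => G j n z - s2 * G j.+1 n z + G j.+2 n z).
Proof.
move=> FG; have := FG 0%N isT; have := FG 1%N isT; have := FG 2%N isT.
rewrite !addn2 !addn1 !addn0 => FG2 FG1 FG0.
apply: fequivD FG2; have := fequivD FG0 (fequivZ (- s2) FG1).
congr fequiv; apply/funext => n; apply/funext => z; ring.
Qed.

Let rho_period i k : fequiv (rho (i + 8 * k)%N) (rho i).
Proof.
apply: rho_equiv => l _; have := f_period (i + l) k.
by rewrite addnAC.
Qed.

Let rho_shift i k : fequiv (fun n z => rho (i + k)%N n (P n (iter k Z z))) (rho i).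
Proof.
apply: (@rho_equiv (i + k) i (fun j n z => f j n (P n (iter k Z z))) f) => l _.
by have := f_shift (i + l) k; rewrite addnAC.
Qed.

(* The bound [c] on all the [rho i] shrinks by the factor [3 / (2 + s2)] since
   Z^2 + s2 Z + 1 = (Z - 1)^2 + (2 + s2) Z almost annihilates [rho] and (Z - 1)^2 has asymptotic norm
   at most 3. *)
Let rho_small i : fequiv (rho i) (fun _ _ => 0).
Proof.
suff H c : 0 < c -> forall i, fbounded c (rho i).
  have : fbounded 0 (rho i) by apply: fbounded_closed => e /H; rewrite add0r.
  by apply: eq_fbounded => n z; rewrite subr0.
move: c; apply: (@geometric_shrink _ (fun c => forall i, fbounded c (rho i))
  (3 / (2 + s2)) (1 + s2 + 1)).
- by rewrite divr_ge0//; move: s2_gt1; lra.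
- by rewrite ltr_pdivrMr; move: s2_gt1; lra.
- by move: s2_gt1; lra.
- move=> {}i; have fb j : fbounded 1 (f j) by exact: J_bounded.
  have := fboundedD (fboundedB (fb i) (fboundedZ s2 (fb i.+1))) (fb i.+2).
  by rewrite mulr1 ger0_norm//; exact: (ltW (lt_trans ltr01 s2_gt1)).
- by move=> c c' cc' H j; exact: le_fbounded (H j).
move=> c c0 _ H {}i.
have rhoPB j n u v : rho j n (P n (u - v)) = rho j n (P n u) - rho j n (P n v).
  rewrite /P iterZD iterZN /rho /f.
  have JB w a b : J w (a - b) = J w a - J w b.
    by rewrite [a - b]addrC -scaleN1r J_lin mulN1r addrC.
  by rewrite !JB; ring.
have step j : fbounded (3 / (2 + s2) * c) (rho j.+1).
  (* The product of the two factors of [Z^4 + 1]: the sum expands to [f j + f (j + 4)], the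
     coefficient of [f (j + 2)] being [2 - s2 * s2 = 0]. *)
  have E1 : fequiv (fun n z => rho j n z + s2 * rho j.+1 n z + rho j.+2 n z) (fun _ _ => 0).
    have := fequivD (f_anti j) (eq_fequiv (fun n z => erefl (f j n z))).
    rewrite addn4; congr fequiv; apply/funext => n; apply/funext => z; last by rewrite addNr.
    by rewrite /rho; ring: s2_sqr.
  have E2 : fequiv (fun n z => rho j.+2 n (P n (Z (Z z - z) - (Z z - z))))
                   (fun n z => rho j n z - 2 * rho j.+1 n z + rho j.+2 n z).
    have S0 := rho_shift j.+2 0; have S1 := rho_shift j.+1 1; have S2 := rho_shift j 2.
    rewrite addn0 in S0; rewrite addn1 in S1; rewrite addn2 in S2.
    have := fequivD (fequivD S2 (fequivZ (- 2) S1)) S0.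
    congr fequiv; apply/funext => n; apply/funext => z; last by ring.
    by rewrite linearB /= !rhoPB; ring.
  have E3 := fbounded_comp c0 (ler0n R 3) (H j.+2) P_incr2.
  have s20 : 0 < 2 + s2 by move: s2_gt1; lra.
  have := fboundedB E1 (fequiv_bounded E2 E3).
  move=> /(fboundedZ (2 + s2)^-1); rewrite add0r ger0_norm ?invr_ge0 1?ltW//.
  rewrite mulrA [_ * 3]mulrC; apply: eq_fbounded => n z.
  by rewrite subr0 (_ : _ - _ = (2 + s2) * rho j.+1 n z) ?mulKf ?gt_eqF//; ring.
(* [step] reaches only successor indices; [i] is reached as [i + 8], one full turn later. *)
have := step (i + 7)%N; rewrite -addnS.
by apply: fequiv_bounded; exact: (rho_period i 1).
Qed.

Let r i n := x i n - s2 *: x i.+1 n + x i.+2 n.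

Let r_succ i n : r i.+1 n = Z (r i n).
Proof. by rewrite /r [in RHS]linearD [in RHS]linearB [in RHS]linearZ. Qed.

Let r_sum i n : r i n + s2 *: r i.+1 n + r i.+2 n = x (i + 4)%N n + x i n.
Proof.
rewrite addn4 /r !scalerDr scalerN scalerA s2_sqr scaler_nat mulr2n.
set a := x i n; set b := s2 *: x i.+1 n; set c := x i.+2 n.
set d := s2 *: x i.+3 n; set e := x i.+4 n.
rewrite (AC (3*3*3) (9*1*((3*7)*5)*(2*4)*(8*6)))/=.
by rewrite subrr addNr [- d + d]addNr !addr0.
Qed.

(** The same contraction as for [rho], on vectors. The bound 3 is known only for [P n (Z - 1)^2],
    but [P n] commutes with [Z] and almost fixes [r j n], so it may be inserted. *)
Let r_null i : null_seq (r i).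
Proof.
suff H c : 0 < c -> forall i e, 0 < e -> \forall n \near \oo, `|r i n| <= c + e.
  apply/cvgrPdist_le => e e0; have e20 : 0 < e / 2 by rewrite divr_gt0.
  apply: filterS (H _ e20 i _ e20) => n.
  by rewrite sub0r normrN -splitr.
move: c; apply: (@geometric_shrink _
  (fun c => forall i e, 0 < e -> \forall n \near \oo, `|r i n| <= c + e)
  (3 / (2 + s2)) (1 + s2 + 1)).
- by rewrite divr_ge0//; move: s2_gt1; lra.
- by rewrite ltr_pdivrMr; move: s2_gt1; lra.
- by move: s2_gt1; lra.
- move=> {}i e e0; have e40 : 0 < e / (2 + s2) by rewrite divr_gt0//; move: s2_gt1; lra.
  have xb j : \forall n \near \oo, `|x j n| <= 1 + e / (2 + s2).
    have /cvgrPdist_le/(_ _ e40) := x_unit j.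
    by apply: filterS => n; rewrite ler_distlC => /andP[].
  apply: filterS3 (xb i) (xb i.+1) (xb i.+2) => n x0 x1 x2.
  rewrite /r; apply: (le_trans (ler_normD _ _)).
  apply: (le_trans (lerD (ler_normB _ _) x2)).
  have s20 : 0 < s2 by move: s2_gt1; lra.
  rewrite normrZ gtr0_norm//.
  have : s2 * `|x i.+1 n| <= s2 * (1 + e / (2 + s2)) by rewrite ler_pM2l.
  have : (2 + s2) * (e / (2 + s2)) = e by rewrite mulrC divfK// gt_eqF//; lra.
  lra.
- move=> c c' cc' H j e e0; apply: filterS (H j e e0) => n /le_trans; apply.
  by rewrite lerD2r.
move=> c c0 _ H {}i.
have s20 : 0 < 2 + s2 by move: s2_gt1; lra.
have step j e : 0 < e -> \forall n \near \oo, `|r j.+1 n| <= 3 / (2 + s2) * c + e.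
  (* Five errors [e'] add up: three from [3 (c + e')], one from [x (j + 4) + x j], and one from the
     insertion of [P n]. *)
  move=> e0; pose e' := e * (2 + s2) / 5.
  have e'0 : 0 < e' by rewrite divr_gt0// mulr_gt0.
  pose D (v : X) := Z (Z v - v) - (Z v - v).
  have PDr : null_seq (fun n => P n (D (r j n)) - D (r j n)).
    have Pr : null_seq (fun n => P n (r j n) - r j n).
      have := null_seqD (null_seqB (Px j) (null_seqZ s2 (Px j.+1))) (Px j.+2).
      congr null_seq; apply/funext => n; rewrite /r /P !(iterZD, iterZN, iterZZ).
      rewrite scalerBr !opprD !opprK.
      by rewrite [LHS](AC (2*2*2) (1*3*5*((2*4)*6)))/=.
    apply: (@le_null_seq ((M + 1) * (M + 1))) Pr => n.
    have ZB v : `|Z v - v| <= (M + 1) * `|v|.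
      by rewrite mulrDl mul1r (le_trans (ler_normB _ _))// lerD2r.
    have -> : P n (D (r j n)) - D (r j n) = D (P n (r j n) - r j n).
      pose E : {linear X -> X} := Z \- idfun.
      have PE v : P n (E v) = E (P n v).
        by rewrite /E /= /P iterZD iterZN -iterSr.
      rewrite -![D _]/(E (E _)) 2!PE.
      by rewrite (linearB E (P n (r j n)) (r j n)) (linearB E (E (P n (r j n))) (E (r j n))).
    by rewrite (le_trans (ZB _))// -mulrA ler_wpM2l// addr_ge0.
  have /cvgrPdist_le/(_ _ e'0) xa := x_anti j.
  have /cvgrPdist_le/(_ _ e'0) := PDr.
  apply: filterS3 xa (filterI (H j e' e'0) P_incr2) => n + [h1 h2].
  rewrite !sub0r !normrN => h3 h4.
  (* This is [(2 + s2) Z = (Z^2 + s2 Z + 1) - (Z - 1)^2] applied to [r j n]. *)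
  have E : (2 + s2) *: r j.+1 n = (x (j + 4)%N n + x j n) - D (r j n).
    rewrite -r_sum /D -r_succ [Z _]linearB -!r_succ scalerDl scaler_nat mulr2n.
    set a := r j n; set b := r j.+1 n; set c' := r j.+2 n.
    exact: second_difference.
  have : (2 + s2) * `|r j.+1 n| <= 3 * (c + e') + 2 * e'.
    rewrite -[X in X * _](gtr0_norm s20) -normrZ E.
    apply: (le_trans (ler_normB _ _)).
    have := h2 (r j n); rewrite -/(D (r j n)) => h5.
    have := ler_normB (P n (D (r j n))) (P n (D (r j n)) - D (r j n)).
    rewrite opprB addrC subrK; lra.
  move=> h5; rewrite -(ler_pM2l s20); apply: (le_trans h5).
  suff -> : (2 + s2) * (3 / (2 + s2) * c + e) = 3 * (c + e') + 2 * e' by [].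
  by rewrite /e'; field; rewrite gt_eqF.
move=> e e0; have e20 : 0 < e / 2 by rewrite divr_gt0.
have := step (i + 7)%N _ e20; rewrite -addnS.
have rP : null_seq (fun n => r i n - r (i + 8)%N n).
  apply: null_seq_sym.
  have := null_seqD (null_seqB (x_period i 1) (null_seqZ s2 (x_period i.+1 1))) (x_period i.+2 1).
  congr null_seq; apply/funext => n; rewrite /r muln1 !addSn scalerBr !opprD !opprK.
  by rewrite [LHS](AC (2*2*2) (1*3*5*((2*4)*6)))/=.
apply: filterS2 (normB_null_seq rP e20) => n; lra.
Qed.

(** The pair is [x 0] and [x 2], a quarter turn apart. Its scaled sum [m1] and difference [m3] are
    close to [x 1] and [x 3], so that the recurrence [rho] turns into harmonicity; in the
    differences, [- f 0] and [- f 1] are read as [f 4] and [f 5]. The scaled sum and difference of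
    [m1] and [m3] are again [x 2] and [- x 0], exactly. *)
Lemma rotation_harmonic : exists u v : nat -> X,
  [/\ unit_seq u, harmonic s2 u v &
    harmonic s2 (fun n => s2^-1 *: (u n + v n)) (fun n => s2^-1 *: (v n - u n))].
Proof.
have s20 : s2 != 0 by rewrite gt_eqF// (lt_trans ltr01 s2_gt1).
have s2V2 : s2^-1 * 2 = s2 by rewrite -s2_sqr mulKf.
pose m1 n := s2^-1 *: (x 0 n + x 2 n).
pose m3 n := s2^-1 *: (x 2 n - x 0 n).
have m1x : null_seq (fun n => m1 n - x 1 n).
  have := null_seqZ s2^-1 (r_null 0); congr null_seq; apply/funext => n.
  by rewrite /r addrAC scalerBr scalerA mulVf// scale1r.
have m3E n : m3 n = s2 *: x 2 n - m1 n.
  rewrite -{1}s2V2 -scalerA scaler_nat mulr2n -scalerBr; congr (_ *: _).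
  by rewrite [x 0 n + _]addrC addrKA.
have m3x : null_seq (fun n => m3 n - x 3 n).
  have := null_seqB (null_seq_sym m1x) (r_null 1); congr null_seq; apply/funext => n.
  rewrite m3E /r !opprD opprK.
  rewrite [LHS](AC (2*3) (4*2*5*(1*3)))/= subrr addr0.
  by [].
have m1u : unit_seq m1 := unit_seq_near (x_unit 1) m1x.
have m3u : unit_seq m3 := unit_seq_near (x_unit 3) m3x.
have J1 := J_equiv (x_unit 1) m1u m1x.
have J3 := J_equiv (x_unit 3) m3u m3x.
have frefl F : @fequiv _ X F F by exact: eq_fequiv.
exists (x 0), (x 2); split; first exact: x_unit.
  split.
    have := fequivD (rho_small 0) (fequivZ s2 J1).
    congr fequiv; apply/funext => n; apply/funext => z; rewrite /rho /f; ring.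
  have := fequivD (fequivD (rho_small 2) (fequivZ s2 J3))
    (fequivZ (-1) (fequivD (f_anti 0) (frefl (f 0)))).
  congr fequiv; apply/funext => n; apply/funext => z; rewrite /rho /f /m3; ring.
have m13 n : s2^-1 *: (m1 n + m3 n) = x 2 n.
  by rewrite m3E addrC subrK scalerA mulVf// scale1r.
have m31 n : s2^-1 *: (m3 n - m1 n) = - x 0 n.
  rewrite /m3 /m1 -scalerBr [x 0 n + _]addrC opprD addrACA subrr add0r -opprD -mulr2n !scalerN.
  by rewrite -scaler_nat !scalerA -mulrA s2V2 mulVf// scale1r.
change (harmonic s2 m1 m3); split.
  have := fequivD (rho_small 1) (fequivD (fequivD (fequiv_sym J1) (fequiv_sym J3))
    (frefl (fun n z => s2 * f 2 n z - f 1 n z - f 3 n z))).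
  congr fequiv; apply/funext => n; apply/funext => z; rewrite ?m13 /rho /f; ring.
have := fequivD (fequivD (rho_small 3) (fequivD (fequivZ s2 (f_anti 0)) (fequivZ (-1) (f_anti 1))))
   (fequivD (fequivD (fequiv_sym J3) (fequivZ (-1) (fequiv_sym J1))) (frefl (fun n z => - f 3 n z))).
congr fequiv; apply/funext => n; apply/funext => z; rewrite ?m31 ?J_opp /rho /f; ring.
Qed.

End rotation_sequence.

Lemma antiperiodic_harmonic (s2 : R) : s2 * s2 = 2 -> 1 < s2 ->
  (exists M, forall z, `|Z z| <= M * `|z|) ->
  (forall e : R, 0 < e -> exists m, forall k, (m <= k)%N ->
    forall z, `|iter k Z z| <= (1 + e) * `|z|) ->
  (exists m, forall k, (m <= k)%N ->
    forall z, `|iter k Z (Z (Z z - z) - (Z z - z))| <= 3 * `|z|) ->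
  (forall e : R, 0 < e -> exists2 y, `|y| = 1 & `|iter 4 Z y + y| <= e) ->
  exists u v : nat -> X, [/\ unit_seq u, harmonic s2 u v &
    harmonic s2 (fun n => s2^-1 *: (u n + v n)) (fun n => s2^-1 *: (v n - u n))].
Proof.
move=> s2_sqr s2_gt1 [M' ZM'] Zcontr [m0 Zincr2] Zanti.
pose M := `|M'|.
have M0 : 0 <= M by exact: normr_ge0.
have ZM z : `|Z z| <= M * `|z|.
  by rewrite (le_trans (ZM' z))// ler_wpM2r// ler_norm.
have iterM k z : `|iter k Z z| <= M ^+ k * `|z|.
  elim: k => [|k IHk] /=; first by rewrite mul1r.
  by rewrite exprS -mulrA (le_trans (ZM _))// ler_wpM2l.
have iterB k a b : iter k Z (a - b) = iter k Z a - iter k Z b.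
  by elim: k => //= k ->; rewrite linearB.
(* [Z^(8 k) - 1] is a multiple of [Z^4 + 1]. *)
have period k : exists2 C, 0 <= C & forall z, `|iter (8 * k) Z z - z| <= C * `|iter 4 Z z + z|.
  elim: k => [|k [C C0 IHk]].
    by exists 0 => // z; rewrite muln0 subrr normr0 mul0r.
  exists (M ^+ (8 * k) * (M ^+ 4 + 1) + C).
    by rewrite addr_ge0// mulr_ge0 ?addr_ge0 ?exprn_ge0.
  move=> z; set w := iter 4 Z z + z.
  have -> : iter (8 * k.+1) Z z - z =
      iter (8 * k) Z (iter 4 Z w - w) + (iter (8 * k) Z z - z).
    have -> : iter 4 Z w - w = iter 8 Z z - z.
      have -> : iter 4 Z w = iter 8 Z z + iter 4 Z z.
        by rewrite /w /= !linearD.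
      by rewrite /w addrKA.
    by rewrite iterB -iterD mulnS addnC addrA subrK.
  apply: (le_trans (ler_normD _ _)); rewrite mulrDl lerD//.
  apply: (le_trans (iterM _ _)); rewrite -mulrA ler_wpM2l ?exprn_ge0//.
  by rewrite (le_trans (ler_normB _ _))// mulrDl mul1r lerD2r iterM.
pose d (n : nat) : R := n.+1%:R^-1.
have d0 n : 0 < d n by rewrite invr_gt0.
have d_near (e : R) : 0 < e -> \forall n \near \oo, d n <= e.
  by move=> e0; apply: filterS (near_infty_natSinv_lt (PosNum e0)) => n /ltW.
have [q qP] := choice (fun n => Zcontr (d n) (d0 n)).
(* A multiple of 8, so that [Z^(Q n)] almost fixes antiperiodic vectors, and large enough for the
   late-time bounds. Since the constant of [period] depends on [Q n], the vector [y n] is chosen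
   after it. *)
pose Q n := (8 * maxn (q n) m0)%N.
have Q_ge n k : (q n <= Q n + k)%N /\ (m0 <= Q n)%N by rewrite /Q; lia.
have yex n : exists y, [/\ `|y| = 1, `|iter 4 Z y + y| <= d n &
    `|iter (Q n) Z y - y| <= d n].
  have [C C0 HC] := period (maxn (q n) m0).
  have C10 : 0 < C + 1 by rewrite ltr_wpDl.
  have [y y1 yd] := Zanti (d n / (C + 1)) (divr_gt0 (d0 n) C10).
  exists y; split=> //.
    by rewrite (le_trans yd)// ler_pdivrMr// ler_peMr ?(ltW (d0 n))// lerDr.
  apply: (le_trans (HC y)); apply: (le_trans (ler_wpM2l C0 yd)).
  by rewrite mulrCA ler_piMr ?(ltW (d0 n))// ler_pdivrMr// mul1r lerDl.
have [y yP] := choice yex.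
apply: (@rotation_harmonic y Q M) => //.
- by move=> n; have [] := yP n.
- apply/cvgrPdist_le => e /d_near; apply: filterS => n.
  by rewrite sub0r normrN; apply: le_trans; have [] := yP n.
- apply/cvgrPdist_le => e /d_near; apply: filterS => n.
  by rewrite sub0r normrN; apply: le_trans; have [] := yP n.
- move=> k e /d_near; apply: filterS => n dn z; rewrite -iterD.
  apply: (le_trans (qP n _ (Q_ge n k).1 z)).
  by rewrite ler_wpM2r// lerD2l.
- by apply: nearW => n; apply: Zincr2; exact: (Q_ge n 0%N).2.
Qed.

End rotation.

(** * Pointwise inequalities for real powers *)

Section real_powers.
Context (R : realType).
Implicit Types p r s x y a b c : R.

(** Young's inequality for the product of [s] and 1, with exponents [p] and [p / (p - 1)]. *)
Lemma powR_bernoulli p s : 1 <= p -> 0 <= s -> 1 + p * (s - 1) <= s `^ p.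
Proof.
move=> p1 s0; have [<-|p_neq1] := eqVneq 1 p.
  by rewrite powRr1//; lra.
have p_gt1 : 1 < p by rewrite lt_neqAle p_neq1.
have p0 : 0 < p by lra.
have q0 : 0 < p / (p - 1) by rewrite divr_gt0// subr_gt0.
have pq : p^-1 + (p / (p - 1))^-1 = 1 by field; lra.
have := conjugate_powR s0 ler01 p0 q0 pq.
rewrite powR1 mulr1 invf_div => /(ler_wpM2l (ltW p0)).
have -> : p * (s `^ p / p + 1 * ((p - 1) / p)) = s `^ p + p - 1 by field; lra.
lra.
Qed.

(* Squaring Bernoulli's inequality at [Num.sqrt s] gives a remainder term. *)
Lemma powR_bernoulli_sqr p s : 1 < p -> 0 <= s ->
  1 + p * (s - 1) + (p - 1) * (Num.sqrt s - 1) ^+ 2 <= s `^ p.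
Proof.
move=> p1 s0; set u := Num.sqrt s.
have u0 : 0 <= u by exact: sqrtr_ge0.
have us : u * u = s by rewrite -expr2 sqr_sqrtr.
have up : s `^ p = u `^ p * u `^ p by rewrite -us powRM.
have u2 : 0 <= (u - 1) * (u - 1) by rewrite -expr2 sqr_ge0.
have [h|h] := leP 0 (1 + p * (u - 1)).
  apply: (@le_trans _ _ ((1 + p * (u - 1)) * (1 + p * (u - 1)))).
    by have := mulr_ge0 (sqr_ge0 (p - 1)) (sqr_ge0 (u - 1)); rewrite -us; lra.
  by rewrite up; apply: ler_pM => //; exact: powR_bernoulli (ltW p1) u0.
apply: le_trans (powR_ge0 _ _); rewrite -us.
have : u * (1 - (2 * p - 1) * (1 - u)) <= 0.
  by rewrite mulr_ge0_le0//; nra.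
lra.
Qed.

Lemma powR_superadd r x y : 1 <= r -> 0 <= x -> 0 <= y ->
  x `^ r + y `^ r <= (x + y) `^ r.
Proof.
move=> r1 x0 y0; have r0 : 0 < r by lra.
have [xy0|xy0] := eqVneq (x + y) 0.
  have -> : x = 0 by lra. have -> : y = 0 by lra.
  by rewrite addr0 powR0 ?gt_eqF// addr0.
have xyp : 0 < x + y by rewrite lt_neqAle eq_sym xy0 addr_ge0.
have unit u : 0 <= u -> u <= 1 -> u `^ r <= u.
  move=> u0 u1; have [->|un0] := eqVneq u 0; first by rewrite powR0// gt_eqF.
  by apply: ge1r_powR => //; rewrite lt_neqAle eq_sym un0 u0.
have E z : 0 <= z -> z `^ r = (x + y) `^ r * (z / (x + y)) `^ r.
  by move=> z0; rewrite -powRM ?divr_ge0 ?(ltW xyp)// mulrC divfK.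
rewrite (E x)// (E y)// -mulrDr ler_piMr ?powR_ge0//.
have hx : x / (x + y) <= 1 by rewrite ler_pdivrMr//; lra.
have hy : y / (x + y) <= 1 by rewrite ler_pdivrMr//; lra.
apply: (le_trans (lerD (unit _ _ hx) (unit _ _ hy))); rewrite ?divr_ge0 ?(ltW xyp)//.
by rewrite -mulrDl divff.
Qed.

Lemma powR_subadd r x y : 0 < r -> r <= 1 -> 0 <= x -> 0 <= y ->
  (x + y) `^ r <= x `^ r + y `^ r.
Proof.
move=> r0 r1 x0 y0.
have [xy0|xy0] := eqVneq (x + y) 0.
  have -> : x = 0 by lra. have -> : y = 0 by lra.
  by rewrite addr0 powR0 ?gt_eqF// addr0.
have xyp : 0 < x + y by rewrite lt_neqAle eq_sym xy0 addr_ge0.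
have unit u : 0 <= u -> u <= 1 -> u <= u `^ r.
  move=> u0 u1; have [->|un0] := eqVneq u 0; first by rewrite powR0// gt_eqF.
  by apply: ger1_powR => //; rewrite lt_neqAle eq_sym un0 u0.
have E z : 0 <= z -> z `^ r = (x + y) `^ r * (z / (x + y)) `^ r.
  by move=> z0; rewrite -powRM ?divr_ge0 ?(ltW xyp)// mulrC divfK.
rewrite (E x)// (E y)// -mulrDr ler_peMr ?powR_ge0//.
have hx : x / (x + y) <= 1 by rewrite ler_pdivrMr//; lra.
have hy : y / (x + y) <= 1 by rewrite ler_pdivrMr//; lra.
apply: (le_trans _ (lerD (unit _ _ hx) (unit _ _ hy))); rewrite ?divr_ge0 ?(ltW xyp)//.
by rewrite -mulrDl divff.
Qed.

(** For [r = p - 1] this is the derivative of [|a|^p / p], the pointwise form of the duality map of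
    L^p. *)
Definition spow r a : R := Num.sg a * `|a| `^ r.

Lemma spowN r a : spow r (- a) = - spow r a.
Proof. by rewrite /spow sgrN normrN mulNr. Qed.

Lemma spow_ge0 r a : 0 <= a -> 0 < r -> spow r a = a `^ r.
Proof.
move=> a0 r0; rewrite /spow ger0_norm//; have [->|an0] := eqVneq a 0.
  by rewrite sgr0 mul0r powR0// gt_eqF.
by rewrite gtr0_sg ?mul1r// lt_neqAle eq_sym an0.
Qed.

Lemma spowM r c a : 0 <= c -> 0 < r -> spow r (c * a) = c `^ r * spow r a.
Proof.
move=> c0 r0; rewrite /spow sgrM normrM ger0_norm// powRM//.
have [->|cn0] := eqVneq c 0; first by rewrite sgr0 powR0 ?gt_eqF// !mul0r.
by rewrite gtr0_sg ?mul1r 1?mulrCA// lt_neqAle eq_sym cn0.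
Qed.

Lemma norm_spow r a : 0 < r -> `|spow r a| = `|a| `^ r.
Proof.
move=> r0; rewrite /spow normrM normr_sg [`|_ `^ _|]ger0_norm ?powR_ge0//.
have [->|an0] := eqVneq a 0; first by rewrite normr0 powR0 ?gt_eqF// mulr0.
by rewrite mul1r.
Qed.

Lemma spow_mulr p a : 1 < p -> spow (p - 1) a * a = `|a| `^ p.
Proof.
move=> p1; rewrite /spow mulrAC -normrEsg mulr_powRB1//; lra.
Qed.

(** Bernoulli's inequality at [y / x], scaled by [x^p]: the power lies above its tangent at [x]. *)
Lemma powR_young p x y : 1 < p -> 0 <= x -> 0 <= y ->
  p * (x `^ (p - 1) * y) <= y `^ p + (p - 1) * x `^ p.
Proof.
move=> p1 x0 y0; have p0 : 0 < p by lra.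
have [->|xn0] := eqVneq x 0.
  rewrite !powR0; [|by rewrite gt_eqF; lra ..].
  by rewrite mul0r !mulr0 addr0 powR_ge0.
have xp : 0 < x by rewrite lt_neqAle eq_sym xn0.
have := powR_bernoulli (ltW p1) (divr_ge0 y0 x0).
have -> : y `^ p = x `^ p * (y / x) `^ p.
  by rewrite -powRM ?divr_ge0// mulrC divfK.
have xE : x `^ p = x * x `^ (p - 1) by rewrite mulr_powRB1.
move=> /(ler_wpM2l (powR_ge0 x p)).
have -> : x `^ p * (1 + p * (y / x - 1)) = p * (x `^ (p - 1) * y) - (p - 1) * x `^ p.
  by rewrite xE; field.
lra.
Qed.

Lemma le_spow_mul r a b : spow r a * b <= `|a| `^ r * `|b|.
Proof.
apply: (le_trans (ler_norm _)); rewrite /spow !normrM normr_sg.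
rewrite [`|_ `^ _|]ger0_norm ?powR_ge0// ler_wpM2r//.
by rewrite ler_piMl ?powR_ge0//; case: (a != 0).
Qed.

Lemma spow_young p a b : 1 < p ->
  p * (spow (p - 1) a * b) <= `|b| `^ p + (p - 1) * `|a| `^ p.
Proof.
move=> p1; apply: le_trans (powR_young p1 (normr_ge0 a) (normr_ge0 b)).
by rewrite ler_wpM2l ?le_spow_mul//; lra.
Qed.

Lemma norm_spow_mul_le p a b : 1 < p ->
  `|spow (p - 1) a * b| <= `|a| `^ p + `|b| `^ p.
Proof.
move=> p1; have p0 : 0 < p by lra.
rewrite -(ler_pM2l p0).
have a0 := powR_ge0 `|a| p; have b0 := powR_ge0 `|b| p.
apply: (@le_trans _ _ (`|b| `^ p + (p - 1) * `|a| `^ p)); last by nra.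
apply: le_trans (powR_young p1 (normr_ge0 a) (normr_ge0 b)).
by rewrite ler_wpM2l ?(ltW p0)// normrM norm_spow//; lra.
Qed.

Lemma spow_diff_le r a b : 0 < r -> 0 <= b -> b <= a -> r <= 1 ->
  spow r a - spow r b <= spow r (a - b).
Proof.
move=> r0 b0 ba r1; have a0 := le_trans b0 ba.
rewrite !spow_ge0 ?subr_ge0//.
have := powR_subadd r0 r1 b0 (_ : 0 <= a - b).
by rewrite subr_ge0 subrKC => /(_ ba); lra.
Qed.

Lemma spow_diff_ge r a b : 1 <= r -> 0 <= b -> b <= a ->
  spow r (a - b) <= spow r a - spow r b.
Proof.
move=> r1 b0 ba; have a0 := le_trans b0 ba.
have r0 : 0 < r by lra.
rewrite !spow_ge0 ?subr_ge0//.
have := powR_superadd r1 b0 (_ : 0 <= a - b).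
by rewrite subr_ge0 subrKC => /(_ ba); lra.
Qed.

Lemma same_sign_ind (P : R -> R -> Prop) :
  (forall a b, P a b -> P b a) -> (forall a b, P a b -> P (- a) (- b)) ->
  (forall a b, 0 <= b -> b <= a -> P a b) ->
  forall a b, 0 <= a * b -> P a b.
Proof.
move=> Psym Popp Ple.
have Pge0 a b : 0 <= a -> 0 <= b -> P a b.
  by move=> a0 b0; have [ab|/ltW ba] := leP b a; [exact: Ple|exact/Psym/Ple].
move=> a b ab; have [a0|a0] := leP 0 a.
  have [b0|b0] := leP 0 b; first exact: Pge0.
  have -> : a = 0 by nra.
  by rewrite -oppr0 -[b]opprK; apply: Popp; apply: Pge0 => //; lra.
have [b0|b0] := leP 0 b.
  have -> : b = 0 by nra.
  by rewrite -oppr0 -[a]opprK; apply: Popp; apply: Pge0 => //; lra.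
by rewrite -[a]opprK -[b]opprK; apply: Popp; apply: Pge0; lra.
Qed.

(** This is subadditivity of [t |-> t^(p - 1)] on the half-line; for opposite signs the inequality
    is reversed. Its direction also changes at [p = 2], as [spow_diff_mul_ge] shows, and this is the
    origin of the asymmetry that rules out eighth turns. *)
Lemma spow_diff_mul_le p a b : 1 < p -> p <= 2 -> 0 <= a * b ->
  (spow (p - 1) a - spow (p - 1) b) * (a - b) <= `|a - b| `^ p.
Proof.
move=> p1 p2; have r0 : 0 < p - 1 by lra.
move: a b; apply: same_sign_ind => a b.
- by rewrite distrC; congr (_ <= _); ring.
- by rewrite !spowN -!opprD normrN mulrNN.
move=> b0 ba; rewrite -spow_mulr// ler_wpM2r ?subr_ge0//.
by apply: spow_diff_le => //; lra.
Qed.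

Lemma spow_diff_mul_ge p a b : 2 <= p -> 0 <= a * b ->
  `|a - b| `^ p <= (spow (p - 1) a - spow (p - 1) b) * (a - b).
Proof.
move=> p2; have p1 : 1 < p by lra.
move: a b; apply: same_sign_ind => a b.
- by rewrite distrC; congr (_ <= _); ring.
- by rewrite !spowN -!opprD normrN mulrNN.
move=> b0 ba; rewrite -spow_mulr// ler_wpM2r ?subr_ge0//.
by apply: spow_diff_ge => //; lra.
Qed.

(** The right side covers three regimes: a Hoelder bound for [r <= 1], a Lipschitz bound with
    constant at most [r 2^r] for [r > 1], and [2 (a - b)^r] when [a] and [b] lie on different sides
    of 0. *)
Lemma spow_modulus r a b : 0 < r -> `|a| <= 2 -> `|b| <= 2 ->
  `|spow r a - spow r b| <= (r * 2 `^ r + 2) * (`|a - b| `^ r + `|a - b|).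
Proof.
move=> r0; set C := _ + 2.
have C0 : 0 <= r * 2 `^ r by rewrite mulr_ge0 ?powR_ge0// ltW.
have nonneg x y : 0 <= y -> y <= x -> x <= 2 ->
    spow r x - spow r y <= C * ((x - y) `^ r + (x - y)).
  move=> y0 yx x2; have xy0 : 0 <= x - y by rewrite subr_ge0.
  have xyr := powR_ge0 (x - y) r.
  have [r1|r1] := leP r 1.
    apply: (le_trans (spow_diff_le r0 y0 yx r1)).
    rewrite spow_ge0// /C; nra.
  have x0 := le_trans y0 yx.
  have := powR_young r1 x0 y0; rewrite !spow_ge0// -[x `^ r]mulr_powRB1//.
  have : x `^ (r - 1) <= 2 `^ r.
    apply: (@le_trans _ _ (2 `^ (r - 1))).
      by apply: ge0_ler_powR => //; rewrite ?nnegrE//; lra.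
    by apply: ler_powR; lra.
  move=> /(ler_wpM2r xy0) /(ler_wpM2l (ltW r0)).
  rewrite /C; set u := x `^ (r - 1); set w := 2 `^ r => h1 h2.
  have : 0 <= r * w * (x - y) `^ r by rewrite mulr_ge0.
  lra.
wlog ba : a b / b <= a.
  by move=> H a2 b2; have [/H|/ltW/H] := leP b a; [exact|rewrite distrC [`|a - b|]distrC; exact].
move=> a2 b2.
have ab0 : 0 <= a - b by rewrite subr_ge0.
rewrite [`|a - b|]ger0_norm//.
have /andP[a2' a2''] : -2 <= a <= 2 by rewrite -ler_norml.
have /andP[b2' b2''] : -2 <= b <= 2 by rewrite -ler_norml.
have spow_mono x y : y <= x -> spow r y <= spow r x.
  have mono x' y' : 0 <= y' -> y' <= x' -> spow r y' <= spow r x'.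
    move=> y0 yx; have x0 := le_trans y0 yx; rewrite !spow_ge0//.
    by apply: ge0_ler_powR => //; rewrite ?nnegrE// ltW.
  have [y0|/ltW y0] := leP 0 y; first exact: mono.
  have [x0|/ltW x0] := leP 0 x.
    move=> _; apply: (@le_trans _ _ 0); last by rewrite spow_ge0// powR_ge0.
    by rewrite -[y]opprK spowN oppr_le0 spow_ge0 ?powR_ge0// oppr_ge0.
  by move=> yx; rewrite -[x]opprK -[y]opprK !(spowN r (- _)) lerN2 mono ?lerN2// oppr_ge0.
rewrite ger0_norm ?subr_ge0 ?spow_mono//.
have [b0|b0] := leP 0 b; first exact: nonneg.
have [a0|a0] := leP a 0.
  have := @nonneg (- b) (- a); rewrite !spowN !opprK ![- b + a]addrC [_ + spow r a]addrC.
  by apply; lra.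
rewrite -[b]opprK spowN opprK !spow_ge0 ?oppr_ge0 ?(ltW b0) ?(ltW a0)// opprK.
have h1 : a `^ r <= (a - b) `^ r.
  by apply: ge0_ler_powR; rewrite ?nnegrE//; lra.
have h2 : (- b) `^ r <= (a - b) `^ r.
  by apply: ge0_ler_powR; rewrite ?nnegrE//; lra.
have xyr := powR_ge0 (a - b) r.
rewrite /C; nra.
Qed.

(** Both sides are homogeneous of degree [p] in the pair of [a] and [b], so division by the larger
    absolute value reduces to arguments bounded by 1. The error is measured in p-th powers so that
    it can be integrated. *)
Lemma spow_unif_continuous p e : 1 < p -> 0 < e -> exists2 t0, 0 < t0 &
  forall t, 0 <= t -> t <= t0 -> forall a b,
    (spow (p - 1) (a + t * b) - spow (p - 1) a) * b <= e * (`|a| `^ p + `|b| `^ p).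
Proof.
move=> p1 e0; have r0 : 0 < p - 1 by lra.
set r := p - 1; pose C := r * 2 `^ r + 2.
have C0 : 0 < C by rewrite /C ltr_wpDl// mulr_ge0 ?powR_ge0// ltW.
have p0 : 0 < p by lra.
pose d := e / (2 * C).
have d0 : 0 < d by rewrite divr_gt0// mulr_gt0.
(* Ensures [t <= d] and [t^r <= d], whence [C (t^r + t) <= e]; [t <= 1] keeps the arguments of
   [spow_modulus] within 2. *)
pose t0 := Num.min 1 (Num.min d (d `^ r^-1)).
exists t0; first by rewrite !lt_min ltr01 d0 powR_gt0.
move=> t t_ge0; rewrite /t0 !le_min => /and3P[t1 td tdr] a b.
pose M := Num.max `|a| `|b|.
have aM : `|a| <= M by rewrite le_max lexx.
have bM : `|b| <= M by rewrite le_max lexx orbT.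
have [M0|Mn0] := eqVneq M 0.
  have -> : b = 0 by apply/normr0_eq0/le_anti; rewrite normr_ge0 -M0 bM.
  by rewrite mulr0 mulr_ge0 ?addr_ge0 ?powR_ge0// ltW.
have M_ge0 : 0 <= M by rewrite (le_trans _ aM).
have M_gt0 : 0 < M by rewrite lt_neqAle eq_sym Mn0.
pose x := a / M; pose y := b / M.
have x1 : `|x| <= 1 by rewrite normrM normfV (ger0_norm M_ge0) ler_pdivrMr// mul1r.
have y1 : `|y| <= 1 by rewrite normrM normfV (ger0_norm M_ge0) ler_pdivrMr// mul1r.
have aE : a = M * x by rewrite /x mulrC divfK.
have bE : b = M * y by rewrite /y mulrC divfK.
have ty1 : `|t * y| <= t by rewrite normrM ger0_norm// ler_piMr.
have ty : `|t * y| `^ r <= d.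
  apply: (@le_trans _ _ ((d `^ r^-1) `^ r)).
    apply: ge0_ler_powR; rewrite ?nnegrE ?powR_ge0//; first exact: ltW.
    exact: le_trans tdr.
  by rewrite -powRrM mulVf ?powRr1 ?gt_eqF// ltW.
have key : `|spow r (x + t * y) - spow r x| <= e.
  apply: (le_trans (spow_modulus r0 _ _)).
  - by apply: (le_trans (ler_normD _ _)); lra.
  - by lra.
  rewrite addrAC subrr add0r -/C.
  apply: (@le_trans _ _ (C * (d + d))).
    by rewrite ler_pM2l// lerD// (le_trans ty1).
  by rewrite (_ : C * (d + d) = e)// /d; field; rewrite gt_eqF.
have MpE : M `^ p <= `|a| `^ p + `|b| `^ p.
  rewrite /M maxEle; case: ifP => _; rewrite ?lerDr ?lerDl powR_ge0//.
have abE : M * x + t * (M * y) = M * (x + t * y) by ring.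
rewrite aE bE abE (spowM (x + t * y) M_ge0 r0) (spowM x M_ge0 r0) -mulrBr.
rewrite (_ : M `^ r * _ * (M * y) = M * M `^ r * ((spow r (x + t * y) - spow r x) * y)); last by ring.
rewrite mulr_powRB1// -aE -bE.
apply: (@le_trans _ _ (M `^ p * e)).
  rewrite ler_wpM2l ?powR_ge0//.
  apply: (le_trans (ler_norm _)); rewrite normrM.
  by apply: le_trans key; rewrite ler_piMr.
by rewrite mulrC ler_pM2l.
Qed.

(** For [x > 0], Bernoulli's inequality with remainder is applied to [x / m] and [1 / m], where [m]
    is the midpoint: their mean is 1, so the linear terms cancel and a quadratic remainder survives.
    For [x <= 0] the midpoint is at most [1 / 2], and [2^-p < 1 / 2] leaves a fixed gap. *)
Lemma powR_midpoint_gap p : 1 < p -> exists2 c, 0 < c &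
  forall x, -1 <= x -> x <= 1 ->
    c * (1 - x) ^+ 2 <= (1 + `|x| `^ p) / 2 - `|(1 + x) / 2| `^ p.
Proof.
move=> p1; have p0 : 0 < p by lra.
pose h := 2^-1 `^ p : R.
have h0 : 0 < h by rewrite powR_gt0 ?invr_gt0.
have h1 : h < 1 / 2.
  have r0 : 0 < p - 1 by lra.
  have := gt0_ltr_powR r0 (_ : 2^-1 \is Num.nneg) (_ : 1 \is Num.nneg) (_ : 2^-1 < 1 :> R).
  rewrite !nnegrE powR1 => /(_ ltac:(lra) ltac:(lra) ltac:(lra)).
  have -> : h = 2^-1 * 2^-1 `^ (p - 1) by rewrite mulr_powRB1// invr_ge0.
  lra.
pose c := Num.min (h * (p - 1) / 72) ((1 / 2 - h) / 4).
have c1 : c <= h * (p - 1) / 72 by rewrite ge_min lexx.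
have c2 : c <= (1 / 2 - h) / 4 by rewrite ge_min lexx orbT.
exists c; first by rewrite lt_min !divr_gt0 ?mulr_gt0 ?subr_gt0//; lra.
move=> x x0 x1; have [xneg|xpos] := leP x 0.
  have : `|(1 + x) / 2| `^ p <= h.
    by rewrite ger0_norm; [apply: ge0_ler_powR; rewrite ?nnegrE//; lra|lra].
  have := powR_ge0 `|x| p.
  have : (1 - x) ^+ 2 <= 4 by rewrite expr2; nra.
  have : 0 <= (1 - x) ^+ 2 by exact: sqr_ge0.
  set X := (1 - x) ^+ 2 => X0 X4 xp hx.
  have : c * X <= (1 / 2 - h) / 4 * X by rewrite ler_wpM2r.
  have : (1 / 2 - h) / 4 * X <= (1 / 2 - h) / 4 * 4 by rewrite ler_wpM2l//; lra.
  lra.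
set m := (1 + x) / 2.
have m2 : 1 / 2 <= m by rewrite /m; lra.
have m1 : m <= 1 by rewrite /m; lra.
have m0 : 0 < m by lra.
have m_ge0 := ltW m0.
rewrite (ger0_norm (ltW xpos)) (ger0_norm m_ge0).
have scale z : 0 <= z -> z `^ p = m `^ p * (z / m) `^ p.
  by move=> z0; rewrite -powRM ?(divr_ge0 z0 m_ge0)// mulrC divfK// gt_eqF.
have mp : h <= m `^ p by apply: ge0_ler_powR; rewrite ?nnegrE//; lra.
have mp0 : 0 < m `^ p by rewrite powR_gt0.
have E1 := powR_bernoulli_sqr p1 (divr_ge0 (ltW xpos) (ltW m0)).
have E2 := powR_bernoulli_sqr p1 (divr_ge0 ler01 (ltW m0)).
have xm : x / m + 1 / m = 2.
  by rewrite -mulrDl (_ : x + 1 = 2 * m) ?mulfK ?gt_eqF// /m; field.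
have E : m `^ p * (2 + (p - 1) * (Num.sqrt (1 / m) - 1) ^+ 2) <= x `^ p + 1.
  have s1 : m `^ p * (1 / m) `^ p = 1 by rewrite -scale// powR1.
  rewrite (scale x (ltW xpos)) -[X in _ <= _ + X]s1.
  rewrite -mulrDr ler_pM2l//.
  have := sqr_ge0 (Num.sqrt (x / m) - 1); nra.
set v := Num.sqrt (1 / m) in E *.
have v0 : 0 <= v by exact: sqrtr_ge0.
have vv : v * v = 1 / m by rewrite -expr2 sqr_sqrtr// divr_ge0// ltW.
have v2 : v <= 2.
  have : 1 / m <= 2 by rewrite ler_pdivrMr//; lra.
  nra.
(* [v * v - 1 = (v - 1) (v + 1)] with [v + 1 <= 3]; this is the source of the 36 below and of the 72
   in [c]. *)
have vx : (1 - x) / 6 <= v - 1.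
  have : (1 - x) / 2 <= v * v - 1.
    by rewrite vv lerBrDr ler_pdivlMr// /m; nra.
  nra.
have vx2 : (1 - x) ^+ 2 / 36 <= (v - 1) ^+ 2.
  rewrite !expr2; nra.
have : h * (p - 1) * ((1 - x) ^+ 2 / 36) <= m `^ p * (p - 1) * (v - 1) ^+ 2.
  apply: ler_pM => //; first by rewrite mulr_ge0//; [exact: ltW|lra].
    by rewrite divr_ge0// sqr_ge0.
  by rewrite ler_wpM2r//; lra.
have : c * (1 - x) ^+ 2 <= h * (p - 1) / 72 * (1 - x) ^+ 2.
  by rewrite ler_wpM2r// sqr_ge0.
lra.
Qed.

(** By homogeneity [b = 1] may be assumed. Either [|a - b|^p] is below [e], or [1 - x >= th], where
    the midpoint gap is at least [c th^2] and [K] was chosen to make it dominate [2^p]. Being linear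
    in p-th powers, the inequality passes to integrals, with the same argument on both sides of
    [p = 2]. *)
Lemma powR_unif_convex p e : 1 < p -> 0 < e -> exists2 K, 0 <= K & forall a b,
  `|a - b| `^ p <= e * (`|a| `^ p + `|b| `^ p) +
    K * ((`|a| `^ p + `|b| `^ p) / 2 - `|(a + b) / 2| `^ p).
Proof.
move=> p1 e0; have p0 : 0 < p by lra.
have [c c0 gap] := powR_midpoint_gap p1.
pose th := e `^ p^-1; have th0 : 0 < th by rewrite powR_gt0.
pose K := 2 `^ p / (c * th ^+ 2).
have cth : 0 < c * th ^+ 2 by rewrite mulr_gt0// exprn_gt0.
have K0 : 0 <= K by rewrite divr_ge0 ?powR_ge0// ltW.
exists K => // a b.
wlog ab : a b / `|a| <= `|b|.
  move=> H; have [/H//|/ltW/H] := leP `|a| `|b|.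
  by rewrite distrC [`|b| `^ p + _]addrC [b + a]addrC.
have [b0|bn0] := eqVneq b 0.
  have -> : a = 0 by apply/normr0_eq0/le_anti; rewrite normr_ge0 (le_trans ab)// b0 normr0.
  rewrite b0 !(subr0, addr0, mul0r, normr0) powR0 ?gt_eqF//.
  by rewrite !(subr0, addr0, mul0r, mulr0).
pose x := a / b.
have x1 : `|x| <= 1 by rewrite normrM normfV ler_pdivrMr ?normr_gt0// mul1r.
have /andP[x1' x1''] : -1 <= x <= 1 by rewrite -ler_norml.
have gx := gap _ x1' x1''.
have aE : a = b * x by rewrite mulrC divfK.
have key : `|1 - x| `^ p <= e * (1 + `|x| `^ p) +
    K * ((1 + `|x| `^ p) / 2 - `|(1 + x) / 2| `^ p).
  have g0 : 0 <= (1 + `|x| `^ p) / 2 - `|(1 + x) / 2| `^ p.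
    by apply: le_trans gx; rewrite mulr_ge0 ?sqr_ge0// ltW.
  have xp := powR_ge0 `|x| p.
  have [small|big] := leP (`|1 - x| `^ p) e.
    apply: (le_trans small); have := mulr_ge0 K0 g0; nra.
  rewrite ger0_norm in big *; last lra.
  have thx : th <= 1 - x.
    have thp : th `^ p = e by rewrite -powRrM mulVf ?powRr1 ?gt_eqF// ltW.
    rewrite leNgt; apply/negP => h; move: big; rewrite ltNge => /negP; apply.
    rewrite -thp; apply: ltW; apply: gt0_ltr_powR; rewrite ?nnegrE//; last exact: ltW.
    lra.
  have x2 : (1 - x) `^ p <= 2 `^ p by apply: ge0_ler_powR; rewrite ?nnegrE//; lra.
  apply: (le_trans x2).
  have : c * th ^+ 2 <= (1 + `|x| `^ p) / 2 - `|(1 + x) / 2| `^ p.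
    by apply: le_trans gx; rewrite ler_pM2l// !expr2; nra.
  move=> /(ler_wpM2l K0); rewrite {1}/K divfK ?gt_eqF//.
  have : 0 <= e * (1 + `|x| `^ p) by rewrite mulr_ge0 ?addr_ge0// ltW.
  lra.
have E z : `|b * z| `^ p = `|b| `^ p * `|z| `^ p by rewrite normrM powRM.
have -> : a - b = - (b * (1 - x)) by rewrite aE; ring.
have -> : (a + b) / 2 = b * ((1 + x) / 2) by rewrite aE; field.
rewrite normrN aE !E.
have := ler_wpM2l (powR_ge0 `|b| p) key; lra.
Qed.

End real_powers.

Lemma powR_near1 (R : realType) (p e : R) : 1 < p -> 0 < e ->
  exists2 d, 0 < d & forall x, 0 <= x ->
    (x <= 1 + d -> x `^ p <= 1 + e) /\ (1 - d <= x -> 1 - e <= x `^ p).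
Proof.
move=> p1 e0; have p0 : 0 < p by lra.
pose d := e / (p * (1 + e)).
have pe0 : 0 < p * (1 + e) by rewrite mulr_gt0//; lra.
have d0 : 0 < d by rewrite divr_gt0.
have dE : p * d * (1 + e) = e by rewrite /d; field; rewrite !gt_eqF//; lra.
exists d => // x x0; split=> xd.
  apply: (@le_trans _ _ ((1 + d) `^ p)).
    by apply: ge0_ler_powR; rewrite ?nnegrE//; lra.
  pose y := (1 + d)^-1; have d10 : 0 < 1 + d by lra.
  have y0 : 0 <= y by rewrite invr_ge0 ltW.
  have yd : (1 + d) * y = 1 by rewrite mulfV// gt_eqF.
  have := powR_bernoulli (ltW p1) y0.
  have : (1 + d) `^ p * y `^ p = 1 by rewrite -powRM ?(ltW d10)// yd powR1.
  have : 0 <= (1 + d) `^ p by exact: powR_ge0.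
  set A := (1 + d) `^ p; set B := y `^ p => A0 AB B1.
  have y1 : 1 - d <= y by nra.
  have : 1 - p * d <= B by nra.
  move=> h; have : A * (1 - p * d) <= 1 by rewrite -[leRHS]AB; apply: ler_wpM2l.
  have : (1 - p * d) * (1 + e) = 1 by lra.
  have : 0 < 1 + e by lra.
  nra.
have := powR_bernoulli (ltW p1) x0.
have : p * d <= e by nra.
nra.
Qed.

(** * Uniform convexity and uniform smoothness from inequalities in p-th powers *)

Section geometry.
Context (R : realType) (X : normedModType R) (p : R).
Hypothesis p1 : 1 < p.

Let p0 : 0 < p. Proof. by apply: lt_trans p1. Qed.

Let le_of_powR (x y : R) : 0 <= x -> 0 <= y -> x `^ p <= y `^ p -> x <= y.
Proof.
move=> x0 y0; apply: contraTT; rewrite -!ltNge => yx.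
by apply: gt0_ltr_powR.
Qed.

Lemma uniformly_convex_powR :
  (forall e, 0 < e -> exists2 K, 0 <= K & forall f g : X,
    `|f - g| `^ p <= e * (`|f| `^ p + `|g| `^ p) +
      K * ((`|f| `^ p + `|g| `^ p) / 2 - `|2^-1 *: (f + g)| `^ p)) ->
  forall e, 0 < e -> exists2 d, 0 < d & forall u v : X,
  `|u| <= 1 + d -> `|v| <= 1 + d -> 2 - d <= `|u + v| -> `|u - v| <= e.
Proof.
move=> Xuc e e0; have ep0 : 0 < e `^ p by rewrite powR_gt0.
have [K K0 H] := Xuc (e `^ p / 8) ltac:(by rewrite divr_gt0).
pose e1 := Num.min 1 (e `^ p / (4 * (K + 1))).
have K1 : 0 < K + 1 by lra.
have e10 : 0 < e1 by rewrite lt_min ltr01 divr_gt0// mulr_gt0.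
have e11 : e1 <= 1 by rewrite ge_min lexx.
have e1K : e1 * (4 * (K + 1)) <= e `^ p.
  by rewrite -ler_pdivlMr ?mulr_gt0// ge_min lexx orbT.
have [d1 d10 Hd] := powR_near1 p1 e10.
exists d1 => // u v ud vd uvd.
apply: le_of_powR => //; first exact: ltW.
apply: (le_trans (H u v)).
have u1 := (Hd _ (normr_ge0 u)).1 ud.
have v1 := (Hd _ (normr_ge0 v)).1 vd.
have m1 : 1 - e1 <= `|2^-1 *: (u + v)| `^ p.
  apply: (Hd _ (normr_ge0 _)).2; rewrite normrZ ger0_norm ?invr_ge0//.
  lra.
have h1 : e `^ p / 8 * (`|u| `^ p + `|v| `^ p) <= e `^ p / 8 * 4.
  by rewrite ler_wpM2l ?divr_ge0 ?powR_ge0//; lra.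
have h2 : K * ((`|u| `^ p + `|v| `^ p) / 2 - `|2^-1 *: (u + v)| `^ p) <= K * (2 * e1).
  by rewrite ler_wpM2l//; lra.
lra.
Qed.

Variable J : X -> X -> R.
Hypothesis Jdual_lin : forall f a g h, J f (a *: g + h) = a * J f g + J f h.
Hypothesis Jdual_diag : forall f, J f f = `|f| `^ p.
Hypothesis Jdual_young : forall f g,
  p * J f g <= `|g| `^ p + (p - 1) * `|f| `^ p.
Hypothesis Jdual_unif_continuous : forall e, 0 < e -> exists2 t0, 0 < t0 &
  forall t, 0 <= t -> t <= t0 -> forall f g,
    J (f + t *: g) g - J f g <= e * (`|f| `^ p + `|g| `^ p).

Let Jdualr0 f : J f 0 = 0.
Proof. by have := Jdual_lin f (-1) 0 0; rewrite scaler0 addr0 mulN1r addNr. Qed.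

Let JdualrZ a f z : J f (a *: z) = a * J f z.
Proof. by have := Jdual_lin f a z 0; rewrite Jdualr0 !addr0. Qed.

Let Jdual_le_unit e f z : `|f| `^ p <= 1 + e -> 0 <= e -> J f z <= (1 + e) * `|z|.
Proof.
move=> fe e0; have [->|z0] := eqVneq z 0.
  by rewrite Jdualr0 normr0 mulr0.
have zp : 0 < `|z| by rewrite normr_gt0.
have := Jdual_young f (`|z|^-1 *: z).
rewrite JdualrZ normrZ normfV normr_id mulVf ?gt_eqF// powR1 => h.
rewrite -ler_pdivrMr// mulrC -(ler_pM2l p0).
have : (p - 1) * `|f| `^ p <= (p - 1) * (1 + e).
  by rewrite ler_wpM2l// subr_ge0 ltW.
lra.
Qed.

Let JdualrN f z : J f (- z) = - J f z.
Proof.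
by rewrite -scaleN1r JdualrZ mulN1r.
Qed.

Lemma Jdual_le e : 0 < e -> exists2 d, 0 < d &
  forall x, `|x| <= 1 + d -> forall z, `|J x z| <= (1 + e) * `|z|.
Proof.
move=> e0; have [d1 d10 Hd] := powR_near1 p1 e0.
exists d1 => // x xd z; have xp := (Hd _ (normr_ge0 x)).1 xd.
rewrite ler_norml; apply/andP; split; last exact: Jdual_le_unit (ltW e0).
by rewrite lerNl -JdualrN -(normrN z); apply: Jdual_le_unit (ltW e0).
Qed.

Lemma Jdual_diag_ge e : 0 < e -> exists2 d, 0 < d &
  forall x, 1 - d <= `|x| -> 1 - e <= J x x.
Proof.
move=> e0; have [d1 d10 Hd] := powR_near1 p1 e0.
by exists d1 => // x xd; rewrite Jdual_diag; apply: (Hd _ _).2.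
Qed.

(** Young's inequality at [x + t z] and the uniform continuity of [J] bound [|x + t z|] by
    [1 + t J x z], up to errors small against [t]. For an almost norming [phi], the number
    [phi x + t phi z] is at most about [|x + t z|]; division by [t] gives [phi z <= J x z + e] for
    unit [z], and [- z] gives the other side. *)
Lemma Jdual_unique e : 0 < e -> exists2 d, 0 < d &
  forall x (phi : X -> R), (forall a u v, phi (a *: u + v) = a * phi u + phi v) ->
    (forall z, `|phi z| <= (1 + d) * `|z|) -> `|x| <= 1 + d -> 1 - d <= phi x ->
    forall z, `|phi z - J x z| <= e * `|z|.
Proof.
move=> e0; have s0 : 0 < e / 24 by rewrite divr_gt0.
have [t t0 Ht] := Jdual_unif_continuous s0.
(* Small against [t e], because errors of size [e1] end up divided by [t]. *)
pose e1 := Num.min 1 (t * e / 16).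
have te0 : 0 < t * e by rewrite mulr_gt0.
have e10 : 0 < e1 by rewrite lt_min ltr01 divr_gt0.
have e11 : e1 <= 1 by rewrite ge_min lexx.
have e1t : e1 <= t * e / 16 by rewrite ge_min lexx orbT.
have [d1 d10 Hd] := powR_near1 p1 e10.
pose d2 := Num.min d1 (Num.min e1 (e / 16)).
have d20 : 0 < d2 by rewrite lt_min d10/= lt_min e10 divr_gt0.
have d21 : d2 <= d1 by rewrite ge_min lexx.
have d2e1 : d2 <= e1 by rewrite /d2 ge_min ge_min lexx orbT.
have d2e : d2 <= e / 16 by rewrite /d2 ge_min ge_min lexx !orbT.
exists d2 => // x phi philin phib xd phix.
have xp : `|x| `^ p <= 1 + e1.
  by apply: (Hd _ (normr_ge0 _)).1; lra.
have key z : `|z| = 1 -> phi z - J x z <= e.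
  move=> z1.
  have y_young := Jdual_young (x + t *: z) x.
  have Jy : J (x + t *: z) x = `|x + t *: z| `^ p - t * J (x + t *: z) z.
    have := Jdual_lin (x + t *: z) t z x; rewrite [t *: z + x]addrC Jdual_diag.
    by move=> ->; rewrite [t * _ + _]addrC addrK.
  have Hy := Ht _ (ltW t0) (lexx t) x z.
  rewrite z1 powR1 in Hy.
  have Jz : J (x + t *: z) z <= J x z + 3 * (e / 24).
    have xp3 : `|x| `^ p + 1 <= 3 by move: xp e11; lra.
    have : e / 24 * (`|x| `^ p + 1) <= e / 24 * 3 by rewrite ler_wpM2l ?(ltW s0).
    move: Hy; lra.
  have Jxz : J x z <= 2.
    by have := @Jdual_le_unit e1 x z xp (ltW e10); rewrite z1; move: e11; lra.
  have yb : `|x + t *: z| <= 1 + e1 + t * (J x z + e / 8).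
    have := powR_bernoulli (ltW p1) (normr_ge0 (x + t *: z)).
    rewrite Jy in y_young.
    have : t * J (x + t *: z) z <= t * (J x z + e / 8).
      by rewrite ler_pM2l//; move: Jz; lra.
    set Y := `|x + t *: z|; set Yp := Y `^ p in y_young *.
    set A := t * (J x z + e / 8); move=> hA hB.
    rewrite -(ler_pM2l p0).
    have : p * (t * J (x + t *: z) z) <= p * A by rewrite ler_pM2l.
    have : e1 <= p * e1 by rewrite ler_peMl ?ltW.
    by move: hA hB y_young xp; lra.
  have phiy : phi (x + t *: z) = phi x + t * phi z.
    by rewrite addrC philin addrC.
  have := phib (x + t *: z); rewrite phiy => /(le_trans (ler_norm _)) h.
  have d1y : (1 + d2) * `|x + t *: z| <= (1 + d2) * (1 + e1 + t * (J x z + e / 8)).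
    by rewrite ler_wpM2l// addr_ge0// ltW.
  rewrite -(ler_pM2l t0).
  have q1 : d2 * (t * J x z) <= d2 * (t * 2) by rewrite !ler_pM2l.
  have q2 : t * d2 <= t * (e / 16) by rewrite ler_pM2l.
  have q3 : d2 * (t * e) <= 1 * (t * e) by rewrite ler_pM2r// (le_trans d2e1).
  have q4 : d2 * e1 <= d2 * 1 by rewrite ler_pM2l.
  by move: q1 q2 q3 q4 d1y h phix e1t d2e1 te0; lra.
have phi0 : phi 0 = 0.
  by have := philin (-1) 0 0; rewrite scaler0 addr0 mulN1r addNr.
have phiZ a z : phi (a *: z) = a * phi z.
  by have := philin a z 0; rewrite phi0 !addr0.
have key2 z : phi z - J x z <= e * `|z|.
  have [->|z0] := eqVneq z 0.
    by rewrite phi0 Jdualr0 normr0 mulr0 subrr.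
  have zp : 0 < `|z| by rewrite normr_gt0.
  have := key (`|z|^-1 *: z); rewrite normrZ normfV normr_id mulVf ?gt_eqF//.
  by move=> /(_ erefl); rewrite phiZ JdualrZ -mulrBr mulrC ler_pdivrMr.
move=> z; rewrite ler_norml; apply/andP; split; last exact: key2.
have := key2 (- z); rewrite normrN -scaleN1r phiZ JdualrZ; lra.
Qed.

End geometry.

(** * The vector of minimal norm asymptotic to a given one *)

Section minimal_norm.
Context (R : realType) (X : normedModType R) (T : R -> {linear X -> X}).

Hypothesis T_add : forall s t, 0 <= s -> 0 <= t -> forall x,
  T (s + t) x = T s (T t x).
Hypothesis T_contr : forall e : R, 0 < e -> exists2 r0, 0 <= r0 &
  forall r, r0 <= r -> forall x, `|T r x| <= (1 + e) * `|x|.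
Hypothesis X_unif_convex : forall e : R, 0 < e -> exists2 d, 0 < d &
  forall u v : X, `|u| <= 1 + d -> `|v| <= 1 + d -> 2 - d <= `|u + v| ->
    `|u - v| <= e.
Hypothesis X_complete : forall u : nat -> X,
  (forall e, 0 < e -> exists N, forall m n, (N <= m)%N -> (N <= n)%N ->
    `|u m - u n| <= e) ->
  exists l, forall e, 0 < e -> exists N, forall n, (N <= n)%N -> `|u n - l| <= e.
Hypothesis incr_vanish : forall t, 0 <= t -> asbound T 0 (incr T t).

Definition asymptotic x c := forall e : R, 0 < e ->
  exists2 r0, 0 <= r0 & forall r, r0 <= r -> `|T r (x - c)| <= e.

Lemma asymptotic_refl x : asymptotic x x.
Proof. by move=> e e0; exists 0 => // r _; rewrite subrr raddf0 normr0 ltW. Qed.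

Lemma asymptotic_mid x c c' : asymptotic x c -> asymptotic x c' ->
  asymptotic x (2^-1 *: (c + c')).
Proof.
move=> xc xc' e e0.
have [r0 r00 H] := xc e e0; have [r1 r10 H'] := xc' e e0.
exists (r0 + r1) => [|r rr]; first by rewrite addr_ge0.
have -> : x - 2^-1 *: (c + c') = 2^-1 *: ((x - c) + (x - c')).
  have {1}-> : x = 2^-1 *: (x + x).
    by rewrite scalerDr -scalerDl (_ : 2^-1 + 2^-1 = 1) ?scale1r//; lra.
  by rewrite -scalerBr; congr (_ *: _); rewrite opprD addrACA.
rewrite linearZ/= normrZ ger0_norm ?invr_ge0// raddfD.
have h1 : `|T r (x - c)| <= e by apply: H; lra.
have h2 : `|T r (x - c')| <= e by apply: H'; lra.
have := ler_normD (T r (x - c)) (T r (x - c')); lra.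
Qed.

Lemma asymptotic_closed x y : (forall e, 0 < e -> exists2 c, asymptotic x c & `|c - y| <= e) ->
  asymptotic x y.
Proof.
move=> H e e0; have e30 : 0 < e / 3 by rewrite divr_gt0.
have [c xc cy] := H _ e30; have [r0 r00 H0] := xc _ e30.
have [r1 r10 H1] := T_contr ltr01.
exists (r0 + r1) => [|r rr]; first by rewrite addr_ge0.
have -> : x - y = (x - c) + (c - y) by rewrite addrA subrK.
rewrite raddfD.
have h0 : `|T r (x - c)| <= e / 3 by apply: H0; lra.
have h1 : `|T r (c - y)| <= (1 + 1) * `|c - y| by apply: H1; lra.
have := ler_normD (T r (x - c)) (T r (c - y)); lra.
Qed.

Lemma asymptotic_T t x c : 0 <= t -> asymptotic x c -> asymptotic x (T t c).
Proof.
move=> t0 xc e e0; have [r0 r00 H0] := xc _ (divr_gt0 e0 (ltr0n R 2)).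
have e20 : 0 < e / 2 / (1 + `|c|) by rewrite !divr_gt0// ltr_wpDr.
have [r1 r10 H1] := incr_vanish t0 e20.
exists (r0 + r1) => [|r rr]; first by rewrite addr_ge0.
have -> : x - T t c = (x - c) - incr T t c by rewrite incrE opprB addrA subrK.
rewrite raddfB.
have h0 : `|T r (x - c)| <= e / 2 by apply: H0; lra.
have h1 : `|T r (incr T t c)| <= (0 + e / 2 / (1 + `|c|)) * `|c| by apply: H1; lra.
have h2 : (0 + e / 2 / (1 + `|c|)) * `|c| <= e / 2.
  rewrite add0r mulrAC ler_pdivrMr ?ltr_wpDr// ler_wpM2l//; last by rewrite lerDr.
  by rewrite divr_ge0// ltW.
have := ler_normB (T r (x - c)) (T r (incr T t c)); lra.
Qed.

(** The midpoint of two almost minimal elements is again in [K], hence of norm at least [l], and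
    uniform convexity, scaled by [l], brings the two together. This scaling needs [l > 0]; for
    [l = 0] both norms are small. *)
Lemma minimal_norm_unique (K : X -> Prop) (l : R) :
  (forall c c', K c -> K c' -> K (2^-1 *: (c + c'))) ->
  0 <= l -> (forall c, K c -> l <= `|c|) ->
  forall e, 0 < e -> exists2 d, 0 < d & forall u v, K u -> K v ->
    `|u| <= l + d -> `|v| <= l + d -> `|u - v| <= e.
Proof.
move=> Kmid l0 Kl e e0; have [lz|l_neq0] := eqVneq l 0.
  exists (e / 2) => [|u v _ _]; first by rewrite divr_gt0.
  by rewrite lz add0r => u2 v2; have := ler_normB u v; lra.
have lp : 0 < l by rewrite lt_neqAle eq_sym l_neq0.
have [d d0 H] := X_unif_convex (divr_gt0 e0 lp).
exists (l * d) => [|u v Ku Kv ul vl]; first by rewrite mulr_gt0.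
have nZ (z : X) : `|l^-1 *: z| = `|z| / l.
  by rewrite normrZ ger0_norm ?invr_ge0// mulrC.
have := H (l^-1 *: u) (l^-1 *: v); rewrite -scalerDr -scalerBr !nZ.
rewrite !ler_pdivrMr// ler_pdivlMr//.
move=> /(_ _ _ _); rewrite divfK ?gt_eqF//; apply.
- by rewrite mulrDl mul1r (mulrC d).
- by rewrite mulrDl mul1r (mulrC d).
have := Kl _ (Kmid _ _ Ku Kv); rewrite normrZ ger0_norm ?invr_ge0//.
by have := mulr_gt0 lp d0; lra.
Qed.

Lemma asymptotic_minimal x : exists2 y, asymptotic x y &
  forall e, 0 < e -> exists2 d, 0 < d & forall u, asymptotic x u ->
    `|u| <= `|y| + d -> `|u - y| <= e.
Proof.
pose N := [set `|c| | c in asymptotic x].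
have N_inf : has_inf N.
  split; first by exists `|x|; exists x => //; exact: asymptotic_refl.
  by exists 0 => _ [c _ <-].
pose l := inf N.
have l0 : 0 <= l by apply: lb_le_inf; [exact: N_inf.1|move=> _ [c _ <-]].
have Nl c : asymptotic x c -> l <= `|c|.
  by move=> xc; apply: ge_inf; [exact: N_inf.2|exists c].
have Huniq := minimal_norm_unique (@asymptotic_mid x) l0 Nl.
have ex n : exists c, asymptotic x c /\ `|c| <= l + n.+1%:R^-1.
  have n0 : 0 < n.+1%:R^-1 :> R by rewrite invr_gt0.
  by have [_ [c xc <-] /ltW cl] := inf_adherent n0 N_inf; exists c.
have [w Hw] := choice ex.
have small (d : R) : 0 < d -> exists n0, forall n, (n0 <= n)%N -> n.+1%:R^-1 <= d.
  move=> d0; exists (Num.truncn d^-1) => n n0n.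
  rewrite -[leRHS]invrK lef_pV2 ?posrE ?invr_gt0//.
  by apply/ltW/(lt_le_trans (truncnS_gt _)); rewrite ler_nat.
have [e e0|y Hy] := @X_complete w.
  have [d d0 H] := Huniq e e0; have [n0 Hn0] := small d d0.
  exists n0 => m n mn nn; apply: H; [exact: (Hw _).1|exact: (Hw _).1| |].
    by rewrite (le_trans (Hw _).2)// lerD2l Hn0.
  by rewrite (le_trans (Hw _).2)// lerD2l Hn0.
have xy : asymptotic x y.
  apply: asymptotic_closed => e e0; have [n0 Hn0] := Hy e e0.
  by exists (w n0); [exact: (Hw _).1|exact: Hn0].
have yl : `|y| <= l.
  apply/ler_addgt0Pr => e e0; have e20 : 0 < e / 2 by rewrite divr_gt0.
  have [n0 Hn0] := Hy _ e20; have [n1 Hn1] := small _ e20.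
  have h0 := Hn0 (maxn n0 n1) (leq_maxl _ _).
  have h1 := Hn1 (maxn n0 n1) (leq_maxr _ _).
  have h2 := le_trans (Hw (maxn n0 n1)).2 (lerD (lexx l) h1).
  have := ler_normB (w (maxn n0 n1)) (w (maxn n0 n1) - y).
  rewrite subKr; lra.
exists y => // e e0; have [d d0 H] := Huniq e e0.
exists d => // u xu uy; apply: H => //; first by rewrite (le_trans uy)// lerD2r.
by rewrite (le_trans yl)// lerDl ltW.
Qed.

(** For late [r], the vector [T r y] is still asymptotic to [x] and hardly longer than the minimal
    [y], so it is close to [y]; and [T r x] is close to [T r y]. *)
Lemma asymptotic_cvg x : exists y, forall e, 0 < e ->
  exists2 r0, 0 <= r0 & forall r, r0 <= r -> `|T r x - y| <= e.
Proof.
have [y xy Hy] := asymptotic_minimal x; exists y => e e0.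
have e20 : 0 < e / 2 by rewrite divr_gt0.
have [r0 r00 H0] := xy _ e20; have [d d0 Hd] := Hy _ e20.
have dy0 : 0 < d / (1 + `|y|) by rewrite divr_gt0// ltr_wpDr.
have [r1 r10 H1] := T_contr dy0.
exists (r0 + r1) => [|r rr]; first by rewrite addr_ge0.
have h0 : `|T r (x - y)| <= e / 2 by apply: H0; lra.
have h1 : `|T r y - y| <= e / 2.
  apply: Hd; first by apply: asymptotic_T => //; lra.
  have r1r : r1 <= r by lra.
  rewrite (le_trans (H1 r r1r y))// mulrDl mul1r lerD2l mulrAC.
  by rewrite ler_pdivrMr ?ltr_wpDr// ler_wpM2l ?(ltW d0)// lerDr.
have -> : T r x - y = T r (x - y) + (T r y - y) by rewrite raddfB addrA subrK.
by have := ler_normD (T r (x - y)) (T r y - y); lra.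
Qed.

End minimal_norm.

(** * Duality map and uniform convexity of L^p *)

Section Lp.
Context d (T : measurableType d) (R : realType) (mu : {measure set T -> \bar R}).
Variables (p : R) (p1 : 1 < p).

Local Notation Lp := (LspaceType mu (lt1_le1e p1)).
Local Notation Lfn := (LfunType mu (lt1_le1e p1)).
Local Notation pi := (@Lspace_pi d T R mu p%:E (lt1_le1e p1)).
Local Notation repr := (@Lspace_repr d T R mu p%:E (lt1_le1e p1)).
Local Notation integ h := (mu.-integrable setT (EFin \o h)).

Let p0 : 0 < p. Proof. by apply: lt_trans p1. Qed.

Lemma Lfun_measurable (F : Lfn) : measurable_fun setT (F : T -> R).
Proof. exact: measurable_funPT. Qed.

Lemma integrable_powR (F : Lfn) : integ (fun x => `|F x| `^ p).
Proof. by apply: Lfun_integrable => //; [exact: ltW|exact: LfunP]. Qed.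

Lemma Lp_normE (F : Lfn) : `|pi F| `^ p = \int[mu]_x (`|F x| `^ p).
Proof.
rewrite Lspace_normrE /Rintegral.
have := @powR_Lnorm _ _ _ mu (EFin \o F) p; rewrite gt_eqF// => /(_ isT).
by rewrite -finite_norm_fine poweR_EFin => /(congr1 fine).
Qed.

Lemma integ_le (g h : T -> R) : measurable_fun setT h -> integ g ->
  (forall x, `|h x| <= g x) -> integ h.
Proof.
move=> mh ig hg; apply: le_integrable ig => //.
  exact/measurable_EFinP.
by move=> x _ /=; rewrite lee_fin (le_trans (hg x))// ler_norm.
Qed.

Lemma integD (g h : T -> R) : integ g -> integ h -> integ (fun x => g x + h x).
Proof. by move=> ig ih; exact: (integrableD measurableT ig ih). Qed.

Lemma integZ a (h : T -> R) : integ h -> integ (fun x => a * h x).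
Proof. by move=> ih; exact: (integrableZl measurableT a ih). Qed.

Lemma integB (g h : T -> R) : integ g -> integ h -> integ (fun x => g x - h x).
Proof. by move=> ig ih; exact: (integrableB measurableT ig ih). Qed.

Lemma measurable_norm_powR r (h : T -> R) : measurable_fun setT h ->
  measurable_fun setT (fun x => `|h x| `^ r).
Proof.
move=> mh; apply: (measurableT_comp (measurable_powR _)).
exact: measurableT_comp.
Qed.

Lemma Lfun_exists (h : T -> R) : measurable_fun setT h ->
  integ (fun x => `|h x| `^ p) -> exists F : Lfn, forall x, F x = h x.
Proof.
move=> mh ih.
have hL : h \in hoelder.Lfun mu p%:E.
  apply/andP; split; rewrite inE//=.
  rewrite /finite_norm unlock /=.
  apply: poweR_lty; apply: integrable_lty => //.
by exists (Lfun_Sub (lt1_le1e p1) hL).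
Qed.

Lemma Lfun_le_exists (h : T -> R) (F G : Lfn) : measurable_fun setT h ->
  (forall x, `|h x| <= `|F x| + `|G x|) -> exists H : Lfn, forall x, H x = h x.
Proof.
move=> mh hFG; apply: Lfun_exists => //.
apply: (@integ_le (fun x => 2 `^ p * (`|F x| `^ p + `|G x| `^ p))).
- exact: measurable_norm_powR.
- by apply/integZ/integD; exact: integrable_powR.
move=> x; rewrite ger0_norm ?powR_ge0//.
pose M := Num.max `|F x| `|G x|.
have M0 : 0 <= M by rewrite le_max normr_ge0.
apply: (@le_trans _ _ ((2 * M) `^ p)).
  apply: ge0_ler_powR; rewrite ?nnegrE ?mulr_ge0 ?(ltW p0)//.
  have : `|F x| <= M by rewrite le_max lexx.
  have : `|G x| <= M by rewrite le_max lexx orbT.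
  have := hFG x; lra.
rewrite powRM// ler_wpM2l ?powR_ge0// /M maxEle.
by case: ifP => _; rewrite ?lerDl ?lerDr powR_ge0.
Qed.

Lemma measurable_spow r : 0 < r -> measurable_fun setT (@spow R r).
Proof.
move=> r0; rewrite (_ : spow r = fun a => if 0 <= a then a `^ r else - ((- a) `^ r)).
  apply: measurable_fun_ifT.
  - exact: measurable_fun_ler.
  - exact: measurable_powR.
  - apply: measurableT_comp => //; apply: (measurableT_comp (measurable_powR _)).
    exact: oppr_measurable.
apply/funext => a; case: ifPn => [a0|]; first by rewrite spow_ge0.
by rewrite -ltNge => a0; rewrite -[LHS]opprK -spowN spow_ge0 ?oppr_ge0 ?ltW.
Qed.

(** The usual factor [|f|^(2 - p)] is left out: [Jdual] is then the integral of a pointwise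
    expression, and its degree [p - 1] in [f], which differs from 1 for [p != 2], leads to the
    contradiction. On the unit sphere both versions agree. *)
Definition Jdual (f g : Lp) : R :=
  \int[mu]_x (spow (p - 1) (repr f x) * repr g x).

Lemma measurable_spow_mul (F G : T -> R) :
  measurable_fun setT F -> measurable_fun setT G ->
  measurable_fun setT (fun x => spow (p - 1) (F x) * G x).
Proof.
move=> mF mG; apply: measurable_funM => //.
by apply: (measurableT_comp (measurable_spow _)) => //; rewrite subr_gt0.
Qed.

Lemma integ_spow_mul (F G : Lfn) : integ (fun x => spow (p - 1) (F x) * G x).
Proof.
apply: (@integ_le (fun x => `|F x| `^ p + `|G x| `^ p)).
- by apply: measurable_spow_mul; exact: Lfun_measurable.
- by apply: integD; exact: integrable_powR.
by move=> x; exact: norm_spow_mul_le.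
Qed.

Lemma JdualE (F G : Lfn) :
  Jdual (pi F) (pi G) = \int[mu]_x (spow (p - 1) (F x) * G x).
Proof.
congr fine; apply: ae_eq_integral => //.
- by apply/measurable_EFinP/measurable_spow_mul; exact: Lfun_measurable.
- by apply/measurable_EFinP/measurable_spow_mul; exact: Lfun_measurable.
apply: filterS2 (Lspace_piK F) (Lspace_piK G) => x /(_ I) FE /(_ I) GE _.
congr (_%:E); congr (spow _ _ * _); [exact: FE|exact: GE].
Qed.

Lemma Lp_ind (P : Lp -> Prop) : (forall F, P (pi F)) -> forall f, P f.
Proof. by move=> PF f; rewrite -(Lspace_reprK f). Qed.

Lemma pi_lin a (F G : Lfn) : a *: pi F + pi G = pi (a *: F + G).
Proof. by rewrite Lspace_piD Lspace_piZ. Qed.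

Lemma Lfun_linE a (F G : Lfn) x : (a *: F + G) x = a * F x + G x.
Proof. by []. Qed.

Lemma Lfun_scaleE a (F : Lfn) x : (a *: F) x = a * F x.
Proof. by []. Qed.

Lemma Lfun_oppE (F : Lfn) x : (- F) x = - F x.
Proof. by []. Qed.

Lemma Jdual_lin f a g h : Jdual f (a *: g + h) = a * Jdual f g + Jdual f h.
Proof.
elim/Lp_ind: f => F; elim/Lp_ind: g => G; elim/Lp_ind: h => H.
rewrite pi_lin !JdualE -RintegralZl//; last exact: integ_spow_mul.
rewrite -RintegralD//; [|exact/integZ/integ_spow_mul|exact: integ_spow_mul].
by apply: eq_Rintegral => x _; rewrite Lfun_linE; ring.
Qed.

Lemma JdualN f g : Jdual (- f) g = - Jdual f g.
Proof.
elim/Lp_ind: f => F; elim/Lp_ind: g => G.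
have -> : - pi F = pi (- F) by rewrite -scaleN1r -Lspace_piZ scaleN1r.
rewrite !JdualE -[RHS]mulN1r -RintegralZl//; last exact: integ_spow_mul.
apply: eq_Rintegral => x _; rewrite Lfun_oppE spowN; ring.
Qed.

Lemma JdualZ c f g : 0 <= c -> Jdual (c *: f) g = c `^ (p - 1) * Jdual f g.
Proof.
move=> c0; elim/Lp_ind: f => F; elim/Lp_ind: g => G.
rewrite -Lspace_piZ !JdualE -RintegralZl//; last exact: integ_spow_mul.
apply: eq_Rintegral => x _; rewrite Lfun_scaleE.
by rewrite spowM// ?mulrA// subr_gt0.
Qed.

Lemma Jdual_diag f : Jdual f f = `|f| `^ p.
Proof.
elim/Lp_ind: f => F; rewrite JdualE Lp_normE.
by apply: eq_Rintegral => x _; exact: spow_mulr.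
Qed.

Lemma Jdual_young f g : p * Jdual f g <= `|g| `^ p + (p - 1) * `|f| `^ p.
Proof.
elim/Lp_ind: f => F; elim/Lp_ind: g => G.
have iF := integrable_powR F; have iG := integrable_powR G.
rewrite JdualE !Lp_normE -!RintegralZl//; last exact: integ_spow_mul.
rewrite -RintegralD//; last exact: integZ.
apply: le_Rintegral => //.
- exact/integZ/integ_spow_mul.
- exact/integD/integZ.
by move=> x _; exact: spow_young.
Qed.

Lemma Jdual_unif_continuous e : 0 < e -> exists2 t0, 0 < t0 &
  forall t, 0 <= t -> t <= t0 -> forall f g,
    Jdual (f + t *: g) g - Jdual f g <= e * (`|f| `^ p + `|g| `^ p).
Proof.
move=> e0; have [t0 t00 H] := spow_unif_continuous p1 e0.
exists t0 => // t t_ge0 tt0; elim/Lp_ind => F; elim/Lp_ind => G.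
have iF := integrable_powR F; have iG := integrable_powR G.
rewrite [pi F + _]addrC pi_lin !JdualE !Lp_normE -RintegralD//.
rewrite -RintegralB//; [|exact: integ_spow_mul|exact: integ_spow_mul].
rewrite -RintegralZl//; last exact: integD.
apply: le_Rintegral => //.
- by apply: integB; exact: integ_spow_mul.
- exact/integZ/integD.
move=> x _; rewrite -mulrBl Lfun_linE [t * _ + _]addrC.
exact: H.
Qed.

Lemma Lp_unif_convex e : 0 < e -> exists2 K, 0 <= K & forall f g : Lp,
  `|f - g| `^ p <= e * (`|f| `^ p + `|g| `^ p) +
    K * ((`|f| `^ p + `|g| `^ p) / 2 - `|2^-1 *: (f + g)| `^ p).
Proof.
move=> e0; have [K K0 H] := powR_unif_convex p1 e0.
exists K => //; elim/Lp_ind => F; elim/Lp_ind => G.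
have iF := integrable_powR F; have iG := integrable_powR G.
have -> : pi F - pi G = pi (F - G).
  by rewrite addrC -scaleN1r pi_lin scaleN1r addrC.
rewrite -Lspace_piD -Lspace_piZ !Lp_normE -RintegralD// [_ / 2]mulrC.
have iFG : integ (fun x => `|F x| `^ p + `|G x| `^ p) by exact: integD.
rewrite -!RintegralZl//.
have iM : integ (fun x => 2^-1 * (`|F x| `^ p + `|G x| `^ p) -
    `|(2^-1 *: (F + G)) x| `^ p).
  by apply: integB; [exact: integZ|exact: integrable_powR].
rewrite -RintegralB//; [|exact: integZ|exact: integrable_powR].
rewrite -RintegralZl// -RintegralD//; [|exact: integZ|exact: integZ].
apply: le_Rintegral => //; first exact: integrable_powR.
  by apply: integD; exact: integZ.
move=> x _; have := H (F x) (G x).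
by rewrite [_ / 2]mulrC [(F x + _) / 2]mulrC.
Qed.

Lemma Lspace_piB (F G : Lfn) : pi (F - G) = pi F - pi G.
Proof. by rewrite Lspace_piD; congr (_ + _); rewrite -scaleN1r Lspace_piZ scaleN1r. Qed.

End Lp.

(** * Harmonic pairs of unit vectors do not exist in L^p for p different from 2 *)

Lemma le_of_dominated (R : realDomainType) (k e' eps t A B : R) :
  0 < k -> 0 <= e' -> `|eps| = 1 -> 0 <= B -> A <= B + 1 ->
  2 * e' <= k -> k * B <= eps * t -> `|t| <= e' * A -> k * B <= 2 * e'.
Proof.
move=> k0 e'0 eps1 B0 AB e'k kB tA.
have h1 : eps * t <= `|t| by rewrite (le_trans (ler_norm _))// normrM eps1 mul1r.
have h2 : e' * A <= e' * (B + 1) by rewrite ler_wpM2l.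
have h3 : 2 * e' * B <= k * B by rewrite ler_wpM2r.
lra.
Qed.

(** The second term is twice the minimum of [|a|] and [|b|]. *)
Lemma norm_le_abs_diff (R : realDomainType) (a b : R) :
  `|a| <= `| `|a| - `|b| | + `| `|a + b| - `|b - a| |.
Proof.
have h1 := ler_norm (`|a| - `|b|).
have h2 := ler_norm (`|a + b| - `|b - a|).
have h3 := ler_norm (- (`|a| - `|b|)); rewrite normrN in h3.
have h4 := ler_norm (- (`|a + b| - `|b - a|)); rewrite normrN in h4.
move: h1 h2 h3 h4; set A := `| `|a| - `|b| |; set B := `| `|a + b| - `|b - a| |.
case: (ger0P a) => ha; case: (ger0P b) => hb; case: (ger0P (a + b)) => hab;
  case: (ger0P (b - a)) => hba; lra.
Qed.

Section no_harmonic.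
Context d (T : measurableType d) (R : realType) (mu : {measure set T -> \bar R}).
Variables (p : R) (p1 : 1 < p).

Local Notation Lp := (LspaceType mu (lt1_le1e p1)).
Local Notation Lfn := (LfunType mu (lt1_le1e p1)).
Local Notation pi := (@Lspace_pi d T R mu p%:E (lt1_le1e p1)).
Local Notation J := (@Jdual d T R mu p p1).
Local Notation integ h := (mu.-integrable setT (EFin \o h)).

Let p0 : 0 < p. Proof. by apply: lt_trans p1. Qed.

Let piN (F : Lfn) : pi (- F) = - pi F.
Proof. by rewrite -scaleN1r Lspace_piZ scaleN1r. Qed.

Let Lfun_subE (F G : Lfn) x : (F - G) x = F x - G x.
Proof. by []. Qed.

(** The test vector is [F - G] cut off to the set where [F] and [G] have the same sign; there the
    pointwise inequality holds, and elsewhere both sides vanish. *)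
Lemma test_same_sign (c k eps : R) (F G : Lfn) :
  (forall a b, 0 <= a * b ->
    k * `|a - b| `^ p <=
      eps * ((spow (p - 1) a - spow (p - 1) b - c * spow (p - 1) (a - b)) * (a - b))) ->
  exists H : Lfn, (forall x, 0 <= F x * G x -> H x = F x - G x) /\
    k * `|pi H| `^ p <=
      eps * (J (pi F) (pi H) - J (pi G) (pi H) - c * J (pi F - pi G) (pi H)).
Proof.
move=> Hk; have r0 : 0 < p - 1 by rewrite subr_gt0.
pose h x := if 0 <= F x * G x then F x - G x else 0.
have mF := Lfun_measurable F; have mG := Lfun_measurable G.
have [H HE] : exists H : Lfn, forall x, H x = h x.
  apply: (@Lfun_le_exists _ _ _ _ _ _ h F G).
  - apply: measurable_fun_ifT => //.
    + by apply: measurable_fun_ler => //; exact: measurable_funM.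
    + exact: measurable_funB.
  - move=> x; rewrite /h; case: ifP => _; first exact: ler_normB.
    by rewrite normr0 addr_ge0.
exists H; split=> [x FG|]; first by rewrite HE /h FG.
rewrite -Lspace_piB !JdualE Lp_normE.
have iH := integrable_powR H.
have iFH := integ_spow_mul F H; have iGH := integ_spow_mul G H.
have iFGH := integ_spow_mul (F - G) H.
rewrite -RintegralZl// -[c * _]RintegralZl// -RintegralB//.
rewrite -RintegralB//; [|exact: integB|exact: integZ].
rewrite -[eps * _]RintegralZl//; last by apply: integB; [exact: integB|exact: integZ].
apply: le_Rintegral => //; first exact: integZ.
  by apply/integZ/integB; [exact: integB|exact: integZ].
move=> x _; rewrite Lfun_subE HE /h; case: ifPn => FG.
  by apply: le_trans (Hk _ _ FG) _; rewrite le_eqVlt; apply/orP; left; apply/eqP; ring.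
by rewrite normr0 powR0 ?gt_eqF// !mulr0 !subr0 mulr0.
Qed.

Variable s2 : R.
Hypothesis s2_sqr : s2 * s2 = 2.
Hypothesis s2_gt1 : 1 < s2.
Hypothesis p_neq2 : p != 2.

(** By homogeneity, the right-hand sides in [harmonic] are [c] times [J (f + g)] and [c] times
    [J (g - f)]. *)
Let c := s2 * s2^-1 `^ (p - 1).

Let s2V0 : 0 < s2^-1.
Proof. by rewrite invr_gt0 (lt_trans ltr01 s2_gt1). Qed.

Let s2_le2 : s2 <= 2.
Proof. by move: s2_gt1 s2_sqr; nra. Qed.

(* [c] is [s2] to the power [2 - p], so it exceeds 1 exactly when [p < 2], that is, when
   [spow (p - 1)] is subadditive on arguments of the same sign. *)
Let sign_gap : exists k eps : R, [/\ 0 < k, `|eps| = 1 & forall a b, 0 <= a * b ->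
    k * `|a - b| `^ p <=
      eps * ((spow (p - 1) a - spow (p - 1) b - c * spow (p - 1) (a - b)) * (a - b))].
Proof.
have cE : c = s2^-1 `^ (p - 2).
  rewrite /c -mulr_powRB1 ?(ltW s2V0) ?subr_gt0//.
  rewrite mulVKf ?gt_eqF ?(lt_trans ltr01 s2_gt1)//; congr (_ `^ _); lra.
have s2V1 : s2^-1 < 1 by rewrite invf_lt1// (lt_trans ltr01 s2_gt1).
have powlt1 r : 0 < r -> s2^-1 `^ r < 1.
  move=> r0; have := @gt0_ltr_powR _ r r0 s2^-1 1.
  by rewrite !nnegrE powR1 (ltW s2V0); exact.
have [p_lt2|p_gt2|//] := ltgtP p 2; last by move/eqP: p_neq2.
  have c1 : 1 < c.
    rewrite cE (_ : p - 2 = - (2 - p)); last by ring.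
    rewrite powRN invf_gt1 ?powR_gt0//; apply: powlt1; lra.
  exists (c - 1), (-1); split=> [||a b ab]; [lra|by rewrite normrN normr1|].
  have := spow_diff_mul_le p1 (ltW p_lt2) ab.
  rewrite -(spow_mulr (a - b) p1); lra.
have c1 : c < 1 by rewrite cE powlt1//; lra.
exists (1 - c), 1; split=> [||a b ab]; [lra|by rewrite normr1|].
have := spow_diff_mul_ge (ltW p_gt2) ab.
rewrite -(spow_mulr (a - b) p1); lra.
Qed.

Let le_powR1 (t : R) : 0 <= t -> t <= t `^ p + 1.
Proof.
move=> t0; have := powR_ge0 t p; have [t1|/ltW t1] := leP t 1; first lra.
have := le1r_powR t1 (ltW p1); lra.
Qed.

(** The second condition of [harmonic], tested on [h1], controls [G - F] where the signs agree; the
    first, tested on [h2], controls [F + G] where they differ. In both cases this is the difference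
    of [|F|] and [|G|] up to sign. *)
Lemma harmonic_abs_close (F G : nat -> Lfn) :
  harmonic J s2 (fun n => pi (F n)) (fun n => pi (G n)) ->
  forall e, 0 < e -> \forall n \near \oo,
    integ (fun x => `| `|F n x| - `|G n x| | `^ p) /\
    \int[mu]_x (`| `|F n x| - `|G n x| | `^ p) <= e.
Proof.
move=> [H1 H2] e e0; have [k [eps [k0 eps1 gap]]] := sign_gap.
pose e' := k * Num.min (1 / 2) (e / 4).
have m0 : 0 < Num.min (1 / 2) (e / 4) by rewrite lt_min !divr_gt0.
have e'0 : 0 < e' by rewrite mulr_gt0.
have e'k : 2 * e' <= k.
  have : e' <= k * (1 / 2) by rewrite ler_pM2l// ge_min lexx.
  lra.
have ke2 : 2 * e' <= k * (e / 2).
  have : e' <= k * (e / 4) by rewrite ler_pM2l// ge_min lexx orbT.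
  lra.
apply: filterS2 (H1 e' e'0) (H2 e' e'0) => n {}H1 {}H2.
have [h1 [h1E h1le]] := test_same_sign (G n) (F n) gap.
have [h2 [h2E h2le]] := test_same_sign (F n) (- G n) gap.
have close (z : Lp) (t : R) : k * `|z| `^ p <= eps * t -> `|t| <= (0 + e') * `|z| ->
    `|z| `^ p <= e / 2.
  rewrite add0r => kz tz; rewrite -(ler_pM2l k0); apply: le_trans ke2.
  (* Absorption: with [B = |z|^p] and [|z| <= B + 1] one gets [k B <= e' (B + 1)], where [e' B] is
     at most half of the left side. *)
  apply: (le_of_dominated k0 (ltW e'0) eps1 _ (le_powR1 (normr_ge0 z)) e'k kz tz).
  exact: powR_ge0.
have z1 : `|pi h1| `^ p <= e / 2.
  apply: close h1le _; have := H2 (pi h1).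
  have E := JdualZ (pi (G n) - pi (F n)) (pi h1) (ltW s2V0).
  by rewrite E mulrA.
have z2 : `|pi h2| `^ p <= e / 2.
  apply: close h2le _; have := H1 (pi h2).
  have E := JdualZ (pi (F n) + pi (G n)) (pi h2) (ltW s2V0).
  have EN : J (pi (- G n)) (pi h2) = - J (pi (G n)) (pi h2) by rewrite piN JdualN.
  have E2 : pi (F n) - pi (- G n) = pi (F n) + pi (G n) by rewrite piN opprK.
  by rewrite E EN E2 opprK mulrA.
rewrite !Lp_normE in z1 z2.
have i1 := integrable_powR h1; have i2 := integrable_powR h2.
have mF := Lfun_measurable (F n); have mG := Lfun_measurable (G n).
have bound x : `| `|F n x| - `|G n x| | `^ p <= `|h1 x| `^ p + `|h2 x| `^ p.
  have hp1 := powR_ge0 `|h1 x| p; have hp2 := powR_ge0 `|h2 x| p.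
  have [FG|FG] := leP 0 (G n x * F n x).
    rewrite h1E// in hp1 *; apply: (@le_trans _ _ (`|G n x - F n x| `^ p)); last by rewrite lerDl.
    apply: ge0_ler_powR; rewrite ?nnegrE ?(ltW p0)//.
    by rewrite (distrC (G n x)) ler_dist_dist.
  have FG' : 0 <= F n x * (- G n) x by rewrite Lfun_oppE mulrN oppr_ge0 mulrC ltW.
  rewrite h2E// Lfun_oppE opprK; rewrite h2E// Lfun_oppE opprK in hp2.
  apply: (@le_trans _ _ (`|F n x + G n x| `^ p)); last by rewrite lerDr.
  apply: ge0_ler_powR; rewrite ?nnegrE ?(ltW p0)//.
  by have := ler_dist_dist (F n x) (- G n x); rewrite normrN opprK.
have ii : integ (fun x => `| `|F n x| - `|G n x| | `^ p).
  apply: integ_le (integD i1 i2) _.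
    apply: measurable_norm_powR; apply: measurable_funB; exact: measurableT_comp.
  by move=> x; rewrite ger0_norm ?powR_ge0.
split=> //.
apply: (@le_trans _ _ (\int[mu]_x (`|h1 x| `^ p + `|h2 x| `^ p))).
  by apply: le_Rintegral => //; exact: integD.
by rewrite (RintegralD measurableT i1 i2) [leRHS]splitr; exact: (lerD z1 z2).
Qed.

Lemma no_harmonic (u v : nat -> Lp) : unit_seq u -> harmonic J s2 u v ->
  harmonic J s2 (fun n => s2^-1 *: (u n + v n)) (fun n => s2^-1 *: (v n - u n)) ->
  False.
Proof.
move=> u1 h12 h34.
pose F n := Lspace_repr (u n); pose G n := Lspace_repr (v n).
have uE : u = (fun n => pi (F n)) by apply/funext => n; rewrite Lspace_reprK.
have vE : v = (fun n => pi (G n)) by apply/funext => n; rewrite Lspace_reprK.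
pose M n : Lfn := s2^-1 *: (F n + G n); pose K n : Lfn := s2^-1 *: (G n - F n).
have ME : (fun n => s2^-1 *: (u n + v n)) = (fun n => pi (M n)).
  by apply/funext => n; rewrite uE vE Lspace_piZ Lspace_piD.
have KE : (fun n => s2^-1 *: (v n - u n)) = (fun n => pi (K n)).
  by apply/funext => n; rewrite uE vE Lspace_piZ Lspace_piB.
rewrite ME KE in h34; rewrite uE vE in h12.
(* From [|a| <= A + s2 B <= 4 max (A, B)] below. With this [e] the integral of [|F n|^p] is at most
   [1 / 4], whereas it is eventually at least [1 / 2]. *)
pose C : R := 4 `^ p; have C0 : 0 < C by rewrite powR_gt0.
pose e : R := 1 / (8 * C); have e0 : 0 < e by rewrite divr_gt0// mulr_gt0.
have Ce : C * (e + e) = 1 / 4 by rewrite /e; field; rewrite gt_eqF.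
have quarter_lt_half : (1 / 4 : R) < 1 / 2 by lra.
have [l l0 Hl] := @powR_near1 R p (1 / 2) p1 ltac:(lra).
move/cvgrPdist_le/(_ l l0) : u1 => u1.
have : \forall n \near \oo, False.
  apply: filterS3 u1 (harmonic_abs_close h12 e0) (harmonic_abs_close h34 e0).
  move=> n un [i12 e12] [i34 e34].
  have {}un : 1 / 2 <= `|u n| `^ p.
    have := (Hl _ (normr_ge0 (u n))).2; rewrite (_ : 1 - 1 / 2 = 1 / 2); last by field.
    by apply; move: un; rewrite ler_distlC => /andP[].
  rewrite uE Lp_normE in un.
  have : \int[mu]_x (`|F n x| `^ p) <=
      \int[mu]_x (C * (`| `|F n x| - `|G n x| | `^ p + `| `|M n x| - `|K n x| | `^ p)).
    apply: le_Rintegral => //; first exact: integrable_powR.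
      exact/integZ/integD.
    move=> x _; set a := F n x; set b := G n x.
    have -> : M n x = s2^-1 * (a + b) by [].
    have -> : K n x = s2^-1 * (b - a) by [].
    set A := `| `|a| - `|b| |; set B := `| `|s2^-1 * (a + b)| - `|s2^-1 * (b - a)| |.
    have BE : `| `|a + b| - `|b - a| | = s2 * B.
      rewrite /B !normrM gtr0_norm// -mulrBr normrM gtr0_norm// mulVKf//.
      by rewrite gt_eqF// (lt_trans ltr01 s2_gt1).
    have A0 : 0 <= A := normr_ge0 _. have B0 : 0 <= B := normr_ge0 _.
    have aAB : `|a| <= A + s2 * B by rewrite -BE; exact: norm_le_abs_diff.
    have aAB2 : `|a| <= 4 * Num.max A B.
      have : A <= Num.max A B by rewrite le_max lexx.
      have : B <= Num.max A B by rewrite le_max lexx orbT.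
      have : s2 * B <= 2 * B by rewrite ler_wpM2r// s2_le2.
      lra.
    apply: (@le_trans _ _ ((4 * Num.max A B) `^ p)).
      have M0 : 0 <= 4 * Num.max A B by rewrite mulr_ge0// le_max A0.
      by apply: ge0_ler_powR aAB2; rewrite ?nnegrE ?(ltW p0).
    rewrite powRM ?le_max ?A0// ler_wpM2l ?(ltW C0)// maxEle.
    by case: ifP => _; rewrite ?lerDl ?lerDr powR_ge0.
  rewrite RintegralZl//; last exact: integD.
  rewrite (RintegralD measurableT i12 i34) => h.
  have h2 := le_trans un (le_trans h (ler_wpM2l (ltW C0) (lerD e12 e34))).
  by move: h2; rewrite Ce; apply/negP; rewrite -ltNge; exact: quarter_lt_half.
by case=> N _ /(_ N (leqnn N)).
Qed.

End no_harmonic.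

(** * Completeness of L^p *)

Lemma cvg_of_geometric_increments (R : realType) (f : nat -> R) (C : R) :
  (forall k, `|f k.+1 - f k| <= C * 2^-1 ^+ k) -> cvgn f.
Proof.
move=> fC.
have C0 : 0 <= C by have := fC 0%N; rewrite expr0 mulr1; apply: le_trans.
have cv : cvgn (series (fun k => f k.+1 - f k)).
  apply: normed_cvg; apply: (@series_le_cvg _ _ (geometric C 2^-1)).
  - by move=> n; exact: normr_ge0.
  - by move=> n; rewrite /geometric mulr_ge0// exprn_ge0.
  - exact: fC.
  - by apply: is_cvg_geometric_series; rewrite ger0_norm// invf_lt1// ltr1n.
have -> : f = (fun n => f 0%N + series (fun k => f k.+1 - f k) n).
  by apply/funext => n; rewrite /series /= telescope_sumr// addrC subrK.
by apply: is_cvgD => //; exact: is_cvg_cst.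
Qed.

Lemma limn_einf_le (R : realType) (u : nat -> \bar R) (c : \bar R) (K : nat) :
  (forall k, (K <= k)%N -> (u k <= c)%E) -> (limn_einf u <= c)%E.
Proof.
move=> uc; rewrite limn_einf_lim; apply: lime_le; first exact: is_cvg_einfs.
apply: nearW => n; apply: (@le_trans _ _ (u (maxn n K))).
  by apply: ereal_inf_lbound; exists (maxn n K) => //=; exact: leq_maxl.
by apply: uc; exact: leq_maxr.
Qed.

Lemma limn_einf_ge (R : realType) (u : nat -> \bar R) (c : \bar R) :
  (\forall k \near \oo, (c <= u k)%E) -> (c <= limn_einf u)%E.
Proof.
move=> [K _ uc]; rewrite limn_einf_lim; apply: lime_ge; first exact: is_cvg_einfs.
exists K => // n /= Kn; apply: le_ereal_inf_tmp => _ [k /= nk <-].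
by apply: uc; exact: leq_trans Kn nk.
Qed.

(* Tangent line inequality: only lower semicontinuity of the power is needed. *)
Lemma norm_powR_le_limn_einf (R : realType) (p : R) (f : nat -> R) (a : R) :
  1 < p -> f @ \oo --> a ->
  ((`|a| `^ p)%:E <= limn_einf (fun k => (`|f k| `^ p)%:E))%E.
Proof.
move=> p1 fa; apply/lee_addgt0Pr => e e0.
rewrite -leeBlDr//; apply: limn_einf_ge.
have cv : p * (`|a| `^ (p - 1) * `|f k|) @[k --> \oo] --> p * (`|a| `^ (p - 1) * `|a|).
  by apply: cvgMr; apply: cvgMr; exact: cvg_norm.
have /cvgrPdist_lt/(_ e e0) := cv; apply: filterS => k /ltW.
rewrite ler_norml -EFinB lee_fin => /andP[_].
have := powR_young p1 (normr_ge0 a) (normr_ge0 (f k)).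
have -> : `|a| `^ (p - 1) * `|a| = `|a| `^ p by rewrite mulrC mulr_powRB1//; lra.
by lra.
Qed.

Section Lp_complete.
Context d (T : measurableType d) (R : realType) (mu : {measure set T -> \bar R}).
Variables (p : R) (p1 : 1 < p).

Local Notation Lp := (LspaceType mu (lt1_le1e p1)).
Local Notation Lfn := (LfunType mu (lt1_le1e p1)).
Local Notation pi := (@Lspace_pi d T R mu p%:E (lt1_le1e p1)).
Local Notation integ h := (mu.-integrable setT (EFin \o h)).

Let p0 : 0 < p. Proof. by apply: lt_trans p1. Qed.

Lemma Lp_norm_integral (F : Lfn) :
  (\int[mu]_x (`|F x| `^ p)%:E = (`|pi F| `^ p)%:E)%E.
Proof.
rewrite Lp_normE /Rintegral fineK//.
exact: (integrable_fin_num measurableT (integrable_powR F)).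
Qed.

(** The weighted series of p-th powers has integral at most 1, hence is finite almost everywhere.
    Where it is finite its terms are bounded, so the increments of [F k x] decay like [2^-k]. *)
Lemma summable_ae_cvg (F : nat -> Lfn) :
  (forall k, (2 ^+ k) `^ p * `|pi (F k.+1 - F k)| `^ p <= 1 / (2 ^ k.+1)%:R) ->
  {ae mu, forall x, cvgn (fun k => F k x)}.
Proof.
move=> FE.
pose q k x := (2 ^+ k) `^ p * `|F k.+1 x - F k x| `^ p.
have q0 k x : 0 <= q k x by rewrite mulr_ge0 ?powR_ge0.
have iq k : integ (q k) by apply: integZ; exact: (integrable_powR (F k.+1 - F k)).
have mq k : measurable_fun setT (EFin \o q k) by exact: measurable_int (iq k).
pose G x := (\sum_(0 <= k <oo) (q k x)%:E)%E.
have iG : (\int[mu]_x G x <= 1%:E)%E.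
  rewrite /G integral_nneseries//; last by move=> k x _; rewrite lee_fin.
  apply: le_trans (@epsilon_trick0 R 1 xpredT ler01).
  apply: lee_nneseries => [k _ _|k _].
    by apply: integral_ge0 => x _; rewrite lee_fin.
  have -> : (\int[mu]_x (q k x)%:E = ((2 ^+ k) `^ p * `|pi (F k.+1 - F k)| `^ p)%:E)%E.
    rewrite EFinM -Lp_norm_integral -ge0_integralZl ?lee_fin ?powR_ge0//.
    by apply/measurable_EFinP; apply: measurable_norm_powR; exact: Lfun_measurable.
  by rewrite lee_fin; exact: (FE k).
have mG : measurable_fun setT G.
  have q0E k x : [set: T] x -> true -> (0 <= (q k x)%:E)%E by rewrite lee_fin.
  exact: (ge0_emeasurable_sum q0E (fun k _ => mq k)).
have G0 x : (0 <= G x)%E by apply: nneseries_ge0 => k _ _; rewrite lee_fin.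
have IG : mu.-integrable setT G.
  apply/integrableP; split=> //.
  under eq_integral do rewrite gee0_abs//.
  by rewrite (le_lt_trans iG)// ltry.
have := integrable_ae measurableT IG; apply: filterS => x /(_ I) Gfin.
pose M := fine (G x).
have qM k : q k x <= M.
  rewrite -lee_fin /M fineK//.
  have q0E j : (0 <= j)%N -> true -> (0 <= (q j x)%:E)%E by rewrite lee_fin.
  apply: le_trans (nneseries_lim_ge k.+1 q0E).
  by rewrite big_nat_recr//= leeDr// sume_ge0// => j _; rewrite lee_fin.
apply: (@cvg_of_geometric_increments _ _ (M + 1)) => k.
have dk : 2 ^+ k * `|F k.+1 x - F k x| <= M + 1.
  set t := 2 ^+ k * _; have t0 : 0 <= t by rewrite mulr_ge0 ?exprn_ge0.
  have tp : t `^ p <= M by rewrite powRM ?exprn_ge0//; exact: qM.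
  have M0 : 0 <= M by rewrite (le_trans _ tp)// powR_ge0.
  have [t1|/ltW t1] := leP t 1; first by rewrite (le_trans t1)// lerDr.
  by rewrite (le_trans (le1r_powR t1 (ltW p1)))// (le_trans tp)// lerDl.
by rewrite exprVn ler_pdivlMr ?exprn_gt0// mulrC.
Qed.

(** Serves to replace representatives by ones that converge at every point, whose limit is then
    measurable. *)
Lemma Lfun_eq0_on (F : Lfn) (N : set T) : measurable N -> mu N = 0%E ->
  exists H : Lfn, pi H = pi F /\ forall x, H x = \1_(~` N) x * F x.
Proof.
move=> mN N0.
have mh : measurable_fun setT (fun x => \1_(~` N) x * F x).
  apply: measurable_funM; last exact: Lfun_measurable.
  by apply: measurable_indic; exact: measurableC.
have [x|H HE] := @Lfun_le_exists _ _ _ mu _ p1 _ F F mh.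
  rewrite normrM indicE (le_trans (ler_piMl _ _) _) ?normr_ge0//.
    by case: (_ \in _); rewrite ?normr1 ?normr0.
  by rewrite lerDl.
exists H; split=> //; apply/Lspace_pi_eqP; exists N; split=> // x /=.
apply: contra_notP => xN _; rewrite HE indicE mem_set// mul1r//.
Qed.

Lemma Lp_fatou (H : nat -> Lfn) (A : Lfn) (h : T -> R) (c : R) K :
  (forall x, (H k x) @[k --> \oo] --> h x) ->
  (forall k, (K <= k)%N -> `|pi A - pi (H k)| `^ p <= c) ->
  (\int[mu]_x (`|A x - h x| `^ p)%:E <= c%:E)%E.
Proof.
move=> Hh Hc.
have mH k : measurable_fun setT (fun x => (`|A x - H k x| `^ p)%:E).
  apply/measurable_EFinP; apply: measurable_norm_powR.
  by apply: measurable_funB; exact: Lfun_measurable.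
have H0 k x : [set: T] x -> (0 <= (`|A x - H k x| `^ p)%:E)%E.
  by rewrite lee_fin powR_ge0.
have fA : (\int[mu]_x (`|A x - h x| `^ p)%:E <=
    \int[mu]_x limn_einf (fun k => (`|A x - H k x| `^ p)%:E))%E.
  apply: ge0_le_integral => //; last 2 first.
  - have -> : (fun x => limn_einf (fun k => (`|A x - H k x| `^ p)%:E)) =
        (fun x => - limn_esup (-%E \o (fun k => (`|A x - H k x| `^ p)%:E)))%E.
      by apply/funext => x; rewrite limn_esupN oppeK.
    apply: measurableT_comp => //; apply: measurable_fun_limn_esup => k.
    by apply: measurableT_comp => //; exact: mH.
  - move=> x _; apply: norm_powR_le_limn_einf => //.
    by apply: cvgB; [exact: cvg_cst|exact: Hh].
  - apply/measurable_EFinP; apply: measurable_norm_powR.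
    apply: measurable_funB; first exact: Lfun_measurable.
    by apply: (measurable_fun_cvg (h := H)) => // m; exact: Lfun_measurable.
apply: (le_trans fA); apply: le_trans (fatou mu measurableT mH H0) _.
apply: (@limn_einf_le _ _ _ K) => k Kk.
have -> : (\int[mu]_x (`|A x - H k x| `^ p)%:E = (`|pi (A - H k)| `^ p)%:E)%E.
  by rewrite -Lp_norm_integral.
rewrite lee_fin; have := Hc k Kk.
by rewrite Lspace_piB.
Qed.

Lemma Lp_complete_fast (w : nat -> Lp) :
  (forall k, (2 ^+ k) `^ p * `|w k.+1 - w k| `^ p <= 1 / (2 ^ k.+1)%:R) ->
  (forall e, 0 < e -> exists N, forall m n, (N <= m)%N -> (N <= n)%N ->
    `|w m - w n| <= e) ->
  exists l, forall e, 0 < e -> exists N, forall n, (N <= n)%N -> `|w n - l| <= e.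
Proof.
move=> wfast wC; pose F k := @Lspace_repr d T R mu p%:E (lt1_le1e p1) (w k).
have FK k : pi (F k) = w k by exact: Lspace_reprK.
have [|N [mN N0 NF]] := @summable_ae_cvg F.
  by move=> k; rewrite Lspace_piB !FK.
have [H HF] := choice (fun k => Lfun_eq0_on (F k) mN N0).
pose h x := limn (fun k => H k x).
have Hh x : cvgn (fun k => H k x).
  have [xN|xN] := pselect (N x).
    have -> : (fun k => H k x) = cst 0.
      by apply/funext => k; rewrite (HF k).2 indicE memNset ?mul0r.
    by apply: (cvgP (0 : R)); exact: cvg_cst.
  have -> : (fun k => H k x) = (fun k => F k x).
    by apply/funext => k; rewrite (HF k).2 indicE mem_set ?mul1r.
  by apply: contrapT => xF; exact/xN/NF.
have dist e : 0 < e -> exists N', forall n, (N' <= n)%N ->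
    (\int[mu]_x (`|F n x - h x| `^ p)%:E <= (e `^ p)%:E)%E.
  move=> e0; have [N' HN'] := wC e e0; exists N' => n N'n.
  apply: (Lp_fatou (K := N') Hh) => k N'k.
  rewrite (HF k).1 !FK; apply: ge0_ler_powR; rewrite ?nnegrE//; first exact: ltW.
    exact: ltW.
  exact: HN'.
have [n0 /(_ _ (leqnn _)) Hn0] := dist 1 ltr01.
have mh : measurable_fun setT h.
  by apply: (measurable_fun_cvg (h := H)) => // m; exact: Lfun_measurable.
have mFh : measurable_fun setT (fun x => F n0 x - h x).
  by apply: measurable_funB => //; exact: Lfun_measurable.
have [|L LE] := @Lfun_exists _ _ _ mu _ p1 _ mFh.
  apply/integrableP; split.
    by apply/measurable_EFinP; exact: measurable_norm_powR.
  under eq_integral do rewrite /= ger0_norm ?powR_ge0//.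
  by rewrite (le_lt_trans Hn0)// ltry.
(* [F n0 - L] is [h]; Fatou's lemma gives p-integrability of the difference [F n0 - h], and that of
   [h] follows. *)
exists (pi (F n0 - L)) => e e0; have [N' HN'] := dist e e0.
exists N' => n /HN'.
have -> : (\int[mu]_x (`|F n x - h x| `^ p)%:E)%E =
    (`|w n - pi (F n0 - L)| `^ p)%:E.
  rewrite -FK -Lspace_piB -Lp_norm_integral; apply: eq_integral => x _.
  have -> // : (F n - (F n0 - L)) x = F n x - h x.
  by rewrite -[LHS]/(F n x - (F n0 x - L x)) LE; ring.
rewrite lee_fin; apply: contraTT; rewrite -!ltNge => elt.
by apply: gt0_ltr_powR => //; rewrite nnegrE; [exact: ltW|exact: normr_ge0].
Qed.

Lemma Lp_complete (u : nat -> Lp) :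
  (forall e, 0 < e -> exists N, forall m n, (N <= m)%N -> (N <= n)%N ->
    `|u m - u n| <= e) ->
  exists l, forall e, 0 < e -> exists N, forall n, (N <= n)%N -> `|u n - l| <= e.
Proof.
move=> uC.
(* Solves [(2^k dl k)^p = 1 / 2^(k + 1)], the rate asked for by [Lp_complete_fast]. *)
pose dl k : R := (1 / (2 ^ k.+1)%:R) `^ p^-1 / 2 ^+ k.
have dl0 k : 0 < dl k.
  by rewrite divr_gt0 ?exprn_gt0// powR_gt0// divr_gt0// ltr0n expn_gt0.
have [N HN] := choice (fun k => uC (dl k) (dl0 k)).
(* At least [k], and such that both [ix k] and [ix k.+1] are past [N k]. *)
pose ix k := (k + \max_(i < k.+1) N i)%N.
have ixN k : (N k <= ix k)%N.
  by rewrite (leq_trans _ (leq_addl _ _))// (leq_bigmax (Ordinal (ltnSn k))).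
have ixk k : (k <= ix k)%N by exact: leq_addr.
have ixS k : (N k <= ix k.+1)%N.
  have kS : (k < k.+2)%N by [].
  by rewrite (leq_trans _ (leq_addl _ _))// (leq_bigmax (Ordinal kS)).
have [k|e e0|l Hl] := @Lp_complete_fast (u \o ix).
- have := HN k _ _ (ixS k) (ixN k); rewrite /= /dl ler_pdivlMr ?exprn_gt0// => H.
  rewrite -powRM ?exprn_ge0// mulrC.
  have := @ge0_ler_powR R p (ltW p0) _ _ _ _ H.
  rewrite !nnegrE mulr_ge0 ?exprn_ge0// powR_ge0 => /(_ isT isT).
  by rewrite -powRrM mulVf ?gt_eqF// powRr1// divr_ge0.
- have [N' HN'] := uC e e0; exists N' => m n mN nN.
  by apply: HN'; exact: leq_trans (ixk _).
exists l => e e0; have e20 : 0 < e / 2 by rewrite divr_gt0.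
have [N1 HN1] := Hl _ e20; have [N2 HN2] := uC _ e20.
exists N2 => n N2n; pose k := maxn N1 N2.
have H1 := HN1 k (leq_maxl _ _).
have H2 := HN2 n (ix k) N2n (leq_trans (leq_maxr _ _) (ixk k)).
have -> : u n - l = (u n - u (ix k)) + (u (ix k) - l) by rewrite addrA subrK.
by rewrite (le_trans (ler_normD _ _))// (le_trans (lerD H2 H1))// -splitr.
Qed.

End Lp_complete.

(** * Vanishing of the asymptotic increments *)

Section incr_vanish.
Context (R : realType) (X : normedModType R) (T : R -> {linear X -> X}).

Lemma incr_vanish :
  (forall s t, 0 <= s -> 0 <= t -> forall x, T (s + t) x = T s (T t x)) ->
  (forall e : R, 0 < e -> exists2 r0, 0 <= r0 &
    forall r, r0 <= r -> forall x, `|T r x| <= (1 + e) * `|x|) ->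
  (forall x, T 0 x = x) ->
  (forall t, 0 <= t -> exists M, forall x, `|T t x| <= M * `|x|) ->
  (forall e : R, 0 < e -> exists2 h0, 0 < h0 &
    forall h, 0 < h -> h < h0 -> asbound T e (incr T h)) ->
  (forall e : R, 0 < e -> exists2 d, 0 < d & forall u v : X,
    `|u| <= 1 + d -> `|v| <= 1 + d -> 2 - d <= `|u + v| -> `|u - v| <= e) ->
  (forall Z : {linear X -> X},
    (exists M, forall z, `|Z z| <= M * `|z|) ->
    (forall e : R, 0 < e -> exists m, forall k, (m <= k)%N ->
      forall z, `|iter k Z z| <= (1 + e) * `|z|) ->
    (exists m, forall k, (m <= k)%N ->
      forall z, `|iter k Z (Z (Z z - z) - (Z z - z))| <= 3 * `|z|) ->
    (forall e : R, 0 < e -> exists2 y, `|y| = 1 & `|iter 4 Z y + y| <= e) -> False) ->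
  forall t, 0 <= t -> asbound T 0 (incr T t).
Proof.
move=> T_add T_contr T_id T_bdd T_cont Xuc no_anti.
apply: asbound0_incr => // u u0; apply: contrapT => Bu.
have [t [t0 B2 Bge]] := asbound_first_time T_add T_contr T_id T_cont
  (ex_intro2 _ _ u u0 Bu).
pose h := t / 2; have h0 : 0 < h by rewrite divr_gt0.
have h_ge0 := ltW h0.
have th : t = h + h by rewrite /h -splitr.
have iterT k z : iter k (T h) z = T (k%:R * h) z.
  elim: k => [|k IHk] /=; first by rewrite mul0r T_id.
  have -> : k.+1%:R * h = h + k%:R * h by rewrite -natr1; ring.
  by rewrite IHk T_add//; exact: mulr_ge0.
have large r : exists m, forall k, (m <= k)%N -> r <= k%:R * h.
  exists (Num.truncn (r / h)).+1 => k mk; rewrite -ler_pdivrMr//.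
  by apply/ltW/(lt_le_trans (truncnS_gt _)); rewrite ler_nat.
apply: (no_anti (T h)).
- by apply: T_bdd; exact: ltW.
- move=> e e0; have [r0 _ Hr] := T_contr e e0; have [m Hm] := large r0.
  by exists m => k mk z; rewrite iterT; apply: Hr; exact: Hm.
(* As [h <= t], the bound 2 holds at [h]. A slack of 1 gives the constant 3, still below
   [2 + sqrt 2]. *)
- have [|r0 _ Hr] := B2 h (ltW h0) _ 1 ltr01; first by rewrite th lerDl ltW.
  have [m Hm] := large r0; exists m => k mk z; rewrite iterT.
  by have := Hr _ (Hm k mk) z; rewrite (_ : 2 + 1 = 3)//; ring.
- move=> e e0.
  have [y y1 ye] := asbound_incr2_antiperiodic T_add T_contr Xuc (ltW t0)
    (B2 t (ltW t0) (lexx t)) Bge e0.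
  exists y => //; rewrite iterT.
  by have -> : 4%:R * h = t + t by rewrite th; ring.
Qed.

End incr_vanish.

(** * From operator norms and growth bounds to asymptotic bounds *)

Section operator_norm.
Context (R : realType) (X : normedModType R).

Lemma opnorm_le (f : {linear X -> X}) (c : R) : 0 <= c ->
  (opnorm f <= c%:E)%E -> forall x, `|f x| <= c * `|x|.
Proof.
move=> c0 fc x; have [->|x0] := eqVneq x 0; first by rewrite raddf0 !normr0 mulr0.
have xp : 0 < `|x| by rewrite normr_gt0.
rewrite -ler_pdivrMr// mulrC -[`|x|^-1]ger0_norm ?invr_ge0// -normrZ.
rewrite -lee_fin (le_trans _ fc)//; apply: ereal_sup_ubound; exists (`|x|^-1 *: x) => /=.
  by rewrite normrZ ger0_norm ?invr_ge0// mulVf ?gt_eqF.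
by rewrite linearZ.
Qed.

Lemma continuous_linear_lipschitz (f : {linear X -> X}) : continuous f ->
  exists M, forall x, `|f x| <= M * `|x|.
Proof.
move=> /linear_bounded_continuous/linear_boundedP fb.
by have [M HM] := filter_ex fb; exists M.
Qed.

Lemma limf_esup_lt (Y : choiceType) (F : filteredType Y) (G : set_system F)
    (f : F -> \bar R) (c : \bar R) :
  (limf_esup f G < c)%E -> exists2 A, G A & forall y, A y -> (f y < c)%E.
Proof.
move=> /ereal_inf_lt[_ [A GA <-] Ac]; exists A => // y Ay.
by apply: le_lt_trans Ac; apply: ereal_sup_ubound; exists y.
Qed.

End operator_norm.

Section semigroup.
Context (R : realType) (X : normedModType R) (S : R -> {linear X -> X}).

Lemma linear_of_morphism (P : X -> X) :
  (forall a x y, P (a *: x + y) = a *: P x + P y) ->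
  exists Q : {linear X -> X}, forall x, Q x = P x.
Proof.
move=> lP; pose Q : {linear X -> X} := HB.pack P (GRing.isLinear.Build R X X *:%R P lP).
by exists Q.
Qed.

Lemma pointwise_converges_strongly :
  (forall e : R, 0 < e -> exists2 r0, 0 <= r0 &
    forall r, r0 <= r -> forall x, `|S r x| <= (1 + e) * `|x|) ->
  (forall x, exists y, forall e, 0 < e ->
    exists2 r0, 0 <= r0 & forall r, r0 <= r -> `|S r x - y| <= e) ->
  converges_strongly S.
Proof.
move=> S_contr Sx; have [P HP] := choice Sx.
have cvP x : S t x @[t --> +oo] --> P x.
  apply/cvgrPdist_le => e e0; have [r0 _ Hr] := HP x e e0.
  by exists r0; split; [exact: num_real|move=> r /ltW /Hr; rewrite distrC].
have [Q QE] : exists Q : {linear X -> X}, forall x, Q x = P x.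
  apply: linear_of_morphism => a x y.
  have H : S t (a *: x + y) @[t --> +oo] --> a *: P x + P y.
    under eq_fun do rewrite linearP.
    by apply: cvgD; [apply: cvgZr; exact: cvP|exact: cvP].
  exact: (cvg_unique _ (cvP _) H).
exists Q => [|x]; last by rewrite QE.
apply/linear_bounded_continuous/linear_boundedP; exists 2; split; first exact: num_real.
move=> M M2 x; rewrite QE; apply: (@le_trans _ _ (2 * `|x|)); last by rewrite ler_wpM2r// ltW.
have [r0 _ Hr] := S_contr 1 ltr01.
apply/ler_addgt0Pr => e e0; have [r1 _ Hr1] := HP x e e0.
have h1 := Hr1 (Num.max r0 r1) _; have h2 := Hr (Num.max r0 r1) _ x.
rewrite !le_max !lexx orbT/= in h1 h2.
have := ler_normB (S (Num.max r0 r1) x) (S (Num.max r0 r1) x - P x).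
rewrite subKr => /le_trans; apply.
by apply: lerD; [have := h2 isT; rewrite -[1 + 1]/2|exact: h1].
Qed.

Lemma uac_eventually_le : uniformly_asymptotically_contractive S ->
  forall e : R, 0 < e -> exists2 r0, 0 <= r0 &
    forall r, r0 <= r -> forall x, `|S r x| <= (1 + e) * `|x|.
Proof.
move=> S_limsup e e0.
have e1 : (limf_esup (fun t => opnorm (S t)) +oo_R < (1 + e)%:E)%E.
  by rewrite (le_lt_trans S_limsup)// lte_fin ltrDl.
have [A [M [_ MA]] HA] := limf_esup_lt e1.
exists (Num.max 0 (M + 1)) => [|r]; first by rewrite le_max lexx.
rewrite ge_max => /andP[r0 rM]; apply: opnorm_le; first by rewrite addr_ge0// ltW.
by apply/ltW/HA/MA; rewrite (lt_le_trans _ rM)// ltrDl.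
Qed.

Hypothesis S_C0 : C0_semigroup S.
Hypothesis S_contr : forall e : R, 0 < e -> exists2 r0, 0 <= r0 &
  forall r, r0 <= r -> forall x, `|S r x| <= (1 + e) * `|x|.

(** Since [S (t + h) - S t = S t (S h - 1)], norm continuity at a single time [t] controls the
    increments at all later times. *)
Lemma asbound_incr_of_opnorm (t h e : R) : 0 <= t -> 0 <= h -> 0 <= e ->
  (opnorm (S (t + h)%R \- S t)%R <= e%:E)%E -> asbound S e (incr S h).
Proof.
move=> t0 h0 e0 /(opnorm_le e0) H.
apply: (@asbound_at _ _ _ (C0_add S_C0) S_contr t) => // x.
by have := H x; rewrite incrE linearB -[S t (S h x)](C0_add S_C0 t0 h0 x).
Qed.

Lemma enc_asbound : eventually_norm_continuous S ->
  forall e : R, 0 < e -> exists2 h0, 0 < h0 &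
    forall h, 0 < h -> h < h0 -> asbound S e (incr S h).
Proof.
move=> [t0 t00 H] e e0.
have [t t_gt t_ge0] : exists2 t, t0 < t & 0 <= t.
  by exists (t0 + 1); [rewrite ltrDl|rewrite addr_ge0].
have eE : (0%E < e%:E)%E by rewrite lte_fin.
have /nbhs_ballP[d /= d0 Hd] := H t t_gt _ (nbhs_open_ereal_lt eE).
exists d => // h h0 hd.
apply: (@asbound_incr_of_opnorm t) => //; [exact: ltW|exact: ltW|].
apply/ltW/Hd; rewrite /ball /= opprD addrA subrr add0r normrN.
by rewrite ger0_norm// ltW.
Qed.

Lemma nci_asbound : norm_continuous_at_infinity S -> fine (growth_bound S) = 0 ->
  forall e : R, 0 < e -> exists2 h0, 0 < h0 &
    forall h, 0 < h -> h < h0 -> asbound S e (incr S h).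
Proof.
move=> Hn g0 e e0; have eE : (0%E < e%:E)%E by rewrite lte_fin.
have := Hn _ (nbhs_open_ereal_lt eE); rewrite g0 => -[M [_ HM]].
pose t := Num.max 0 (M + 1).
have t0 : 0 <= t by rewrite le_max lexx.
have tM : M < t by rewrite lt_max ltrDl ltr01 orbT.
have [A /nbhs_ballP[d /= d0 Ad] HA] := limf_esup_lt (HM _ tM).
exists d => // h h0 hd; apply: (@asbound_incr_of_opnorm t) => //; [exact: ltW|exact: ltW|].
have hA : A h.
  apply: Ad; last by rewrite gt_eqF.
  by rewrite /ball /= sub0r normrN ger0_norm// ltW.
have := ltW (HA h hA); congr (opnorm _ <= _)%E.
by apply/funext => x; rewrite /rescaled /= !mul0r oppr0 expR0 !scale1r.
Qed.

(* If no exponential bound is available, the growth bound is [+oo] and its [fine] is also 0. *)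
Lemma growth_bound_dichotomy : (-oo < growth_bound S)%E ->
  fine (growth_bound S) = 0 \/ exists w M, w < 0 /\
    forall t, 0 <= t -> forall x, `|S t x| <= M * expR (w * t) * `|x|.
Proof.
move=> gb.
pose W := [set w : R | exists2 M : R, 1 <= M &
    forall t, 0 <= t -> (opnorm (S t) <= (M * expR (w * t))%:E)%E].
have [[w [M [M1 wM] w0]]|noneg] := pselect (exists2 w, W w & w < 0).
  right; exists w, M; split=> // t t0; apply: opnorm_le; last exact: wM.
  by rewrite mulr_ge0 ?expR_ge0// (le_trans ler01).
left; have [[w [M M1 wM]]|W0] := pselect (exists w, W w); last first.
  suff -> : growth_bound S = +oo%E by [].
  rewrite -ereal_inf0; congr ereal_inf.
  by rewrite -subset0 => y [v Wv _]; apply: W0; exists v.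
have gb_ge0 : (0 <= growth_bound S)%E.
  apply: le_ereal_inf_tmp => _ [v Wv <-]; rewrite lee_fin leNgt; apply/negP => v0.
  by apply: noneg; exists v.
suff W0 : W 0.
  have : (growth_bound S <= 0)%E by apply: ereal_inf_lbound; exists 0.
  by move=> gb_le0; rewrite (_ : growth_bound S = 0%E)//; apply/le_anti; rewrite gb_le0.
have [r0 r00 Hr] := S_contr ltr01.
(* The exponential bound is used only on [[0, r0]]; beyond [r0] the norms are at most 2. *)
exists (2 + M * expR (`|w| * r0)) => [|t t0].
  have : 0 <= M * expR (`|w| * r0) by rewrite mulr_ge0 ?expR_ge0// (le_trans ler01).
  by lra.
rewrite mul0r expR0 mulr1; have [tr|rt] := leP t r0.
  apply: (le_trans (wM t t0)); rewrite lee_fin; apply: ler_wpDl => //.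
  rewrite ler_wpM2l ?(le_trans ler01)// ler_expR.
  by rewrite (le_trans (ler_norm _))// normrM (ger0_norm t0) ler_wpM2l.
apply: ge_ereal_sup => _ [x /= x1 <-]; rewrite lee_fin.
rewrite (le_trans (Hr t (ltW rt) x))//; apply: (@le_trans _ _ 2).
  by rewrite -[leRHS]mulr1 ler_wpM2l.
by rewrite lerDl mulr_ge0 ?expR_ge0// (le_trans ler01).
Qed.

Lemma expR_decay_cvg w M : w < 0 ->
  (forall t, 0 <= t -> forall x, `|S t x| <= M * expR (w * t) * `|x|) ->
  forall x, exists y, forall e, 0 < e ->
    exists2 r0, 0 <= r0 & forall r, r0 <= r -> `|S r x - y| <= e.
Proof.
move=> w0 H x; exists 0 => e e0; pose C := `|M| * `|x| / e.
have C0 : 0 <= C by rewrite divr_ge0 ?mulr_ge0// ltW.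
exists (C / - w) => [|r rC]; first by rewrite divr_ge0// oppr_ge0 ltW.
have r0 : 0 <= r by rewrite (le_trans _ rC)// divr_ge0// oppr_ge0 ltW.
rewrite subr0 (le_trans (H r r0 x))//.
have E : 1 + C <= expR (- (w * r)).
  rewrite (le_trans _ (expR_ge1Dx _))// lerD2l -mulNr mulrC.
  by rewrite -ler_pdivrMr// oppr_gt0.
rewrite -[w * r]opprK expRN mulrAC ler_pdivrMr ?expR_gt0//.
apply: (@le_trans _ _ (`|M| * `|x|)); first by rewrite ler_wpM2r// ler_norm.
have -> : `|M| * `|x| = e * C by rewrite [RHS]mulrC divfK ?gt_eqF.
by rewrite ler_wpM2l ?ltW// (lt_le_trans _ E)// ltrDr.
Qed.

End semigroup.

(** * The semigroup on L^p *)

Section Lp_semigroup.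
Context d (T : measurableType d) (R : realType) (mu : {measure set T -> \bar R}).
Variables (p : R) (p1 : 1 < p).

Local Notation Lp := (LspaceType mu (lt1_le1e p1)).

Lemma Lp_uniformly_convex e : 0 < e -> exists2 d, 0 < d & forall u v : Lp,
  `|u| <= 1 + d -> `|v| <= 1 + d -> 2 - d <= `|u + v| -> `|u - v| <= e.
Proof. exact: (uniformly_convex_powR p1 (@Lp_unif_convex _ _ _ mu p p1)). Qed.

Lemma Lp_no_antiperiodic (Z : {linear Lp -> Lp}) : p != 2 ->
  (exists M, forall z, `|Z z| <= M * `|z|) ->
  (forall e : R, 0 < e -> exists m, forall k, (m <= k)%N ->
    forall z, `|iter k Z z| <= (1 + e) * `|z|) ->
  (exists m, forall k, (m <= k)%N ->
    forall z, `|iter k Z (Z (Z z - z) - (Z z - z))| <= 3 * `|z|) ->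
  (forall e : R, 0 < e -> exists2 y, `|y| = 1 & `|iter 4 Z y + y| <= e) -> False.
Proof.
move=> p2 Zb Zc Zi Za.
have s2_sqr : Num.sqrt 2 * Num.sqrt 2 = 2 :> R by rewrite -expr2 sqr_sqrtr.
have s2_gt1 : 1 < Num.sqrt 2 :> R by rewrite -[ltLHS]sqrtr1 ltr_sqrt// ltr1n.
pose J := @Jdual _ T R mu p p1.
have [u [v [u1 uv wv]]] := @antiperiodic_harmonic _ _ Z J
  (@Jdual_lin _ _ _ mu p p1) (@JdualN _ _ _ mu p p1)
  (Jdual_le p1 (@Jdual_lin _ _ _ mu p p1) (@Jdual_young _ _ _ mu p p1))
  (Jdual_diag_ge p1 (@Jdual_diag _ _ _ mu p p1))
  (Jdual_unique p1 (@Jdual_lin _ _ _ mu p p1) (@Jdual_diag _ _ _ mu p p1) (@Jdual_young _ _ _ mu p p1)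
    (@Jdual_unif_continuous _ _ _ mu p p1))
  _ s2_sqr s2_gt1 Zb Zc Zi Za.
exact: (no_harmonic s2_sqr s2_gt1 p2 u1 uv wv).
Qed.

End Lp_semigroup.

Theorem corollary4p7 (R : realType) (d : measure_display)
  (Omega : measurableType d) (mu : {measure set Omega -> \bar R})
  (p : R) (p_gt1 : 1 < p) (p_neq2 : p != 2)
  (S : R -> {linear LspaceType mu (lt1_le1e p_gt1) ->
                    LspaceType mu (lt1_le1e p_gt1)})
  (A : set (LspaceType mu (lt1_le1e p_gt1) * LspaceType mu (lt1_le1e p_gt1)))
  (S_C0 : C0_semigroup S) (S_gen : A = generator S)
  (S_contr : uniformly_asymptotically_contractive S)
  (S_cont : ((-oo < growth_bound S)%E /\ norm_continuous_at_infinity S) \/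
            eventually_norm_continuous S) :
  converges_strongly S.
Proof.
have S_le := uac_eventually_le S_contr.
apply: pointwise_converges_strongly => //.
have conv : (forall e : R, 0 < e -> exists2 h0, 0 < h0 &
      forall h, 0 < h -> h < h0 -> asbound S e (incr S h)) ->
    forall x, exists y, forall e, 0 < e ->
      exists2 r0, 0 <= r0 & forall r, r0 <= r -> `|S r x - y| <= e.
  move=> S_incr; apply: asymptotic_cvg => //.
  - exact: Lp_uniformly_convex.
  - exact: Lp_complete.
  - apply: incr_vanish => //; [exact: C0_add|exact: C0_id| | |].
    + by move=> t t0; apply/continuous_linear_lipschitz/C0_bounded.
    + exact: Lp_uniformly_convex.
    + by move=> Z; exact: Lp_no_antiperiodic.
case: S_cont => [[gb nci]|enc]; last by apply: conv; exact: enc_asbound.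
(* Either the rescaling in the definition of norm continuity at infinity is trivial, or the
   semigroup decays exponentially and converges to 0. *)
have [g0|[w [M [w0 wM]]]] := growth_bound_dichotomy S_le gb.
  by apply: conv; exact: nci_asbound.
exact: expR_decay_cvg w0 wM.
Qed.
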